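(* Let $0<q<1$ and let $n,d$ be positive integers with $n\le d/2$. For every $\lambda\in\Lambda_n$ the quantum dimension of the irreducible $\mathcal{U}_q(\mathfrak{gl}_d(\mathbb{C}))$-representation $V_\lambda^q$ is $$\begin{aligned}\mathrm{Dim}_{q}(V_{\lambda}^{q})&=q^{2(2n-d-1)|\lambda|-4(\rho,\lambda)}\prod_{i=1}^n\frac{\bigl(q^{2(1+\lambda_i+\rho_i)};q^2\bigr)_{d-2n}^2}{\bigl(q^{2(1+\rho_i)};q^2\bigr)_{d-2n}^2}\,\frac{1-q^{2(d-2n+1+2(\lambda_i+\rho_i))}}{1-q^{2(d-2n+1+2\rho_i)}}\\&\qquad\times\prod_{1\leq j<k\leq n}\frac{(1-q^{2(d-2n+1+\lambda_j+\lambda_k+\rho_j+\rho_k)})^2(1-q^{2(\lambda_j-\lambda_k+\rho_j-\rho_k)})^2}{(1-q^{2(d-2n+1+\rho_j+\rho_k)})^2(1-q^{2(\rho_j-\rho_k)})^2}.\end{aligned}$$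
   Context: $\Lambda_n$ is the set of partitions $\lambda=(\lambda_1\ge\dots\ge\lambda_n\ge0)$; $|\lambda|=\sum_i\lambda_i$; $\rho=(n-1,n-2,\dots,0)$, $(\rho,\lambda)=\sum_i\rho_i\lambda_i$; $(a;q)_j=\prod_{i=0}^{j-1}(1-aq^i)$. $\mathcal{U}_q$ is the quantized universal enveloping algebra of $\mathfrak{gl}_d(\mathbb{C})$, the complex unital algebra with generators $x_i,y_i$ ($1\le i\le d-1$) and $K_j^{\pm1}$ ($1\le j\le d$), with the $K_j$ commuting and invertible, $K_ix_jK_i^{-1}=q^{\delta_{i,j}-\delta_{i,j+1}}x_j$, $K_iy_jK_i^{-1}=q^{-\delta_{i,j}+\delta_{i,j+1}}y_j$, $[x_i,y_j]=\delta_{i,j}\frac{K_iK_{i+1}^{-1}-K_i^{-1}K_{i+1}}{q-q^{-1}}$, and the usual quantum Serre relations. It is a Hopf $*$-algebra with $\Delta(K_j)=K_j\otimes K_j$, $\Delta(x_j)=x_j\otimes1+K_jK_{j+1}^{-1}\otimes x_j$, $\Delta(y_j)=y_j\otimes K_j^{-1}K_{j+1}+1\otimes y_j$, and with (antilinear) $*$-structure $x_j^*=q^{-1}y_jK_jK_{j+1}^{-1}$, $y_j^*=qK_j^{-1}K_{j+1}x_j$, $(K_i^{\pm1})^*=K_i^{\pm1}$. The antipode is denoted $S$. A finite dimensional $\mathcal{U}_q$-representation $V$ is of type one if $V=\bigoplus_{\nu\in\mathbb{Z}^d}V[\nu]$ with $V[\nu]=\{v: K_jv=q^{\nu_j}v,\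 1\le j\le d\}$. The irreducible ones are, up to equivalence, the $L_\mu^q$ with $\mu\in P_d^+=\{\mu\in\mathbb{Z}^d:\mu_1\ge\cdots\ge\mu_d\}$, where $L_\mu^q$ has a nonzero highest weight vector $u_\mu\in L^q_\mu[\mu]$, $x_iu_\mu=0$ for all $i$. For $\lambda\in\Lambda_n$ put $\lambda^\natural=(\lambda_1,\dots,\lambda_n,0,\dots,0,-\lambda_n,\dots,-\lambda_1)\in P_d^+$ (with $d-2n$ zeros) and $V_\lambda^q:=L^q_{\lambda^\natural}$. (These are the irreducible representations with nonzero $\mathcal{U}_q(\mathfrak{gl}_{d-n}(\mathbb{C})\times\mathfrak{gl}_n(\mathbb{C}))$-invariant vectors.) Quantum dimension: the dual $V^*$ of a finite dimensional representation $V$ has action $(Xf)(v)=f(S(X)v)$. For $V$ irreducible of type one, let $\varphi:V\to V^{**}$ be the canonical linear isomorphism and equip $V$ with a scalar product that makes it $*$-unitary ($\langle Xv,w\rangle=\langle v,X^*w\rangle$). There is a unique positive definite linear isomorphism $F:V\to V$ such that $\mathrm{Tr}_V(F)=\mathrm{Tr}_V(F^{-1})>0$ and $\varphi\circ F:V\to V^{**}$ intertwines the $\mathcal{U}_q$-actions. Then $\mathrm{Dim}_q(V):=\mathrm{Tr}_V(F)$. *)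

(* Defs.v *)
From HB Require Import structures.
From mathcomp Require Import all_boot all_order all_algebra.
From mathcomp Require Import boolp classical_sets reals complex.

Set Implicit Arguments.
Unset Strict Implicit.
Unset Printing Implicit Defensive.
Import Order.TTheory GRing.Theory Num.Theory.
Local Open Scope ring_scope.
Local Open Scope complex_scope.
Local Open Scope quotient_scope.

(* Indices are 0-based: j : 'I_d stands for j + 1, and the Chevalley index
   i : 'I_d.-1 sits between idx_lo i = i and idx_hi i = i + 1 in 'I_d. *)
Lemma idx_hi_subproof d (i : 'I_d.-1) : (i.+1 < d)%N.
Proof. by rewrite -ltn_predRL. Qed.
Definition idx_lo d (i : 'I_d.-1) : 'I_d := widen_ord (leq_pred d) i.
Definition idx_hi d (i : 'I_d.-1) : 'I_d := Ordinal (idx_hi_subproof i).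

(* The algebra U_q is the quotient of the noncommutative polynomial
   expressions in the generators by the smallest congruence that contains the
   algebra axioms and the defining relations. *)

Inductive uq_gen (d : nat) : Type :=
  | GenX of 'I_d.-1 | GenY of 'I_d.-1 | GenK of 'I_d | GenKi of 'I_d.

Inductive uq_term (R : realType) (d : nat) : Type :=
  | TGen of uq_gen d
  | TZero
  | TOne
  | TAdd of uq_term R d & uq_term R d
  | TMul of uq_term R d & uq_term R d
  | TScale of R[i] & uq_term R d.

Arguments TGen {R d} _.
Arguments TZero {R d}.
Arguments TOne {R d}.

HB.instance Definition _ R d := gen_eqMixin (uq_term R d).
HB.instance Definition _ R d := gen_choiceMixin (uq_term R d).

Declare Scope uq_term_scope.
Delimit Scope uq_term_scope with uqt.
Bind Scope uq_term_scope with uq_term.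
Notation "s + t" := (TAdd s t) : uq_term_scope.
Notation "s * t" := (TMul s t) : uq_term_scope.
Notation "a *: t" := (TScale a%R t) : uq_term_scope.
Notation "s - t" := (TAdd s (TScale (- 1%R)%R t)) : uq_term_scope.
Notation "0" := TZero : uq_term_scope.
Notation "1" := TOne : uq_term_scope.
Local Notation tx i := (TGen (GenX i)).
Local Notation ty i := (TGen (GenY i)).
Local Notation tK j := (TGen (GenK j)).
Local Notation tKi j := (TGen (GenKi j)).

(* wt_exp j i = delta_{j,i} - delta_{j,i+1} *)
Definition wt_exp d (j : 'I_d) (i : 'I_d.-1) : int :=
  ((j == i :> nat) : nat)%:Z - ((j == i.+1 :> nat) : nat)%:Z.

Definition adjacent d (i j : 'I_d.-1) : bool :=
  (i == j.+1 :> nat) || (j == i.+1 :> nat).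

Inductive uq_rel (R : realType) (d : nat) (q : R) :
    uq_term R d -> uq_term R d -> Prop :=
  | RelKK j l : uq_rel q (tK j * tK l) (tK l * tK j)
  | RelKKi j : uq_rel q (tK j * tKi j) 1
  | RelKiK j : uq_rel q (tKi j * tK j) 1
  | RelKx j i :
      uq_rel q (tK j * tx i * tKi j) (q%:C ^ wt_exp j i *: tx i)
  | RelKy j i :
      uq_rel q (tK j * ty i * tKi j) (q%:C ^ (- wt_exp j i) *: ty i)
  | Relxy i j :
      uq_rel q (tx i * ty j - ty j * tx i)
        (((i == j)%:R / (q%:C - q%:C^-1))
           *: (tK (idx_lo i) * tKi (idx_hi i) - tKi (idx_lo i) * tK (idx_hi i)))
  | Relxx i j : i != j -> ~~ adjacent i j ->
      uq_rel q (tx i * tx j) (tx j * tx i)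
  | Relyy i j : i != j -> ~~ adjacent i j ->
      uq_rel q (ty i * ty j) (ty j * ty i)
  | RelSerrex i j : adjacent i j ->
      uq_rel q (tx i * tx i * tx j - (q%:C + q%:C^-1) *: (tx i * tx j * tx i)
                + tx j * tx i * tx i) 0
  | RelSerrey i j : adjacent i j ->
      uq_rel q (ty i * ty i * ty j - (q%:C + q%:C^-1) *: (ty i * ty j * ty i)
                + ty j * ty i * ty i) 0.

Inductive uq_cong (R : realType) (d : nat) (q : R) :
    uq_term R d -> uq_term R d -> Prop :=
  | CongRel s t : uq_rel q s t -> uq_cong q s t
  | CongRefl s : uq_cong q s s
  | CongSym s t : uq_cong q s t -> uq_cong q t s
  | CongTrans s t u : uq_cong q s t -> uq_cong q t u -> uq_cong q s u
  | CongAdd s s' t t' : uq_cong q s s' -> uq_cong q t t' ->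
      uq_cong q (s + t) (s' + t')
  | CongMul s s' t t' : uq_cong q s s' -> uq_cong q t t' ->
      uq_cong q (s * t) (s' * t')
  | CongScale a s s' : uq_cong q s s' -> uq_cong q (a *: s) (a *: s')
  | CongAddA s t u : uq_cong q (s + (t + u)) (s + t + u)
  | CongAddC s t : uq_cong q (s + t) (t + s)
  | CongAdd0 s : uq_cong q (0 + s) s
  | CongAddN s : uq_cong q ((- 1) *: s + s) 0
  | CongMulA s t u : uq_cong q (s * (t * u)) (s * t * u)
  | CongMul1l s : uq_cong q (1 * s) s
  | CongMul1r s : uq_cong q (s * 1) s
  | CongMulDl s t u : uq_cong q ((s + t) * u) (s * u + t * u)
  | CongMulDr s t u : uq_cong q (s * (t + u)) (s * t + s * u)
  | CongScaleA a b s : uq_cong q (a *: (b *: s)) ((a * b) *: s)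
  | CongScale1 s : uq_cong q (1 *: s) s
  | CongScaleDr a s t : uq_cong q (a *: (s + t)) (a *: s + a *: t)
  | CongScaleDl a b s : uq_cong q ((a + b) *: s) (a *: s + b *: s)
  | CongScaleAl a s t : uq_cong q (a *: (s * t)) ((a *: s) * t)
  | CongScaleAr a s t : uq_cong q (a *: (s * t)) (s * (a *: t)).

Section UqAlgebra.
Variables (R : realType) (d : nat) (q : R).
Local Notation C := R[i].
Local Notation term := (uq_term R d).

Definition uq_congb : rel term := fun s t => `[< uq_cong q s t >].

Lemma uq_congb_refl : reflexive uq_congb.
Proof. by move=> s; apply/asboolP; exact: CongRefl. Qed.
Lemma uq_congb_sym : symmetric uq_congb.
Proof. by move=> s t; apply/asboolP/asboolP; exact: CongSym. Qed.
Lemma uq_congb_trans : transitive uq_congb.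
Proof.
by move=> t s u /asboolP st /asboolP tu; apply/asboolP; exact: CongTrans tu.
Qed.
Canonical uq_equiv := EquivRel uq_congb
  uq_congb_refl uq_congb_sym uq_congb_trans.

Definition Uq : Type := {eq_quot uq_equiv}.
HB.instance Definition _ := Choice.on Uq.
HB.instance Definition _ := Quotient.on Uq.

Definition uq_pi (t : term) : Uq := \pi_Uq t.
Definition uq_repr (u : Uq) : term := repr u.

Lemma uq_reprK u : uq_pi (uq_repr u) = u.
Proof. exact: reprK. Qed.

Lemma uq_piP s t : uq_pi s = uq_pi t <-> uq_cong q s t.
Proof.
split=> [/eqmodP/asboolP //|st]; apply/eqmodP; exact/asboolP.
Qed.

Lemma uq_repr_pi t : uq_cong q (uq_repr (uq_pi t)) t.
Proof. by apply/uq_piP; rewrite uq_reprK. Qed.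

Lemma uq_ind (P : Uq -> Prop) : (forall t, P (uq_pi t)) -> forall u, P u.
Proof. by move=> H u; rewrite -(uq_reprK u). Qed.

Definition uq_zero : Uq := uq_pi 0.
Definition uq_one : Uq := uq_pi 1.
Definition uq_scale (a : C) (u : Uq) : Uq := uq_pi (a *: uq_repr u).
Definition uq_opp (u : Uq) : Uq := uq_scale (- 1) u.
Definition uq_add (u v : Uq) : Uq := uq_pi (uq_repr u + uq_repr v).
Definition uq_mul (u v : Uq) : Uq := uq_pi (uq_repr u * uq_repr v).

Lemma uq_scaleE a t : uq_scale a (uq_pi t) = uq_pi (a *: t).
Proof. by apply/uq_piP/CongScale/uq_repr_pi. Qed.
Lemma uq_addE s t : uq_add (uq_pi s) (uq_pi t) = uq_pi (s + t).
Proof. by apply/uq_piP/CongAdd; exact: uq_repr_pi. Qed.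
Lemma uq_mulE s t : uq_mul (uq_pi s) (uq_pi t) = uq_pi (s * t).
Proof. by apply/uq_piP/CongMul; exact: uq_repr_pi. Qed.

Let opE := (uq_scaleE, uq_addE, uq_mulE).

Lemma uq_addA : associative uq_add.
Proof.
elim/uq_ind=> s; elim/uq_ind=> t; elim/uq_ind=> u; rewrite !opE.
exact/uq_piP/CongAddA.
Qed.
Lemma uq_addC : commutative uq_add.
Proof.
by elim/uq_ind=> s; elim/uq_ind=> t; rewrite !opE; exact/uq_piP/CongAddC.
Qed.
Lemma uq_add0 : left_id uq_zero uq_add.
Proof. by elim/uq_ind=> s; rewrite !opE; exact/uq_piP/CongAdd0. Qed.
Lemma uq_addN : left_inverse uq_zero uq_opp uq_add.
Proof.
by elim/uq_ind=> s; rewrite /uq_opp !opE; exact/uq_piP/CongAddN.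
Qed.
HB.instance Definition _ :=
  GRing.isZmodule.Build Uq uq_addA uq_addC uq_add0 uq_addN.

Lemma uq_mulA : associative uq_mul.
Proof.
elim/uq_ind=> s; elim/uq_ind=> t; elim/uq_ind=> u; rewrite !opE.
exact/uq_piP/CongMulA.
Qed.
Lemma uq_mul1l : left_id uq_one uq_mul.
Proof. by elim/uq_ind=> s; rewrite !opE; exact/uq_piP/CongMul1l. Qed.
Lemma uq_mul1r : right_id uq_one uq_mul.
Proof. by elim/uq_ind=> s; rewrite !opE; exact/uq_piP/CongMul1r. Qed.
Lemma uq_mulDl : left_distributive uq_mul uq_add.
Proof.
elim/uq_ind=> s; elim/uq_ind=> t; elim/uq_ind=> u; rewrite !opE.
exact/uq_piP/CongMulDl.
Qed.
Lemma uq_mulDr : right_distributive uq_mul uq_add.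
Proof.
elim/uq_ind=> s; elim/uq_ind=> t; elim/uq_ind=> u; rewrite !opE.
exact/uq_piP/CongMulDr.
Qed.

Definition uq_counit_gen (g : uq_gen d) : C :=
  match g with GenX _ | GenY _ => 0 | GenK _ | GenKi _ => 1 end.
Fixpoint uq_counit_term (t : term) : C :=
  match t with
  | TGen g => uq_counit_gen g
  | TZero => 0
  | TOne => 1
  | TAdd s t => uq_counit_term s + uq_counit_term t
  | TMul s t => uq_counit_term s * uq_counit_term t
  | TScale a t => a * uq_counit_term t
  end.

Lemma uq_counit_cong s t :
  uq_cong q s t -> uq_counit_term s = uq_counit_term t.
Proof.
elim=> {s t} /=.
- by move=> s t []=> * /=;
    rewrite ?(mulr1, mul1r, mulr0, mul0r, subrr, addr0, oppr0, addNr).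
- by [].
- by [].
- by move=> s t u _ -> _ ->.
- by move=> s s' t t' _ -> _ ->.
- by move=> s s' t t' _ -> _ ->.
- by move=> a s s' _ ->.
- by move=> *; rewrite addrA.
- by move=> *; rewrite addrC.
- by move=> *; rewrite add0r.
- by move=> *; rewrite mulN1r addNr.
- by move=> *; rewrite mulrA.
- by move=> *; rewrite mul1r.
- by move=> *; rewrite mulr1.
- by move=> *; rewrite mulrDl.
- by move=> *; rewrite mulrDr.
- by move=> *; rewrite mulrA.
- by move=> *; rewrite mul1r.
- by move=> *; rewrite mulrDr.
- by move=> *; rewrite mulrDl.
- by move=> *; rewrite mulrA.
- by move=> *; rewrite mulrCA.
Qed.

Lemma uq_one_neq0 : uq_one != uq_zero.
Proof.
apply/eqP=> /uq_piP/uq_counit_cong /= /eqP; by rewrite oner_eq0.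
Qed.
HB.instance Definition _ := GRing.Zmodule_isNzRing.Build Uq
  uq_mulA uq_mul1l uq_mul1r uq_mulDl uq_mulDr uq_one_neq0.

Lemma uq_scaleA a b (u : Uq) : uq_scale a (uq_scale b u) = uq_scale (a * b) u.
Proof. by elim/uq_ind: u => s; rewrite !opE; exact/uq_piP/CongScaleA. Qed.
Lemma uq_scale1 : left_id 1 uq_scale.
Proof. by elim/uq_ind=> s; rewrite !opE; exact/uq_piP/CongScale1. Qed.
Lemma uq_scaleDr : right_distributive uq_scale +%R.
Proof.
move=> a; elim/uq_ind=> s; elim/uq_ind=> t.
rewrite -[_ + _]/(uq_add _ _) -[RHS]/(uq_add _ _) !opE.
exact/uq_piP/CongScaleDr.
Qed.
Lemma uq_scaleDl (u : Uq) : {morph uq_scale^~ u : a b / a + b}.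
Proof.
move=> a b; elim/uq_ind: u => s; rewrite -[RHS]/(uq_add _ _) !opE.
exact/uq_piP/CongScaleDl.
Qed.
HB.instance Definition _ := GRing.Zmodule_isLmodule.Build C Uq
  uq_scaleA uq_scale1 uq_scaleDr uq_scaleDl.

Lemma uq_scaleAl (a : C) (u v : Uq) : a *: (u * v) = (a *: u) * v.
Proof.
elim/uq_ind: u => s; elim/uq_ind: v => t.
rewrite -[LHS]/(uq_scale a (uq_mul _ _)) -[RHS]/(uq_mul (uq_scale a _) _) !opE.
exact/uq_piP/CongScaleAl.
Qed.
HB.instance Definition _ := GRing.Lmodule_isLalgebra.Build C Uq uq_scaleAl.

Lemma uq_scaleAr (a : C) (u v : Uq) : a *: (u * v) = u * (a *: v).
Proof.
elim/uq_ind: u => s; elim/uq_ind: v => t.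
rewrite -[LHS]/(uq_scale a (uq_mul _ _)) -[RHS]/(uq_mul _ (uq_scale a _)) !opE.
exact/uq_piP/CongScaleAr.
Qed.
HB.instance Definition _ := GRing.Lalgebra_isAlgebra.Build C Uq uq_scaleAr.

Lemma uq_piD s t : uq_pi (s + t) = uq_pi s + uq_pi t.
Proof. by rewrite -[RHS]/(uq_add _ _) opE. Qed.
Lemma uq_piM s t : uq_pi (s * t) = uq_pi s * uq_pi t.
Proof. by rewrite -[RHS]/(uq_mul _ _) opE. Qed.
Lemma uq_piZ a t : uq_pi (a *: t) = a *: uq_pi t.
Proof. by rewrite -[RHS]/(uq_scale _ _) opE. Qed.

Definition Uq_x (i : 'I_d.-1) : Uq := uq_pi (tx i).
Definition Uq_y (i : 'I_d.-1) : Uq := uq_pi (ty i).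
Definition Uq_K (j : 'I_d) : Uq := uq_pi (tK j).
Definition Uq_Ki (j : 'I_d) : Uq := uq_pi (tKi j).
(* k_i = K_i K_{i+1}^{-1} and its inverse *)
Definition Uq_k (i : 'I_d.-1) : Uq := Uq_K (idx_lo i) * Uq_Ki (idx_hi i).
Definition Uq_ki (i : 'I_d.-1) : Uq := Uq_Ki (idx_lo i) * Uq_K (idx_hi i).

(* The c-semilinear antimultiplicative extension of f : generators -> Uq. *)
Fixpoint anti_term (c : C -> C) (f : uq_gen d -> Uq) (t : term) : Uq :=
  match t with
  | TGen g => f g
  | TZero => 0
  | TOne => 1
  | TAdd s t => anti_term c f s + anti_term c f t
  | TMul s t => anti_term c f t * anti_term c f s
  | TScale a t => c a *: anti_term c f t
  end.

(* Values forced by the antipode axiom m (S (x) id) Delta = epsilon, i.e.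
   S(x_i) + S(k_i) x_i = 0 and S(y_i) k_i^{-1} + y_i = 0. *)
Definition antipode_gen (g : uq_gen d) : Uq :=
  match g with
  | GenX i => - (Uq_ki i * Uq_x i)
  | GenY i => - (Uq_y i * Uq_k i)
  | GenK j => Uq_Ki j
  | GenKi j => Uq_K j
  end.
Definition antipode (u : Uq) : Uq := anti_term id antipode_gen (uq_repr u).

Definition star_gen (g : uq_gen d) : Uq :=
  match g with
  | GenX i => q%:C^-1 *: (Uq_y i * Uq_k i)
  | GenY i => q%:C *: (Uq_ki i * Uq_x i)
  | GenK j => Uq_K j
  | GenKi j => Uq_Ki j
  end.
Definition star (u : Uq) : Uq := anti_term Num.conj star_gen (uq_repr u).

Lemma uq_piB s t : uq_pi (s - t) = uq_pi s - uq_pi t.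
Proof. by rewrite uq_piD uq_piZ scaleN1r. Qed.

Let piE := (uq_piB, uq_piD, uq_piM, uq_piZ).
Let uq_relP s t : uq_rel q s t -> uq_pi s = uq_pi t.
Proof. by move=> st; apply/uq_piP/CongRel. Qed.

Lemma Uq_KK j l : Uq_K j * Uq_K l = Uq_K l * Uq_K j.
Proof. by have := uq_relP (RelKK q j l); rewrite !piE. Qed.
Lemma Uq_KKi j : Uq_K j * Uq_Ki j = 1.
Proof. by have := uq_relP (RelKKi q j); rewrite !piE. Qed.
Lemma Uq_KiK j : Uq_Ki j * Uq_K j = 1.
Proof. by have := uq_relP (RelKiK q j); rewrite !piE. Qed.

Lemma Uq_Kx j i : Uq_K j * Uq_x i * Uq_Ki j = q%:C ^ wt_exp j i *: Uq_x i.
Proof. by have := uq_relP (RelKx q j i); rewrite !piE. Qed.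
Lemma Uq_Ky j i : Uq_K j * Uq_y i * Uq_Ki j = q%:C ^ (- wt_exp j i) *: Uq_y i.
Proof. by have := uq_relP (RelKy q j i); rewrite !piE. Qed.
Lemma Uq_xy i j : Uq_x i * Uq_y j - Uq_y j * Uq_x i =
  ((i == j)%:R / (q%:C - q%:C^-1)) *: (Uq_k i - Uq_ki i).
Proof. by have := uq_relP (Relxy q i j); rewrite !piE. Qed.
Lemma Uq_xx i j : i != j -> ~~ adjacent i j -> Uq_x i * Uq_x j = Uq_x j * Uq_x i.
Proof. by move=> ij nij; have := uq_relP (Relxx q ij nij); rewrite !piE. Qed.
Lemma Uq_yy i j : i != j -> ~~ adjacent i j -> Uq_y i * Uq_y j = Uq_y j * Uq_y i.
Proof. by move=> ij nij; have := uq_relP (Relyy q ij nij); rewrite !piE. Qed.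

Definition serre (z w : Uq) : Uq :=
  z * z * w - (q%:C + q%:C^-1) *: (z * w * z) + w * z * z.
Lemma Uq_serrex i j : adjacent i j -> serre (Uq_x i) (Uq_x j) = 0.
Proof. by move=> ij; have := uq_relP (RelSerrex q ij); rewrite !piE. Qed.
Lemma Uq_serrey i j : adjacent i j -> serre (Uq_y i) (Uq_y j) = 0.
Proof. by move=> ij; have := uq_relP (RelSerrey q ij); rewrite !piE. Qed.

Lemma Uq_KKi_comm j l : Uq_K j * Uq_Ki l = Uq_Ki l * Uq_K j.
Proof.
rewrite -[LHS]mul1r -(Uq_KiK l) -mulrA (mulrA (Uq_K l)) (Uq_KK l j).
by rewrite -(mulrA (Uq_K j)) Uq_KKi mulr1.
Qed.
Lemma Uq_KiKi_comm j l : Uq_Ki j * Uq_Ki l = Uq_Ki l * Uq_Ki j.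
Proof.
rewrite -[LHS]mulr1 -(Uq_KKi j) !mulrA -(mulrA (Uq_Ki j)) -Uq_KKi_comm.
by rewrite mulrA Uq_KiK mul1r.
Qed.

Lemma Uq_Kk j i : Uq_K j * Uq_k i = Uq_k i * Uq_K j.
Proof. by rewrite /Uq_k mulrA Uq_KK -mulrA Uq_KKi_comm mulrA. Qed.
Lemma Uq_Kki j i : Uq_K j * Uq_ki i = Uq_ki i * Uq_K j.
Proof. by rewrite /Uq_ki mulrA Uq_KKi_comm -mulrA Uq_KK mulrA. Qed.
Lemma Uq_Kik j i : Uq_Ki j * Uq_k i = Uq_k i * Uq_Ki j.
Proof. by rewrite /Uq_k mulrA -Uq_KKi_comm -mulrA Uq_KiKi_comm mulrA. Qed.
Lemma Uq_Kiki j i : Uq_Ki j * Uq_ki i = Uq_ki i * Uq_Ki j.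
Proof. by rewrite /Uq_ki mulrA Uq_KiKi_comm -mulrA -Uq_KKi_comm mulrA. Qed.
Lemma Uq_kk i j : Uq_k i * Uq_k j = Uq_k j * Uq_k i.
Proof. by rewrite {1 4}/Uq_k -mulrA Uq_Kik mulrA Uq_Kk mulrA. Qed.
Lemma Uq_kki i j : Uq_k i * Uq_ki j = Uq_ki j * Uq_k i.
Proof. by rewrite /Uq_k -mulrA Uq_Kiki mulrA Uq_Kki mulrA. Qed.
Lemma Uq_kiki i j : Uq_ki i * Uq_ki j = Uq_ki j * Uq_ki i.
Proof. by rewrite {1 4}/Uq_ki -mulrA Uq_Kki mulrA Uq_Kiki mulrA. Qed.
Lemma Uq_kkiV i : Uq_k i * Uq_ki i = 1.
Proof.
rewrite /Uq_ki mulrA -Uq_Kik /Uq_k mulrA Uq_KiK mul1r; exact: Uq_KiK.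
Qed.
Lemma Uq_kikV i : Uq_ki i * Uq_k i = 1.
Proof. by rewrite -Uq_kki Uq_kkiV. Qed.

Section NonzeroQ.
Hypothesis q_neq0 : q != 0.

Lemma qC_neq0 : q%:C != 0 :> C.
Proof. by rewrite fmorph_eq0. Qed.

Lemma Uq_K_move (g gi z : Uq) (m : int) : g * gi = 1 -> gi * g = 1 ->
  g * z * gi = q%:C ^ m *: z -> g * z = q%:C ^ m *: (z * g).
Proof. by move=> _ V E; rewrite scalerAl -E -!mulrA V mulr1. Qed.
Lemma Uq_Ki_move (g gi z : Uq) (m : int) : g * gi = 1 -> gi * g = 1 ->
  g * z * gi = q%:C ^ m *: z -> gi * z = q%:C ^ (- m) *: (z * gi).
Proof.
move=> V V' E; have -> : z * gi = gi * (g * z * gi) by rewrite !mulrA V' mul1r.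
rewrite E -scalerAr scalerA -expfzDr ?qC_neq0 // addNr expr0z scale1r //.
Qed.

Definition cart (i j : 'I_d.-1) : int :=
  wt_exp (idx_lo i) j - wt_exp (idx_hi i) j.

Lemma cartC i j : cart i j = cart j i.
Proof.
rewrite /cart /wt_exp /= !eqSS ![_ == i :> nat]eq_sym ![_ == i.+1 :> nat]eq_sym.
by rewrite !opprB addrC.
Qed.

Lemma Uq_k_move i (z : Uq) (m n : int) :
    Uq_K (idx_lo i) * z * Uq_Ki (idx_lo i) = q%:C ^ m *: z ->
    Uq_K (idx_hi i) * z * Uq_Ki (idx_hi i) = q%:C ^ n *: z ->
  Uq_k i * z = q%:C ^ (m - n) *: (z * Uq_k i) /\
  Uq_ki i * z = q%:C ^ (n - m) *: (z * Uq_ki i).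
Proof.
move=> E1 E2.
have lo := Uq_K_move (Uq_KKi _) (Uq_KiK _) E1.
have loi := Uq_Ki_move (Uq_KKi _) (Uq_KiK _) E1.
have hi := Uq_K_move (Uq_KKi _) (Uq_KiK _) E2.
have hii := Uq_Ki_move (Uq_KKi _) (Uq_KiK _) E2.
split; rewrite /Uq_k /Uq_ki -mulrA.
  rewrite hii -scalerAr (mulrA _ z) lo -scalerAl scalerA -mulrA.
  by rewrite -expfzDr ?qC_neq0 // addrC.
rewrite hi -scalerAr (mulrA _ z) loi -scalerAl scalerA -mulrA.
by rewrite -expfzDr ?qC_neq0.
Qed.

Lemma Uq_kx i j : Uq_k i * Uq_x j = q%:C ^ cart i j *: (Uq_x j * Uq_k i).
Proof. exact: (Uq_k_move (Uq_Kx _ _) (Uq_Kx _ _)).1. Qed.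
Lemma Uq_kix i j : Uq_ki i * Uq_x j = q%:C ^ (- cart i j) *: (Uq_x j * Uq_ki i).
Proof. by rewrite opprB; exact: (Uq_k_move (Uq_Kx _ _) (Uq_Kx _ _)).2. Qed.
Lemma Uq_ky i j : Uq_k i * Uq_y j = q%:C ^ (- cart i j) *: (Uq_y j * Uq_k i).
Proof. by rewrite opprB (Uq_k_move (Uq_Ky _ _) (Uq_Ky _ _)).1 opprK addrC. Qed.
Lemma Uq_kiy i j : Uq_ki i * Uq_y j = q%:C ^ cart i j *: (Uq_y j * Uq_ki i).
Proof. by rewrite (Uq_k_move (Uq_Ky _ _) (Uq_Ky _ _)).2 opprK addrC. Qed.

(* The elements z_i g_i satisfy the same Serre relations as the z_i when the
   g_i commute with each other and with the z_j up to a symmetric cocycle. *)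
Section Twist.
Variables (z g : 'I_d.-1 -> Uq) (b : 'I_d.-1 -> 'I_d.-1 -> C).
Hypothesis gg : forall i j, g i * g j = g j * g i.
Hypothesis gz : forall i j, g i * z j = b i j *: (z j * g i).
Hypothesis bC : forall i j, b i j = b j i.

Lemma twist2 i j : z i * g i * (z j * g j) = b i j *: (z i * z j * (g i * g j)).
Proof. by rewrite -mulrA (mulrA (g i)) gz -scalerAl -scalerAr !mulrA. Qed.

Lemma twist3 i j l : z i * g i * (z j * g j) * (z l * g l) =
  (b i j * b i l * b j l) *: (z i * z j * z l * (g i * g j * g l)).
Proof.
have gz2 : g i * g j * z l = (b i l * b j l) *: (z l * (g i * g j)).
  rewrite -mulrA gz -scalerAr (mulrA _ (z l)) gz -scalerAl scalerA -mulrA.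
  by rewrite mulrC.
rewrite twist2 -scalerAl -(mulrA (z i * z j) (g i * g j)) (mulrA _ (z l)) gz2.
by rewrite -scalerAl -scalerAr scalerA !mulrA.
Qed.

Lemma twist_comm i j : z i * z j = z j * z i ->
  z i * g i * (z j * g j) = z j * g j * (z i * g i).
Proof. by move=> zz; rewrite !twist2 bC zz gg. Qed.

Lemma twist_serre i j :
  serre (z i) (z j) = 0 -> serre (z i * g i) (z j * g j) = 0.
Proof.
move=> S0.
have S0G : serre (z i) (z j) * (g i * g i * g j) = 0 by rewrite S0 mul0r.
have G1 : g i * g j * g i = g i * g i * g j by rewrite -mulrA (gg j) mulrA.
have G2 : g j * g i * g i = g i * g i * g j.
  by rewrite (gg j i) -mulrA (gg j i) mulrA.
have B1 : b i j * b i i * b i j = b i i * b i j * b i j.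
  by rewrite (mulrC (b i j) (b i i)).
have B2 : b i j * b i j * b i i = b i i * b i j * b i j by rewrite mulrC mulrA.
rewrite /serre !twist3 (bC j i) G1 G2 B1 B2; move: (b i i * _ * _) => B.
rewrite scalerA [_ * B]mulrC -scalerA -scalerBr -scalerDr.
rewrite /serre mulrDl mulrBl -scalerAl in S0G.
by rewrite S0G scaler0.
Qed.
End Twist.

Lemma anti_cong (c : {rmorphism C -> C}) f :
  (forall s t, uq_rel q s t -> anti_term c f s = anti_term c f t) ->
  forall s t, uq_cong q s t -> anti_term c f s = anti_term c f t.
Proof.
move=> frel s t; elim=> {s t} /=.
- exact: frel.
- by [].
- by [].
- by move=> s t u _ -> _ ->.
- by move=> s s' t t' _ -> _ ->.
- by move=> s s' t t' _ -> _ ->.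
- by move=> a s s' _ ->.
- by move=> *; rewrite addrA.
- by move=> *; rewrite addrC.
- by move=> *; rewrite add0r.
- by move=> *; rewrite rmorphN1 scaleN1r addNr.
- by move=> *; rewrite mulrA.
- by move=> *; rewrite mulr1.
- by move=> *; rewrite mul1r.
- by move=> *; rewrite mulrDr.
- by move=> *; rewrite mulrDl.
- by move=> *; rewrite scalerA rmorphM.
- by move=> *; rewrite rmorph1 scale1r.
- by move=> *; rewrite scalerDr.
- by move=> *; rewrite rmorphD scalerDl.
- by move=> *; rewrite scalerAr.
- by move=> *; rewrite scalerAl.
Qed.

Lemma twist_scale (z g : 'I_d.-1 -> Uq) (u : 'I_d.-1 -> C) b :
    (forall i j, g i * g j = g j * g i) ->
    (forall i j, g i * z j = b i j *: (z j * g i)) ->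
  (forall i j, (u i *: g i) * (u j *: g j) = (u j *: g j) * (u i *: g i)) /\
  (forall i j, (u i *: g i) * z j = b i j *: (z j * (u i *: g i))).
Proof.
move=> gg gz; split=> i j.
  by rewrite -!scalerAl -!scalerAr gg !scalerA mulrC.
by rewrite -scalerAl gz -scalerAr !scalerA mulrC.
Qed.

Lemma twist_x (u : 'I_d.-1 -> C) : let X i := Uq_x i * (u i *: Uq_ki i) in
  (forall i j, i != j -> ~~ adjacent i j -> X i * X j = X j * X i) /\
  (forall i j, adjacent i j -> serre (X i) (X j) = 0).
Proof.
have [gg gz] := twist_scale u Uq_kiki Uq_kix.
have bC i j : q%:C ^ (- cart i j) = q%:C ^ (- cart j i) :> C by rewrite cartC.
split=> i j; first by move=> ij nij; apply: twist_comm gg gz bC _ _ (Uq_xx ij nij).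
by move=> ij; apply: twist_serre gg gz bC _ _ (Uq_serrex ij).
Qed.

Lemma twist_y (u : 'I_d.-1 -> C) : let Y i := Uq_y i * (u i *: Uq_k i) in
  (forall i j, i != j -> ~~ adjacent i j -> Y i * Y j = Y j * Y i) /\
  (forall i j, adjacent i j -> serre (Y i) (Y j) = 0).
Proof.
have [gg gz] := twist_scale u Uq_kk Uq_ky.
have bC i j : q%:C ^ (- cart i j) = q%:C ^ (- cart j i) :> C by rewrite cartC.
split=> i j; first by move=> ij nij; apply: twist_comm gg gz bC _ _ (Uq_yy ij nij).
by move=> ij; apply: twist_serre gg gz bC _ _ (Uq_serrey ij).
Qed.

Lemma kix_twist i : Uq_ki i * Uq_x i = Uq_x i * (q%:C ^ (- cart i i) *: Uq_ki i).
Proof. by rewrite Uq_kix scalerAr. Qed.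

Lemma Uq_xy_twist i j :
  (Uq_ki j * Uq_x j) * (Uq_y i * Uq_k i) - (Uq_y i * Uq_k i) * (Uq_ki j * Uq_x j)
  = ((i == j)%:R / (q%:C - q%:C^-1)) *: (Uq_k i - Uq_ki i).
Proof.
have -> : Uq_y i * Uq_k i * (Uq_ki j * Uq_x j) =
          Uq_ki j * (Uq_y i * Uq_x j) * Uq_k i.
  rewrite -mulrA (mulrA (Uq_k i)) Uq_kki -(mulrA (Uq_ki j)) Uq_kx.
  rewrite -!scalerAr !mulrA Uq_kiy -!scalerAl -!mulrA.
  by rewrite (cartC i j).
have -> : Uq_ki j * Uq_x j * (Uq_y i * Uq_k i) =
          Uq_ki j * (Uq_x j * Uq_y i) * Uq_k i by rewrite !mulrA.
rewrite -mulrBl -mulrBr Uq_xy eq_sym; case: eqP => [<-|_]; last first.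
  by rewrite mul0r !scale0r mulr0 mul0r.
by rewrite -scalerAr -scalerAl mulrBr Uq_kikV mulrBl -mulrA Uq_kikV mulr1 !mul1r.
Qed.

Lemma anti_rel (c : {rmorphism C -> C}) f :
  c q%:C = q%:C ->
  (forall j l, f (GenK j) * f (GenK l) = f (GenK l) * f (GenK j)) ->
  (forall j, f (GenK j) * f (GenKi j) = 1 /\ f (GenKi j) * f (GenK j) = 1) ->
  (forall j i, f (GenKi j) * f (GenX i) * f (GenK j) =
     q%:C ^ wt_exp j i *: f (GenX i)) ->
  (forall j i, f (GenKi j) * f (GenY i) * f (GenK j) =
     q%:C ^ (- wt_exp j i) *: f (GenY i)) ->
  (forall i j, f (GenY j) * f (GenX i) - f (GenX i) * f (GenY j) =
    ((i == j)%:R / (q%:C - q%:C^-1)) *: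
       (f (GenKi (idx_hi i)) * f (GenK (idx_lo i))
        - f (GenK (idx_hi i)) * f (GenKi (idx_lo i)))) ->
  ((forall i j, i != j -> ~~ adjacent i j ->
      f (GenX i) * f (GenX j) = f (GenX j) * f (GenX i)) /\
  (forall i j, adjacent i j -> serre (f (GenX i)) (f (GenX j)) = 0)) ->
  ((forall i j, i != j -> ~~ adjacent i j ->
      f (GenY i) * f (GenY j) = f (GenY j) * f (GenY i)) /\
  (forall i j, adjacent i j -> serre (f (GenY i)) (f (GenY j)) = 0)) ->
  forall s t, uq_rel q s t -> anti_term c f s = anti_term c f t.
Proof.
move=> cq KK KV Kx Ky xy [xx sx] [yy sy] s t.
have anti_serre z w : serre z w = 0 ->
    w * (z * z) + c (- 1) *: (c (q%:C + q%:C^-1) *: (z * (w * z))) + z * (z * w) = 0.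
  move=> <-; rewrite /serre rmorphN1 scaleN1r rmorphD fmorphV /= cq !mulrA.
  by rewrite addrAC [X in X - _]addrC addrAC.
case=> * /=.
- by rewrite KK.
- by rewrite (KV _).2.
- by rewrite (KV _).1.
- by rewrite mulrA Kx fmorphXz /= cq.
- by rewrite mulrA Ky fmorphXz /= cq.
- rewrite rmorphM fmorphV rmorphB fmorphV rmorph_nat /= cq.
  by rewrite rmorphN1 !scaleN1r xy.
- by rewrite [RHS]xx.
- by rewrite [RHS]yy.
- by rewrite anti_serre // sx.
- by rewrite anti_serre // sy.
Qed.

Lemma antipode_rel s t : uq_rel q s t ->
  anti_term id antipode_gen s = anti_term id antipode_gen t.
Proof.
have SX i : antipode_gen (GenX i) = Uq_x i * (- q%:C ^ (- cart i i) *: Uq_ki i).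
  by rewrite /= kix_twist scaleNr mulrN.
have SY i : antipode_gen (GenY i) = Uq_y i * (- 1 *: Uq_k i).
  by rewrite /= scaleN1r mulrN.
apply: (@anti_rel idfun antipode_gen) => //=.
- exact: Uq_KiKi_comm.
- by move=> j; rewrite Uq_KKi Uq_KiK.
- move=> j i; rewrite mulrN mulNr.
  have -> : Uq_K j * (Uq_ki i * Uq_x i) * Uq_Ki j =
            Uq_ki i * (Uq_K j * Uq_x i * Uq_Ki j) by rewrite mulrA Uq_Kki !mulrA.
  by rewrite Uq_Kx -scalerAr scalerN.
- move=> j i; rewrite mulrN mulNr.
  have -> : Uq_K j * (Uq_y i * Uq_k i) * Uq_Ki j =
            Uq_K j * Uq_y i * Uq_Ki j * Uq_k i.
    by rewrite -[RHS]mulrA Uq_Kik !mulrA.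
  by rewrite Uq_Ky -scalerAl scalerN.
- move=> i j; rewrite !mulrNN -[LHS]opprK opprB Uq_xy_twist [j == i]eq_sym.
  case: eqP => [->|_]; last by rewrite mul0r !scale0r oppr0.
  by rewrite -scalerN opprB /Uq_k /Uq_ki -!Uq_KKi_comm.
- have [C1 C2] := twist_x (fun i => - q%:C ^ (- cart i i)).
  split=> i j; first by move=> ij nij; have := C1 i j ij nij; rewrite -!SX.
  by move=> ij; have := C2 i j ij; rewrite -!SX.
- have [C1 C2] := twist_y (fun i => - 1).
  split=> i j; first by move=> ij nij; have := C1 i j ij nij; rewrite -!SY.
  by move=> ij; have := C2 i j ij; rewrite -!SY.
Qed.

Lemma conj_qC : Num.conj (q%:C : C) = q%:C.
Proof. exact: conjc_real. Qed.

Lemma star_rel s t : uq_rel q s t ->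
  anti_term Num.conj star_gen s = anti_term Num.conj star_gen t.
Proof.
have SX i : star_gen (GenX i) = Uq_y i * (q%:C^-1 *: Uq_k i).
  by rewrite /= scalerAr.
have SY i : star_gen (GenY i) = Uq_x i * (q%:C * q%:C ^ (- cart i i) *: Uq_ki i).
  by rewrite /= kix_twist scalerAr scalerA.
have KiE (z : Uq) j m : Uq_K j * z * Uq_Ki j = q%:C ^ m *: z ->
    Uq_Ki j * z * Uq_K j = q%:C ^ (- m) *: z.
  move=> /(Uq_Ki_move (Uq_KKi _) (Uq_KiK _)) ->.
  by rewrite -scalerAl -mulrA Uq_KiK mulr1.
apply: (@anti_rel (Num.conj : {rmorphism C -> C}) star_gen) => //=.
- exact: conj_qC.
- exact: Uq_KK.
- by move=> j; rewrite Uq_KKi Uq_KiK.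
- move=> j i; rewrite -scalerAr -scalerAl.
  have -> : Uq_Ki j * (Uq_y i * Uq_k i) * Uq_K j =
            Uq_Ki j * Uq_y i * Uq_K j * Uq_k i.
    by rewrite -[RHS]mulrA Uq_Kk !mulrA.
  by rewrite (KiE _ _ _ (Uq_Ky j i)) opprK -scalerAl !scalerA mulrC.
- move=> j i; rewrite -scalerAr -scalerAl.
  have -> : Uq_Ki j * (Uq_ki i * Uq_x i) * Uq_K j =
            Uq_ki i * (Uq_Ki j * Uq_x i * Uq_K j) by rewrite mulrA Uq_Kiki !mulrA.
  by rewrite (KiE _ _ _ (Uq_Kx j i)) -scalerAr !scalerA mulrC.
- move=> i j; rewrite -!scalerAl -!scalerAr !scalerA mulfV ?qC_neq0 //.
  rewrite mulVf ?qC_neq0 // !scale1r Uq_xy_twist.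
  by rewrite /Uq_k /Uq_ki -Uq_KKi_comm Uq_KKi_comm.
- have [C1 C2] := twist_y (fun i => q%:C^-1).
  split=> i j; first by move=> ij nij; have := C1 i j ij nij; rewrite -!SX.
  by move=> ij; have := C2 i j ij; rewrite -!SX.
- have [C1 C2] := twist_x (fun i => q%:C * q%:C ^ (- cart i i)).
  split=> i j; first by move=> ij nij; have := C1 i j ij nij; rewrite -!SY.
  by move=> ij; have := C2 i j ij; rewrite -!SY.
Qed.

Lemma antipode_pi t : antipode (uq_pi t) = anti_term id antipode_gen t.
Proof. exact: (@anti_cong idfun _ antipode_rel _ _ (uq_repr_pi t)). Qed.
Lemma star_pi t : star (uq_pi t) = anti_term Num.conj star_gen t.
Proof.
exact: (@anti_cong (Num.conj : {rmorphism C -> C}) _ star_rel _ _ (uq_repr_pi t)).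
Qed.

Lemma antipodeM u v : antipode (u * v) = antipode v * antipode u.
Proof.
elim/uq_ind: u => s; elim/uq_ind: v => t.
by rewrite -uq_piM !antipode_pi.
Qed.
Lemma antipode1 : antipode 1 = 1.
Proof. by rewrite -[1]/(uq_pi 1) antipode_pi. Qed.
Lemma antipode_linear : linear antipode.
Proof.
move=> a; elim/uq_ind=> s; elim/uq_ind=> t.
by rewrite -uq_piZ -uq_piD !antipode_pi.
Qed.
Lemma antipode_x i : antipode (Uq_x i) = - (Uq_ki i * Uq_x i).
Proof. exact: antipode_pi. Qed.
Lemma antipode_y i : antipode (Uq_y i) = - (Uq_y i * Uq_k i).
Proof. exact: antipode_pi. Qed.
Lemma antipode_K j : antipode (Uq_K j) = Uq_Ki j.
Proof. exact: antipode_pi. Qed.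
Lemma antipode_Ki j : antipode (Uq_Ki j) = Uq_K j.
Proof. exact: antipode_pi. Qed.

Lemma starM u v : star (u * v) = star v * star u.
Proof. by elim/uq_ind: u => s; elim/uq_ind: v => t; rewrite -uq_piM !star_pi. Qed.
Lemma star1 : star 1 = 1.
Proof. by rewrite -[1]/(uq_pi 1) star_pi. Qed.
Lemma star_antilinear a u v : star (a *: u + v) = Num.conj a *: star u + star v.
Proof.
elim/uq_ind: u => s; elim/uq_ind: v => t.
by rewrite -uq_piZ -uq_piD !star_pi.
Qed.
Lemma star_x i : star (Uq_x i) = q%:C^-1 *: (Uq_y i * Uq_k i).
Proof. exact: star_pi. Qed.
Lemma star_y i : star (Uq_y i) = q%:C *: (Uq_ki i * Uq_x i).
Proof. exact: star_pi. Qed.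
Lemma star_K j : star (Uq_K j) = Uq_K j.
Proof. exact: star_pi. Qed.
Lemma star_Ki j : star (Uq_Ki j) = Uq_Ki j.
Proof. exact: star_pi. Qed.

End NonzeroQ.
End UqAlgebra.


Arguments Uq R d q : clear implicits.

Record uq_repr_on (R : realType) (d : nat) (q : R) (V : vectType R[i]) := UqRepr {
  uq_act :> Uq R d q -> 'End(V);
  uq_act_linear : linear uq_act;
  uq_act1 : uq_act 1 = \1%VF;
  uq_actM : forall X Y, uq_act (X * Y) = (uq_act X \o uq_act Y)%VF
}.

Section Representations.
Variables (R : realType) (d : nat) (q : R) (V : vectType R[i]).
Local Notation C := R[i].
Local Notation U := (Uq R d q).
Implicit Types (rho : uq_repr_on d q V) (mu : 'I_d -> int).

Definition weight_space rho mu : {vspace V} :=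
  (\bigcap_(j < d) lker (rho (Uq_K q j) - (q%:C ^ mu j) *: \1%VF))%VS.

Definition type_one rho : Prop :=
  exists s : seq {ffun 'I_d -> int},
    [/\ uniq s,
        forall nu, nu \notin s -> weight_space rho nu = 0%VS,
        directv (\sum_(nu <- s) weight_space rho nu)%VS
      & (\sum_(nu <- s) weight_space rho nu)%VS = fullv].

Definition irreducible rho : Prop :=
  (fullv : {vspace V}) != 0%VS /\
  forall W : {vspace V}, (forall X, (rho X @: W <= W)%VS) ->
    W = 0%VS \/ W = fullv.

(* rho is (a model of) L_mu^q *)
Definition is_L mu rho : Prop :=
  [/\ irreducible rho, type_one rho
    & exists2 u : V, u != 0 & u \in weight_space rho mu /\
        forall i : 'I_d.-1, rho (Uq_x q i) u = 0].

(* <X v, w> = <v, X^* w> *)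
Definition star_unitary rho (form : {dot V for Num.conj}) : Prop :=
  forall (X : U) (v w : V), form (rho X v) w = form v (rho (star X) w).

Definition positive_definite (form : {dot V for Num.conj}) (F : 'End(V)) : Prop :=
  forall v : V, v != 0 -> 0 < form (F v) v.

Definition lfun_trace (F : 'End(V)) : C :=
  \tr (passmx.mxof (vbasis fullv) (vbasis fullv) F).

End Representations.

Section QuantumDimension.
Variables (R : realType) (d : nat) (q : R) (V : vectType R[i]).
Local Notation C := R[i].
Local Notation U := (Uq R d q).

(* The contragredient action (X f)(v) = f (S(X) v), as a family of operators so
   that it can be iterated. *)
Definition dual_act (W : vectType C) (act : U -> 'End(W)) (X : U) :
    'End('Hom(W, C^o)) :=
  linfun (fun f : 'Hom(W, C^o) => (f \o act (antipode X))%VF).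

Lemma dual_actE (W : vectType C) (act : U -> 'End(W)) X (f : 'Hom(W, C^o)) :
  dual_act act X f = (f \o act (antipode X))%VF.
Proof.
pose g (f : 'Hom(W, C^o)) := (f \o act (antipode X))%VF.
have g_lin : linear g.
  by move=> a f1 f2; rewrite /g comp_lfunDl comp_lfunZl.
pose gM := GRing.isLinear.Build C _ _ _ g g_lin.
pose gL : {linear _ -> _} := HB.pack g gM.
by rewrite /dual_act -[linfun _]/(linfun gL) lfunE.
Qed.

Definition bidual_map : 'Hom(V, 'Hom('Hom(V, C^o), C^o)) :=
  linfun (fun v : V => linfun (fun f : 'Hom(V, C^o) => f v : C^o)).

Lemma bidual_mapE (v : V) (f : 'Hom(V, C^o)) : bidual_map v f = f v.
Proof.
have ev_lin w : linear (fun f : 'Hom(V, C^o) => f w : C^o).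
  by move=> a f1 f2; rewrite add_lfunE scale_lfunE.
pose evL w : {linear 'Hom(V, C^o) -> C^o} :=
  HB.pack (fun f : 'Hom(V, C^o) => f w : C^o)
    (GRing.isLinear.Build C _ _ _ _ (ev_lin w)).
have evE w h : linfun (fun f : 'Hom(V, C^o) => f w : C^o) h = h w.
  by rewrite -[linfun _]/(linfun (evL w)) lfunE.
pose phi (w : V) := linfun (fun f : 'Hom(V, C^o) => f w : C^o).
have phi_lin : linear phi.
  move=> a v1 v2; apply/lfunP=> h.
  by rewrite add_lfunE scale_lfunE /phi !evE linearP.
pose phiL : {linear V -> 'Hom('Hom(V, C^o), C^o)} :=
  HB.pack phi (GRing.isLinear.Build C _ _ _ _ phi_lin).
by rewrite /bidual_map -[linfun _]/(linfun phiL) (lfunE phiL) evE.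
Qed.

Definition qdim_operator (rho : uq_repr_on d q V) (F : 'End(V)) : Prop :=
  exists form : {dot V for Num.conj},
    [/\ star_unitary rho form,
        positive_definite form F /\ lker F == 0%VS,
        lfun_trace F = lfun_trace F^-1%VF,
        0 < lfun_trace F
      & forall X : U,
          (bidual_map \o F \o rho X)%VF =
          (dual_act (dual_act rho) X \o (bidual_map \o F))%VF].

Definition qdim (rho : uq_repr_on d q V) : C :=
  lfun_trace (xget 0 [set F | qdim_operator rho F]%classic).

End QuantumDimension.

Section PartitionData.
Variables (n d : nat) (lam : 'I_n -> nat).

(* (lam_1, ..., lam_n, 0, ..., 0, - lam_n, ..., - lam_1); the two blocks do not
   overlap when 2 n <= d. *)
Definition natural_weight (j : 'I_d) : int :=
  if (insub (j : nat) : option 'I_n) is Some i then (lam i)%:Z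
  else if (insub (rev_ord j : nat) : option 'I_n) is Some i then - (lam i)%:Z
  else 0.

Definition rho_vec (i : 'I_n) : nat := (n - i.+1)%N.
Definition weight_size : nat := (\sum_(i < n) lam i)%N.
Definition rho_pairing : nat := (\sum_(i < n) rho_vec i * lam i)%N.
End PartitionData.

(* (a; p)_j *)
Definition qpoch (R : realType) (a p : R) (j : nat) : R :=
  \prod_(i < j) (1 - a * p ^+ i).

(* Main.v *)
Require Import Defs.
From HB Require Import structures.
From mathcomp Require Import all_boot all_order all_algebra.
From mathcomp Require Import perm boolp classical_sets reals complex.
From mathcomp Require Import ring zify.
Set Implicit Arguments.
Unset Strict Implicit.
Unset Printing Implicit Defensive.
Import Order.TTheory GRing.Theory Num.Theory.
Local Open Scope ring_scope.
Local Open Scope complex_scope.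

(** Put mu = lambda^natural and r_j = mu_j - j, a strictly decreasing sequence. The
    quantum dimension is the trace of K_(2 rho)^-1, and it is computed in an explicit
    model of the representation.

    The model is the Gelfand-Tsetlin module: its basis consists of the patterns with top
    row r, the K_j act by the differences of consecutive row sums, and x_k and y_k raise
    and lower the entries of row k with coefficients that are square roots of products of
    q-numbers. Moves at two different entries commute because two entries interact only
    through their difference (coef2_exchange); the diagonal part of [x_k, y_k] is a
    Lagrange interpolation identity for the entries of row k inside the intervals left by
    the neighbouring rows (lagrange_at0, row_commutator, coef2_commutator). The basis is
    orthogonal for a *-unitary form (gt_starX), the pattern with the largest entries is up
    to scalars the only highest weight vector (gt_highest_unique), and together these two
    facts give irreducibility (gt_irreducible). An irreducible representation with the
    same highest weight is isomorphic to this module: the graph of the isomorphism is the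
    submodule of the direct sum generated by the pair of highest weight vectors
    (highest_weight_iso).

    The square of the antipode multiplies x_i by q^-2 and y_i by q^2, as conjugation by
    K_(2 rho)^-1 does. This positive operator therefore intertwines V with its bidual. Every
    intertwiner is a multiple of it, by the Schur lemma, and the normalization
    Tr F = Tr F^-1 > 0 excludes all multiples but the operator itself
    (qdim_operator_unique), because its trace is a product of q-numbers and hence
    invariant under q -> q^-1.

    Its trace is a sum over patterns of powers of q, the principal specialization of a
    Schur function. Summing row by row, the rows interlacing with a given row give, by
    multilinearity, a determinant of geometric sums, which is a Vandermonde determinant
    again (sum_patterns). The result is the Weyl product of [r_i - r_j] / [j - i] over
    i < j < d (sum_trace). For the symmetric weight lambda^natural the pairs i < j fall
    into blocks according to the three parts of the weight: the entries of lambda, the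
    zeros, and the entries of - lambda. The blocks are the factors of the formula
    (weyl_product_blocks). *)
(** * q-numbers and the commutator identity of a single row *)

(** Lagrange interpolation at the pi p of the polynomial
    \prod ('X - be p) - \prod ('X - pi p), evaluated at 0. *)
Lemma lagrange_at0 (F : fieldType) (I : finType) (P : pred I) (pi be : I -> F) :
  {in P &, injective pi} -> (forall p, P p -> pi p != 0) ->
  \sum_(p | P p) (1 - be p / pi p) *
     \prod_(p' | P p' && (p' != p)) ((pi p - be p') / (pi p - pi p')) =
  1 - \prod_(p | P p) (be p / pi p).
Proof.
move=> pi_inj pi0.
pose A : {poly F} := \prod_(p <- enum P) ('X - (be p)%:P).
pose B : {poly F} := \prod_(p <- enum P) ('X - (pi p)%:P).
pose L p : {poly F} := \prod_(p' | P p' && (p' != p)) ('X - (pi p')%:P).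
pose c p := \prod_(p' | P p' && (p' != p)) (pi p - pi p').
have c0 p : P p -> c p != 0.
  move=> Pp; apply/prodf_neq0 => p' /andP[Pp' ne].
  by rewrite subr_eq0; apply: contra_neq ne => /pi_inj ->.
have BE x : B.[x] = \prod_(p | P p) (x - pi p).
  rewrite /B big_enum horner_prod; apply: eq_bigr => p _.
  by rewrite hornerXsubC.
have AE x : A.[x] = \prod_(p | P p) (x - be p).
  rewrite /A big_enum horner_prod; apply: eq_bigr => p _.
  by rewrite hornerXsubC.
have LE p x : (L p).[x] = \prod_(p' | P p' && (p' != p)) (x - pi p').
  rewrite /L horner_prod; apply: eq_bigr => p' _.
  by rewrite hornerXsubC.
pose E : {poly F} := A - B - \sum_(p | P p) (A.[pi p] / c p) *: L p.
have sE : (size E <= size (map pi (enum P)))%N.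
  rewrite size_map; apply: leq_trans (size_polyD _ _) _; rewrite geq_max; apply/andP; split.
    have mA : A \is monic by exact: monic_prod_XsubC.
    have mB : B \is monic by exact: monic_prod_XsubC.
    have sA : size A = (size (enum P)).+1 by rewrite size_prod_XsubC.
    have sB : size B = (size (enum P)).+1 by rewrite size_prod_XsubC.
    apply/leq_sizeP => k; rewrite leq_eqVlt coefB => /orP[/eqP <-|lt].
      move: mA mB; rewrite !monicE !lead_coefE sA sB /= => /eqP -> /eqP ->.
      by rewrite subrr.
    by rewrite !nth_default ?subrr ?sA ?sB.
  rewrite size_polyN; apply: leq_trans (size_sum _ _ _) _.
  apply/bigmax_leqP => p Pp; apply: leq_trans (size_scale_leq _ _) _.
  rewrite /L -big_filter size_prod_XsubC.
  by rewrite -!sum1_size big_filter big_enum [leqRHS](bigD1 p).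
have E0 : E = 0.
  apply: (roots_geq_poly_eq0 (rs := map pi (enum P))); last exact: sE; last first.
    rewrite map_inj_in_uniq ?enum_uniq // => x y.
    by rewrite !mem_enum; exact: pi_inj.
  apply/allP => x /mapP[p]; rewrite mem_enum => Pp ->; rewrite rootE.
  rewrite /E !hornerE horner_sum BE (bigD1 p) //= subrr mul0r subr0.
  rewrite (bigD1 p) //= hornerZ LE -/(c p) divfK ?c0 // big1 ?addr0 ?subrr // => p' /andP[Pp' ne].
   rewrite hornerZ LE (bigD1 p) /= ?subrr ?mul0r ?mulr0 //.
  by rewrite eq_sym ne andbT; exact: Pp.
have : E.[0] = 0 by rewrite E0 horner0.
rewrite /E !hornerE horner_sum AE BE => /eqP; rewrite subr_eq0 => /eqP eq0.
have sg (G : I -> F) (Q : pred I) : \prod_(p | Q p) (0 - G p) = (-1) ^+ #|Q| * \prod_(p | Q p) G p.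
  by rewrite -prodrN; apply: eq_bigr => p _; rewrite sub0r.
have PB0 : \prod_(p | P p) pi p != 0 by apply/prodf_neq0.
rewrite !sg -mulrBr in eq0.
have -> : 1 - \prod_(p | P p) (be p / pi p) =
    (\prod_(p | P p) pi p - \prod_(p | P p) be p) / \prod_(p | P p) pi p.
  by rewrite prodf_div mulrBl divff.
apply: (mulIf PB0); rewrite divfK // -[RHS]opprB.
apply: (mulfI (_ : (-1) ^+ #|P| != 0)); first by rewrite signr_eq0.
rewrite mulrN eq0 -sumrN big_distrl big_distrr /=; apply: eq_bigr => p Pp.
rewrite hornerZ LE sg prodf_div -/(c p) AE [\prod_(p0 | P p0) (pi p - be p0)](bigD1 p) //=.
rewrite [\prod_(p0 | P p0) pi p0](bigD1 p) //=.
have -> : #|P| = #|(fun p0 : I => P p0 && (p0 != p))|.+1.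
  rewrite (cardD1 p) -[p \in P]/(P p) Pp add1n; congr _.+1.
  by apply: eq_card => x; rewrite !inE andbC.
rewrite exprS.
have := pi0 p Pp; have := c0 p Pp.
move: (c p) (\prod_(_ | _) pi _) (\prod_(_ | _) (_ - be _)) (_ ^+ _) => x y z w x0 p0.
by field; rewrite x0.
Qed.

Section QNumbers.
Variables (R : realFieldType) (q : R).
Hypotheses (q_gt0 : 0 < q) (q_lt1 : q < 1).

Definition qnum (z : int) : R := (q ^ z - q ^ (- z)) / (q - q^-1).

Lemma q_unit : q != 0. Proof. by rewrite gt_eqF. Qed.
Hint Resolve q_unit : core.

Lemma qpow_neq0 (z : int) : q ^ z != 0.
Proof. exact: expfz_neq0. Qed.
Hint Resolve qpow_neq0 : core.

Lemma qpow_inj : injective (fun z : int => q ^ z).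
Proof. by apply: ieexprIz; rewrite // lt_eqF. Qed.

Lemma qpow_lt (y z : int) : (q ^ y < q ^ z) = (z < y).
Proof.
have E (w : int) : q ^ w = q^-1 ^ (- w) by rewrite exprz_inv opprK.
by rewrite !E ltr_eXz2l ?ltrN2 // invf_gt1.
Qed.

Lemma qpow_sum (I : Type) (r : seq I) (P : pred I) (F : I -> int) :
  q ^ (\sum_(i <- r | P i) F i) = \prod_(i <- r | P i) q ^ F i.
Proof. by apply: big_morph => // x y; rewrite expfzDr. Qed.

Lemma qdiff_lt0 : q - q^-1 < 0.
Proof. by rewrite subr_lt0 -[X in X < _]expr1z -exprN1 qpow_lt. Qed.

Lemma qdiff_neq0 : q - q^-1 != 0.
Proof. by rewrite lt_eqF // qdiff_lt0. Qed.

Lemma qnumN z : qnum (- z) = - qnum z.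
Proof. by rewrite /qnum opprK -mulNr opprB. Qed.

Lemma qnum1 : qnum 1 = 1.
Proof. by rewrite /qnum expr1z exprN1 divff // qdiff_neq0. Qed.

Lemma qnum_gt0 z : 0 < z -> 0 < qnum z.
Proof.
move=> z0; rewrite /qnum -mulrNN mulr_gt0 ?oppr_gt0 ?invr_lt0 ?qdiff_lt0 //.
by rewrite subr_lt0 qpow_lt; lia.
Qed.

Lemma qnum_lt0 z : z < 0 -> qnum z < 0.
Proof. by move=> z0; rewrite -oppr_gt0 -qnumN qnum_gt0 // oppr_gt0. Qed.

Lemma qnum_neq0 z : z != 0 -> qnum z != 0.
Proof.
by case: ltgtP => // [/qnum_lt0 /lt_eqF->|/qnum_gt0 /gt_eqF->].
Qed.

Lemma qnum_factor (z b : int) :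
  qnum (z - b) = q ^ (- z - b) * (q ^ (2 * z) - q ^ (2 * b)) / (q - q^-1).
Proof.
rewrite /qnum mulrBr -!expfzDr //; congr ((q ^ _ - q ^ _) / _); ring.
Qed.

Lemma qnum_ratio (z b l : int) : z != l ->
  qnum (z - b) / qnum (z - l) =
  q ^ (l - b) * ((q ^ (2 * z) - q ^ (2 * b)) / (q ^ (2 * z) - q ^ (2 * l))).
Proof.
move=> zl; have nz : q ^ (2 * z) - q ^ (2 * l) != 0.
  by rewrite subr_eq0; apply: contra_neq zl => /qpow_inj; lia.
rewrite !qnum_factor.
have -> : l - b = (- z - b) - (- z - l) by ring.
rewrite (expfzDr (- z - b) _ q_unit) -invr_expz; have := qdiff_neq0.
have := qpow_neq0 (- z - l); move: nz.
move: (q ^ (- z - l)) (_ - q ^ (2 * l)) (q - q^-1) => x y w *.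
by field; apply/and3P.
Qed.

(** One row of a pattern moving freely inside the intervals [a i, b i] cut out
    by its two neighbouring rows. *)
Section Row.
Variables (n : nat) (l a b : 'I_n -> int).
Hypothesis lab : forall i, a i <= l i <= b i.
Hypothesis sep : forall i j : 'I_n, (i < j)%N -> b j < a i.

(** The squares of the coefficients with which the entry j moves up and down by one.
    Each interval end is paired with the entry of its interval. *)
Definition row_up (j : 'I_n) : R :=
  - (\prod_i (qnum (l j - b i) * qnum (l j + 1 - a i)) /
     \prod_(i | i != j) (qnum (l j - l i) * qnum (l j + 1 - l i))).
Definition row_down (j : 'I_n) : R :=
  - (\prod_i (qnum (l j - 1 - b i) * qnum (l j - a i)) /
     \prod_(i | i != j) (qnum (l j - 1 - l i) * qnum (l j - l i))).

(** Entries on one side of j contribute factors of equal sign to the numerator and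
    to the denominator, so the sign is that of - [l j - b j]. *)
Lemma row_up_gt0 j : l j < b j -> 0 < row_up j.
Proof.
move=> lb; rewrite /row_up (bigD1 j) //= -mulrA -mulNr -mulNr; apply: mulr_gt0.
  rewrite mulr_gt0 ?oppr_gt0 ?qnum_lt0 ?qnum_gt0 //; first by lia.
  by have := lab j; lia.
rewrite -prodf_div; apply: prodr_gt0 => i ij.
have := lab i; have := lab j.
have [ij'|ij'|/ord_inj ij'] := ltngtP i j; last by rewrite ij' eqxx in ij.
  have := sep ij' => ? ? ?.
  by apply: divr_gt0; rewrite nmulr_rgt0 qnum_lt0 //; lia.
have := sep ij' => ? ? ?.
by apply: divr_gt0; rewrite mulr_gt0 // qnum_gt0 //; lia.
Qed.

Let Q : int := \sum_i (2 * l i - a i - b i).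

(* the poles of the two families of moves that stay inside the intervals *)
Let live (p : 'I_n + 'I_n) : bool :=
  match p with inl i => l i < b i | inr i => a i < l i end.
Let pole (p : 'I_n + 'I_n) : int :=
  match p with inl i => l i | inr i => l i - 1 end.
Let zero (p : 'I_n + 'I_n) : int :=
  match p with inl i => b i | inr i => a i - 1 end.
Let pi p := q ^ (2 * pole p).
Let be p := q ^ (2 * zero p).

Let pole_inj : {in live &, injective pole}.
Proof.
have H (i j : 'I_n) : (i < j)%N -> b j < a i := @sep i j.
have L i := lab i.
move=> [i|i] [j|j]; rewrite /in_mem /= => li lj E;
  have := L i; have := L j;
  case: (ltngtP i j) => [ij|ij|/ord_inj ij] Lj Li;
  by [have := H _ _ ij; lia | rewrite ij | rewrite ij in E; lia].
Qed.

Let term p := (1 - be p / pi p) *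
     \prod_(p' | live p' && (p' != p)) ((pi p - be p') / (pi p - pi p')).

Let sum_term : \sum_(p | live p) term p = 1 - q ^ (- 2 * Q).
Proof.
rewrite lagrange_at0; last 1 first.
- by move=> p _; apply: qpow_neq0.
- have -> : \prod_(p | live p) (be p / pi p) = q ^ (- 2 * Q); last by [].
  rewrite (eq_bigr (fun p => q ^ (2 * (zero p - pole p)))); last first.
    by move=> p _; rewrite /be /pi invr_expz -expfzDr //; congr (q ^ _); ring.
  rewrite big_mkcond big_sumType /= -big_split /= /Q.
  rewrite mulr_sumr qpow_sum /=.
  have pad (x y z : int) : x <= y -> z = 2 * (y - x) ->
      (if x < y then q ^ z else 1) = q ^ (2 * (y - x)).
    by move=> + ->; case: ltgtP => // -> _; rewrite subrr mulr0 expr0z.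
  apply: eq_bigr => i _; have /andP[al lb] := lab i.
  have -> : (if a i < l i then q ^ (2 * (a i - 1 - (l i - 1))) else 1) = q ^ (2 * (a i - l i)).
    by case: ltgtP al => // [? _|-> _]; rewrite ?subrr ?expr0z //; congr (q ^ _); ring.
  by rewrite pad // -expfzDr //; congr (q ^ _); ring.
- move=> p p' lp lp' /qpow_inj E; apply: pole_inj => //; lia.
Qed.

(* the factor of the interval i in a move to or from position z, which is 1
   when the corresponding pole is not live *)
Let ratio_b (z : int) i : z != l i ->
  qnum (z - b i) / qnum (z - l i) =
  q ^ (l i - b i) * (if live (inl i) then
     (q ^ (2 * z) - be (inl i)) / (q ^ (2 * z) - pi (inl i)) else 1).
Proof.
move=> zl; rewrite /live /be /pi /=; case: ltgtP (lab i) => [_ _||eq _]; first by rewrite qnum_ratio.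
  by lia.
by rewrite -eq subrr expr0z divff ?mulr1 // qnum_neq0 // subr_eq0.
Qed.

Let ratio_a (z : int) i : z + 1 != l i ->
  qnum (z + 1 - a i) / qnum (z + 1 - l i) =
  q ^ (l i - a i) * (if live (inr i) then
     (q ^ (2 * z) - be (inr i)) / (q ^ (2 * z) - pi (inr i)) else 1).
Proof.
move=> zl; rewrite /live /be /pi /=.
have -> : z + 1 - a i = z - (a i - 1) by ring.
have -> : z + 1 - l i = z - (l i - 1) by ring.
case: ltgtP (lab i) => [||eq _]; [|by lia|]; last first.
  by rewrite eq subrr expr0z divff ?mulr1 // qnum_neq0; lia.
move=> _ _; rewrite qnum_ratio; last by lia.
by congr (q ^ _ * _); ring.
Qed.

Let gap_up j i : l j < b j -> i != j -> l j + 1 != l i /\ l j != l i.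
Proof.
move=> lb ij; have := lab i; have := lab j.
have [ij'|ij'|/ord_inj ij'] := ltngtP i j; last by rewrite ij' eqxx in ij.
  by have := sep ij'; lia.
by have := sep ij'; lia.
Qed.
Let gap_down j i : a j < l j -> i != j -> l j - 1 != l i /\ l j != l i.
Proof.
move=> lb ij; have := lab i; have := lab j.
have [ij'|ij'|/ord_inj ij'] := ltngtP i j; last by rewrite ij' eqxx in ij.
  by have := sep ij'; lia.
by have := sep ij'; lia.
Qed.

Let split_term (p : 'I_n + 'I_n) z :
  \prod_(p' | live p' && (p' != p)) ((z - be p') / (z - pi p')) =
  (\prod_(i | inl i != p) (if live (inl i) then (z - be (inl i)) / (z - pi (inl i)) else 1))
  * \prod_(i | inr i != p) (if live (inr i) then (z - be (inr i)) / (z - pi (inr i)) else 1).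
Proof.
rewrite big_mkcond big_sumType; congr (_ * _); rewrite [RHS]big_mkcond;
  by apply: eq_bigr => i _; case: (live _) => //=; case: (_ != _).
Qed.

Let qnum_step (x y : int) :
  qnum (x - y) = q ^ (x - y) / (q - q^-1) * (1 - q ^ (2 * y) / q ^ (2 * x)).
Proof.
rewrite /qnum mulrAC mulrBr mulr1 invr_expz -!expfzDr //.
congr ((_ - q ^ _) / _); ring.
Qed.

Let expQ j : q ^ Q = q ^ (l j - b j) * q ^ (l j - a j) *
  q ^ (\sum_(i | i != j) (l i - b i + (l i - a i))).
Proof.
rewrite -!expfzDr // /Q (bigD1 j) //=; congr (q ^ (_ + _)); first by ring.
by apply: eq_bigr => i _; ring.
Qed.

(** Regrouping the factors interval by interval exhibits the coefficient as an
    interpolation term: in each interval the entry and its lowered position are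
    poles, unless they meet the corresponding end, which then cancels them. *)
Lemma row_upE j : l j < b j -> row_up j = - q ^ Q / (q - q^-1) * term (inl j).
Proof.
move=> lb; rewrite /row_up (bigD1 j) //= -[in LHS]mulrA -[in LHS]prodf_div.
under eq_bigr => i ij.
  have [g1 g2] := gap_up lb ij.
  rewrite -mulf_div ratio_b // ratio_a // mulrACA -expfzDr //.
over.
rewrite !big_split /= -!qpow_sum /term split_term /=.
rewrite [X in _ = _ * (_ * (X * _))](eq_bigl (fun i => i != j)); last first.
  by move=> i; rewrite (inj_eq inl_inj).
rewrite [X in _ = _ * (_ * (_ * X))](bigD1 j) //=.
have -> : qnum (l j + 1 - a j) = qnum (l j + 1 - a j) / qnum (l j + 1 - l j).
  by rewrite (_ : l j + 1 - l j = 1) ?qnum1 ?divr1 //; ring.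
rewrite ratio_a; last by lia.
rewrite qnum_step (expQ j) /be /pi /=.
set A := (if _ then _ else _); set B := \prod_(_ | _) _; set D := \prod_(_ | _) _.
by ring.
Qed.

Lemma row_downE j : a j < l j -> row_down j = q ^ Q / (q - q^-1) * term (inr j).
Proof.
move=> lb; rewrite /row_down (bigD1 j) //= -[in LHS]mulrA -[in LHS]prodf_div.
under eq_bigr => i ij.
  have [g1 g2] := gap_down lb ij.
  rewrite -mulf_div ratio_b // -{3 4}[l j](subrK 1) ratio_a ?subrK // mulrACA -expfzDr //.
over.
rewrite !big_split /= -!qpow_sum /term split_term /=.
rewrite [X in _ = _ * (_ * (_ * X))](eq_bigl (fun i => i != j)); last first.
  by move=> i; rewrite (inj_eq inr_inj).
rewrite [X in _ = _ * (_ * (X * _))](bigD1 j) //=.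
have -> : qnum (l j - 1 - b j) = - (qnum (l j - 1 - b j) / qnum (l j - 1 - l j)).
  by rewrite (_ : l j - 1 - l j = - 1) ?qnumN ?qnum1 ?invrN1 ?mulrN1 ?opprK //; ring.
rewrite ratio_b; last by lia.
have -> : l j - a j = (l j - 1) - (a j - 1) by ring.
rewrite qnum_step (_ : l j - 1 - (a j - 1) = l j - a j); last by ring.
rewrite (expQ j) /be /pi /=.
set A := (if _ then _ else _); set B := \prod_(_ | _) _; set D := \prod_(_ | _) _.
by ring.
Qed.

(** By row_upE and row_downE the two families of coefficients are, up to sign and to
    the common factor q^Q / (q - q^-1), the terms of a single interpolation sum, whose
    value is 1 - q^(-2 Q). *)
Lemma row_commutator :
  \sum_(j | a j < l j) row_down j - \sum_(j | l j < b j) row_up j = qnum Q.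
Proof.
rewrite (eq_bigr (fun j => q ^ Q / (q - q^-1) * term (inr j))); last exact: row_downE.
rewrite [X in _ - X](eq_bigr (fun j => - q ^ Q / (q - q^-1) * term (inl j))); last exact: row_upE.
have E : \sum_(j | l j < b j) term (inl j) + \sum_(j | a j < l j) term (inr j) =
    1 - q ^ (- 2 * Q).
  by rewrite -sum_term [RHS]big_mkcond big_sumType -!big_mkcond.
rewrite -!mulr_sumr !mulNr opprK -mulrDr [X in _ * X]addrC E mulrBr mulr1.
rewrite mulrAC -expfzDr // /qnum mulrBl; congr (_ / _ - q ^ _ / _); ring.
Qed.
End Row.
End QNumbers.

(** * Gelfand-Tsetlin patterns *)

Definition array := nat -> nat -> int.

Definition shift (L : array) (k j : nat) (c : int) : array :=
  fun r i => L r i + c * (((r == k) && (i == j) : nat)%:Z).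

(** The K_j-weight. Adding i%:Z undoes the shift of coordinates made in pattern. *)
Definition wt (j : nat) (L : array) : int :=
  \sum_(i < j.+1) (L j i + i%:Z) - \sum_(i < j) (L j.-1 i + i%:Z).

Lemma shiftK L k j c : shift (shift L k j c) k j (- c) = L.
Proof. by apply/funext=> r; apply/funext=> i; rewrite /shift; ring. Qed.

Lemma shiftC L k j c k' j' c' :
  shift (shift L k j c) k' j' c' = shift (shift L k' j' c') k j c.
Proof. by apply/funext=> r; apply/funext=> i; rewrite /shift; ring. Qed.

Lemma shift_at L k j c : shift L k j c k j = L k j + c.
Proof. by rewrite /shift !eqxx mulr1. Qed.

Lemma shift_off L k j c r i : (r != k) || (i != j) -> shift L k j c r i = L r i.
Proof. by rewrite /shift -negb_and => /negPf ->; rewrite mulr0 addr0. Qed.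

Section Patterns.
Variables (d : nat) (top : nat -> int).

(** Gelfand-Tsetlin patterns with top row top, in the coordinates in which the
    j-th entry of a row is lowered by j: rows are strictly decreasing, and row k
    (which has k + 1 entries) interlaces with row k + 1. Entries outside the triangle
    are set to 0, so that patterns are equal when they are equal as arrays. *)
Record pattern (L : array) : Prop := Pattern {
  pat_out : forall k j, (d <= k)%N || (k < j)%N -> L k j = 0;
  pat_top : forall j, (j < d)%N -> L d.-1 j = top j;
  pat_lt : forall k j, (k.+1 < d)%N -> (j <= k)%N -> L k.+1 j.+1 < L k j;
  pat_le : forall k j, (k.+1 < d)%N -> (j <= k)%N -> L k j <= L k.+1 j }.

(** In an inequality between two entries, raising one of them and lowering the other
    push the same way; an inequality that holds before and after both moves holds in
    between. *)
Lemma pattern_corner L k j k' j' :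
  (k, j) != (k', j') -> pattern L -> pattern (shift (shift L k j 1) k' j' (- 1)) ->
  pattern (shift L k j 1) /\ pattern (shift L k' j' (- 1)).
Proof.
move=> /eqP ne [o1 t1 lt1 le1] [o2 t2 lt2 le2].
have {}ne : (k != k') || (j != j').
  by rewrite -negb_and; apply/negP => /andP[/eqP e /eqP e']; apply: ne; rewrite e e'.
pose a r i : bool := (r == k) && (i == j); pose b r i : bool := (r == k') && (i == j').
have sep r i : a r i -> b r i = false.
  by case/andP => /eqP e1 /eqP e2; apply/negP => /andP[/eqP e3 /eqP e4]; lia.
rewrite /shift in o2 t2 lt2 le2 *.
split; split.
- move=> r i h; move: (sep r i) (o1 r i h) (o2 r i h); rewrite -/(a r i) -/(b r i).
  by case: (a r i) => [->|_] //; rewrite mulr0 addr0.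
- move=> i h; move: (sep d.-1 i) (t1 i h) (t2 i h); rewrite -/(a _ i) -/(b _ i).
  by case: (a _ i) => [->|_] //; rewrite ?mulr0 !addr0.
- move=> r i h h'; move: (sep r i) (sep r.+1 i.+1) (lt1 r i h h') (lt2 r i h h').
  rewrite -/(a r i) -/(b r i) -/(a r.+1 i.+1) -/(b r.+1 i.+1).
  by case: (a r i); case: (a r.+1 i.+1); case: (b r i); case: (b r.+1 i.+1) => /=; lia.
- move=> r i h h'; move: (sep r i) (sep r.+1 i) (le1 r i h h') (le2 r i h h').
  rewrite -/(a r i) -/(b r i) -/(a r.+1 i) -/(b r.+1 i).
  by case: (a r i); case: (a r.+1 i); case: (b r i); case: (b r.+1 i) => /=; lia.
- move=> r i h; move: (sep r i) (o1 r i h) (o2 r i h); rewrite -/(a r i) -/(b r i).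
  by case: (a r i); case: (b r i) => /=; lia.
- move=> i h; move: (sep d.-1 i) (t1 i h) (t2 i h); rewrite -/(a _ i) -/(b _ i).
  by case: (a _ i); case: (b _ i) => /=; lia.
- move=> r i h h'; move: (sep r i) (sep r.+1 i.+1) (lt1 r i h h') (lt2 r i h h').
  rewrite -/(a r i) -/(b r i) -/(a r.+1 i.+1) -/(b r.+1 i.+1).
  by case: (a r i); case: (a r.+1 i.+1); case: (b r i); case: (b r.+1 i.+1) => /=; lia.
- move=> r i h h'; move: (sep r i) (sep r.+1 i) (le1 r i h h') (le2 r i h h').
  rewrite -/(a r i) -/(b r i) -/(a r.+1 i) -/(b r.+1 i).
  by case: (a r i); case: (a r.+1 i); case: (b r i); case: (b r.+1 i) => /=; lia.
Qed.

Section RowInterval.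
Variables (L : array) (k : nat).

(* the range left to the entry (k, i) by the rows k + 1 and k - 1 *)
Definition lo (i : nat) : int :=
  if (i < k)%N then Order.max (L k.+1 i.+1 + 1) (L k.-1 i) else L k.+1 i.+1 + 1.
Definition hi (i : nat) : int :=
  if i is i'.+1 then Order.min (L k.+1 i) (L k.-1 i' - 1) else L k.+1 0%N.

Hypotheses (pL : pattern L) (kd : (k.+1 < d)%N).

Lemma lo_hi i : (i <= k)%N -> lo i <= L k i <= hi i.
Proof.
move=> ik; have lt := pat_lt pL kd ik; have le := pat_le pL kd ik.
have dn j : (j < k)%N -> L k j.+1 < L k.-1 j /\ L k.-1 j <= L k j.
  move=> jk; have k0 : (k.-1.+1 = k)%N by lia.
  have jk' : (j <= k.-1)%N by lia.
  have kd' : (k.-1.+1 < d)%N by lia.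
  by move: (pat_lt pL kd' jk') (pat_le pL kd' jk'); rewrite k0.
apply/andP; split.
  by rewrite /lo; case: ifP => [/dn[]|_]; lia.
rewrite /hi; case: i ik lt le => // i ik lt le; have [] := dn _ ik; lia.
Qed.

Lemma hi_lo i j : (i < j)%N -> (j <= k)%N -> hi j < lo i.
Proof.
have adj j' : (j' < k)%N -> hi j'.+1 < lo j' by move=> jk; rewrite /lo /hi jk; lia.
elim: j => // j IHj; rewrite ltnS leq_eqVlt => /orP[/eqP ->|ij] jk; first exact: adj.
have jk' : (j <= k)%N by lia.
by have := IHj ij jk'; have := lo_hi jk'; have := adj _ jk; lia.
Qed.

Lemma pattern_up j : (j <= k)%N -> pattern (shift L k j 1) <-> L k j < hi j.
Proof.
move=> jk; split=> [pS|lt].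
  have := pat_le pS kd jk; rewrite shift_at shift_off; last by lia.
  rewrite /hi; case: j jk pS => [|j] jk pS /=; first by lia.
  have jk' : (j <= k.-1)%N by lia.
  have kd' : (k.-1.+1 < d)%N by lia.
  have k0 : k.-1.+1 = k by lia.
  have := pat_lt pS kd' jk'; rewrite k0 shift_at shift_off; last by lia.
  by lia.
case: (pL) => o t l1 l2; split.
- by move=> r i h; rewrite shift_off ?o //; lia.
- by move=> i h; rewrite shift_off ?t //; lia.
- move=> r i h ir; have := l1 r i h ir; rewrite {2}/shift.
  case: (altP (r.+1 =P k)) => [e|]; last by move=> ?; rewrite shift_off; lia.
  case: (altP (i.+1 =P j)) => [e'|]; last by move=> ?; rewrite shift_off; lia.
  by rewrite e e' shift_at; move: lt; rewrite /hi -e' -e /=; lia.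
- move=> r i h ir; have := l2 r i h ir; rewrite {2}/shift.
  case: (altP (r =P k)) => [e|]; last by move=> ?; rewrite shift_off; lia.
  case: (altP (i =P j)) => [e'|]; last by move=> ?; rewrite shift_off; lia.
  by rewrite e e' shift_at; move: lt; rewrite /hi; case: (j) => /=; lia.
Qed.

Lemma pattern_down j : (j <= k)%N -> pattern (shift L k j (- 1)) <-> lo j < L k j.
Proof.
move=> jk; split=> [pS|lt].
  have := pat_lt pS kd jk; rewrite shift_at shift_off; last by lia.
  rewrite /lo; case: ifP => [jk1|]; last by lia.
  have jk' : (j <= k.-1)%N by lia.
  have kd' : (k.-1.+1 < d)%N by lia.
  have k0 : k.-1.+1 = k by lia.
  have := pat_le pS kd' jk'; rewrite k0 shift_at shift_off; last by lia.
  by lia.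
case: (pL) => o t l1 l2; split.
- by move=> r i h; rewrite shift_off ?o //; lia.
- by move=> i h; rewrite shift_off ?t //; lia.
- move=> r i h ir; have := l1 r i h ir; rewrite {1}/shift.
  case: (altP (r =P k)) => [e|]; last by move=> ?; rewrite shift_off; lia.
  case: (altP (i =P j)) => [e'|]; last by move=> ?; rewrite shift_off; lia.
  by rewrite e e' shift_at; move: lt; rewrite /lo; case: ifP; lia.
- move=> r i h ir; have := l2 r i h ir; rewrite {1}/shift.
  case: (altP (r.+1 =P k)) => [e|]; last by move=> ?; rewrite shift_off; lia.
  case: (altP (i =P j)) => [e'|]; last by move=> ?; rewrite shift_off; lia.
  by rewrite e e' shift_at; move: lt; rewrite /lo -e' -e /=; case: ifP; lia.
Qed.
End RowInterval.
End Patterns.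

(** * The squared matrix coefficients *)

Section Coefficients.
Variables (R : rcfType) (q : R).
Hypotheses (q_gt0 : 0 < q) (q_lt1 : q < 1).
Variables (d : nat) (top : nat -> int).
Local Notation qnum := (qnum q).
Local Notation pattern := (pattern d top).

(** What an entry of row r at distance z contributes to the square of the coefficient
    of a move in row k. *)
Definition interaction (r k : nat) (z : int) : R :=
  if r == k.+1 then qnum z
  else if k == r.+1 then qnum (z + 1)
  else if r == k then (qnum z * qnum (z + 1))^-1 else 1.

Definition entries : pred ('I_d * 'I_d) := fun p => (p.2 <= p.1)%N.

(** The square of the Gelfand-Tsetlin coefficient of the move that raises the entry
    (k, j). Written as a product over all other entries, it shows the effect of moving
    any one of them. *)
Definition coef2 (k j : nat) (L : array) : R :=
  - \prod_(p | entries p && ((p.1 : nat, p.2 : nat) != (k, j)))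
      interaction p.1 k (L k j - L p.1 p.2).

Lemma interaction_sym r k z :
  interaction r k z * interaction k r (- z) =
  interaction r k (z - 1) * interaction k r (- z - 1).
Proof.
have E1 : - z + 1 = - (z - 1) by ring.
have E2 : - z - 1 = - (z + 1) by ring.
rewrite /interaction; have [-> | rk] := eqVneq r k.
  rewrite (_ : k == k.+1 = false); last by lia.
  by rewrite -!invfM !subrK E1 E2 !qnumN; congr (_^-1); ring.
have [-> | rk1] := eqVneq r k.+1.
  rewrite (_ : k == k.+2 = false) ?eqxx; last by lia.
  by rewrite !subrK E1 !qnumN; ring.
have [_ | _] := eqVneq k r.+1; last by [].
by rewrite !subrK E2 !qnumN; ring.
Qed.

(** Two different entries of a pattern interact only through their difference,
    and moving either one up by a unit changes the product of the two
    interactions in the same way. *)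
Lemma coef2_exchange k j k' j' L :
  (k < d)%N -> (j <= k)%N -> (k' < d)%N -> (j' <= k')%N ->
  (k, j) != (k', j') ->
  coef2 k j L * coef2 k' j' L =
  coef2 k j (shift L k' j' 1) * coef2 k' j' (shift L k j 1).
Proof.
move=> kd jk kd' jk' ne.
have split k1 j1 k2 j2 L1 : (k2 < d)%N -> (j2 <= k2)%N -> (k1, j1) != (k2, j2) ->
    exists2 G : int -> R,
      coef2 k1 j1 L1 = - (interaction k2 k1 (L1 k1 j1 - L1 k2 j2) * G (L1 k1 j1))
      & coef2 k1 j1 (shift L1 k2 j2 1) =
        - (interaction k2 k1 (L1 k1 j1 - L1 k2 j2 - 1) * G (L1 k1 j1)).
  move=> kd2 jk2 ne1.
  have j2d : (j2 < d)%N by lia.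
  pose p0 : 'I_d * 'I_d := (Ordinal kd2, Ordinal j2d).
  have p0P : entries p0 && ((p0.1 : nat, p0.2 : nat) != (k1, j1)).
    by rewrite /entries /= jk2 eq_sym.
  pose P p := entries p && ((p.1 : nat, p.2 : nat) != (k1, j1)) && (p != p0).
  exists (fun x => \prod_(p | P p) interaction p.1 k1 (x - L1 p.1 p.2)).
    by rewrite /coef2 (bigD1 p0).
  have E1 : shift L1 k2 j2 1 k1 j1 = L1 k1 j1.
    by rewrite shift_off // -negb_and -xpair_eqE.
  rewrite /coef2 (bigD1 p0) //= E1 shift_at opprD addrA.
  congr (- (_ * _)); apply: eq_bigr => -[p1 p2] /andP[_ /= pp].
  rewrite shift_off //; move: pp; rewrite xpair_eqE negb_and.
  by rewrite -!(inj_eq val_inj).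
have [G E1 E2] := split k j k' j' L kd' jk' ne.
have [|G' E1' E2'] := split k' j' k j L kd jk; first by rewrite eq_sym.
rewrite E1 E2 E1' E2'.
have -> : L k' j' - L k j = - (L k j - L k' j') by rewrite opprB.
have := interaction_sym k' k (L k j - L k' j').
set x1 := interaction _ _ _; set x2 := interaction _ _ _.
set x3 := interaction _ _ _; set x4 := interaction _ _ _ => H.
transitivity (x1 * x2 * (G (L k j) * G' (L k' j'))); first by ring.
by rewrite H; ring.
Qed.

Lemma coef2_rows k j L : (k.+1 < d)%N -> (j <= k)%N ->
  coef2 k j L =
  - ((\prod_(i < k.+2) qnum (L k j - L k.+1 i)) *
     (\prod_(i < k) qnum (L k j + 1 - L k.-1 i)) /
     \prod_(i < k.+1 | i != j :> nat) (qnum (L k j - L k i) * qnum (L k j + 1 - L k i))).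
Proof.
move=> kd jk; rewrite /coef2; congr (- _).
pose F r i := interaction r k (L k j - L r i).
pose G r := \prod_(i < r.+1 | (r, i : nat) != (k, j)) F r i.
have -> : \prod_(p | entries p && ((p.1 : nat, p.2 : nat) != (k, j)))
      interaction p.1 k (L k j - L p.1 p.2) = \prod_(r < d) G r.
  transitivity (\prod_(r < d) \prod_(i < d | (i <= r)%N && ((r : nat, i : nat) != (k, j))) F r i).
    by rewrite pair_big_dep; apply: eq_bigr => -[].
  apply: eq_bigr => r _; rewrite /G.
  rewrite (big_ord_widen_cond d (fun i => (r : nat, i) != (k, j)) (F r)) //.
  by apply: eq_bigl => i; rewrite andbC ltnS.
have G1 r : (r != k.+1) -> (k != r.+1) -> (r != k) -> G r = 1.
  move=> r1 r2 r3; apply: big1 => i _.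
  by rewrite /F /interaction (negPf r1) (negPf r2) (negPf r3).
have kd' : (k < d)%N by lia.
rewrite (bigD1 (Ordinal kd)) //= (bigD1 (Ordinal kd')) /=; last by rewrite -val_eqE /=; lia.
have Gk : G k = (\prod_(i < k.+1 | i != j :> nat)
    (qnum (L k j - L k i) * qnum (L k j + 1 - L k i)))^-1.
  rewrite /G -prodfV; apply: eq_big => [i|i _]; first by rewrite xpair_eqE eqxx.
  rewrite /F /interaction eqxx (_ : k == k.+1 = false); last by lia.
  by rewrite addrAC.
have Gk1 : G k.+1 = \prod_(i < k.+2) qnum (L k j - L k.+1 i).
  rewrite /G; apply: eq_big => [i|i _]; first by rewrite xpair_eqE; lia.
  by rewrite /F /interaction eqxx.
have -> : \prod_(i < d | (i != Ordinal kd) && (i != Ordinal kd')) G i =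
    \prod_(i < k) qnum (L k j + 1 - L k.-1 i).
  case: (posnP k) => [k0|k0].
    rewrite [RHS]big1 => [|[i ik]]; last by exfalso; lia.
    by apply: big1 => i; rewrite -!val_eqE /= => ?; apply: G1; lia.
  have kd'' : (k.-1 < d)%N by lia.
  rewrite (bigD1 (Ordinal kd'')) /=; last by rewrite -!val_eqE /=; lia.
  rewrite [X in _ * X]big1 ?mulr1 => [|i]; last first.
    by rewrite -!val_eqE /= => ?; apply: G1; lia.
  rewrite /G prednK //; apply: eq_big => [i|i _]; first by rewrite xpair_eqE; lia.
  rewrite /F /interaction prednK // eqxx (_ : k.-1 == k.+1 = false); last by lia.
  by rewrite addrAC.
by rewrite Gk Gk1 mulrCA mulrC.
Qed.

Section OneRow.
Variables (L : array) (k : nat).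
Hypotheses (kd : (k.+1 < d)%N) (pL : pattern L).
Local Notation n := (k.+1).
Let l (i : 'I_n) := L k i.
Let a (i : 'I_n) := lo L k i.
Let b (i : 'I_n) := hi L k i.

Let lab i : a i <= l i <= b i.
Proof. by apply: (lo_hi pL kd); rewrite -ltnS. Qed.
Let sep (i j : 'I_n) : (i < j)%N -> b j < a i.
Proof. by move=> ij; apply: (hi_lo pL kd ij); rewrite -ltnS. Qed.

(** Between two neighbouring entries of row k there is one entry of row k + 1 and one
    of row k - 1: the larger ends one interval and the smaller the other. *)
Lemma regroup_neighbours (T : Type) (idx : T) (op : Monoid.com_law idx) (f : int -> T) :
  op (\big[op/idx]_(i < k.+2) f (L k.+1 i)) (\big[op/idx]_(i < k) f (L k.-1 i - 1)) =
  \big[op/idx]_(i < n) op (f (b i)) (f (a i - 1)).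
Proof.
rewrite big_split /= [X in _ = op X _]big_ord_recl [X in _ = op _ X]big_ord_recr /=.
rewrite big_ord_recl big_ord_recr /= /a /b /lo /= ltnn addrK.
rewrite -!Monoid.mulmA; congr (op _ _).
have opC : commutative op := Monoid.mulmC _.
have opA : associative op := Monoid.mulmA _.
have opCA : left_commutative op := Monoid.mulmCA _.
etransitivity; first exact: opCA.
rewrite [RHS]opA [RHS]opC; congr (op _ _).
rewrite -!big_split; apply: eq_bigr => i _ /=.
rewrite /bump /= add1n ltn_ord.
set x := L k.+1 _; set y := L k.-1 _.
case: (ltP x (y - 1)) => h.
  by rewrite (_ : Order.max (x + 1) y - 1 = y - 1) //; lia.
by rewrite (_ : Order.max (x + 1) y - 1 = x) ?[op (f x) _]opC //; lia.
Qed.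

Lemma coef2_up (j : 'I_n) : coef2 k j L = row_up q l a b j.
Proof.
rewrite coef2_rows ?leq_ord // /row_up; congr (- (_ / _)).
have := regroup_neighbours *%R (fun x => qnum (L k j - x)).
rewrite (eq_bigr (fun i : 'I_k => qnum (L k j + 1 - L k.-1 i))) => [->|i _]; last first.
  by congr qnum; ring.
by apply: eq_bigr => i _; congr (_ * qnum _); ring.
Qed.

Lemma coef2_down (j : 'I_n) : coef2 k j (shift L k j (- 1)) = row_down q l a b j.
Proof.
rewrite coef2_rows ?leq_ord // /row_down; congr (- (_ / _)).
  transitivity ((\prod_(i < k.+2) qnum (L k j - 1 - L k.+1 i)) *
                (\prod_(i < k) qnum (L k j - 1 - (L k.-1 i - 1)))).
    congr (_ * _); apply: eq_bigr => -[i ik] _ /=; rewrite shift_at shift_off ?subrK //; try lia.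
    by congr qnum; ring.
  have /= -> := regroup_neighbours *%R (fun x => qnum (L k j - 1 - x)).
  by apply: eq_bigr => i _; congr (_ * qnum _); rewrite /l /a; ring.
apply: eq_big => [i|i ij]; first by [].
rewrite shift_at shift_off; last by rewrite ij orbT.
by rewrite subrK.
Qed.

Lemma coef2_gt0 j : (j <= k)%N -> pattern (shift L k j 1) -> 0 < coef2 k j L.
Proof.
move=> jk; have jn : (j < n)%N by rewrite ltnS.
move=> /(pattern_up pL kd jk) lt.
by rewrite -[j]/(val (Ordinal jn)) coef2_up; apply: row_up_gt0.
Qed.

(** The moves that stay inside the intervals of row k are the moves to patterns, so
    this is row_commutator; by regroup_neighbours the interval ends sum up to the two
    neighbouring rows. *)
Lemma coef2_commutator :
  \sum_(j < n | `[< pattern (shift L k j (- 1)) >]) coef2 k j (shift L k j (- 1))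
  - \sum_(j < n | `[< pattern (shift L k j 1) >]) coef2 k j L =
  qnum (2 * (\sum_(i < k.+1) (L k i + i%:Z))
        - \sum_(i < k.+2) (L k.+1 i + i%:Z) - \sum_(i < k) (L k.-1 i + i%:Z)).
Proof.
have := row_commutator q_gt0 q_lt1 lab sep.
under eq_bigl => j.
  rewrite (_ : (a j < l j) = `[< pattern (shift L k j (- 1)) >]); last first.
    by apply/idP/asboolP => /(pattern_down pL kd (leq_ord j)).
over.
under [X in _ - X]eq_bigl => j.
  rewrite (_ : (l j < b j) = `[< pattern (shift L k j 1) >]); last first.
    by apply/idP/asboolP => /(pattern_up pL kd (leq_ord j)).
over.
rewrite /= (eq_bigr _ (fun j _ => esym (coef2_down j))).
rewrite [X in _ - X](eq_bigr _ (fun j _ => esym (coef2_up j))) => ->.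
congr qnum; rewrite /l.
have := regroup_neighbours +%R id => /= E.
have one m : \sum_(i < m) (1 : int) = m%:Z by rewrite sumr_const card_ord -natz.
have -> : \sum_(i < n) (2 * L k i - a i - b i) =
    2 * (\sum_(i < n) L k i) - \sum_(i < n) (b i + (a i - 1)) - n%:Z.
  by rewrite mulr_sumr -one -!sumrB; apply: eq_bigr => i _; ring.
have ids m : \sum_(i < m) (i%:Z : int) = (\sum_(i < m) i)%N%:Z.
  by rewrite -natz natr_sum; apply: eq_bigr => i _; rewrite natz.
rewrite -E sumrB one !big_split /= !ids !(big_ord_recr k.+1) !(big_ord_recr k) /=.
rewrite !PoszD intS; ring.
Qed.
End OneRow.
End Coefficients.

(** * Enumeration of the patterns with a given top row *)

Definition int_range (y x : int) : seq int :=
  if y <= x then [seq y + i.+1%:Z | i <- iota 0 (absz (x - y)%R)] else [::].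

Lemma mem_int_range y x c : (c \in int_range y x) = (y < c <= x).
Proof.
rewrite /int_range; case: ifP => yx; last by rewrite in_nil; lia.
apply/mapP/idP => [[k] | h]; first by rewrite mem_iota => ? ->; lia.
by exists (absz (c - y - 1)%R); rewrite ?mem_iota; lia.
Qed.

Lemma uniq_int_range y x : uniq (int_range y x).
Proof.
rewrite /int_range; case: ifP => // _; rewrite map_inj_uniq ?iota_uniq //.
by move=> i j /=; lia.
Qed.

Fixpoint interlacing (r : seq int) : seq (seq int) :=
  if r is x :: r' then
    if r' is y :: _ then [seq c :: s | c <- int_range y x, s <- interlacing r']
    else [:: [::]]
  else [::].

Lemma interlacingP (r s : seq int) : r != [::] ->
  reflect (size s = (size r).-1 /\ forall i, (i < size s)%N -> r`_i.+1 < s`_i <= r`_i)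
          (s \in interlacing r).
Proof.
elim: r s => // x [|y r] IHr s _ /=.
  rewrite inE; apply: (iffP eqP) => [-> | [/size0nil]] //.
apply: (iffP allpairsPdep) => [[c [t [crange /(IHr _ isT)[szt tP] ->]]] | [szs sP]].
  split=> [|[|i] lt]; rewrite /= ?szt //.
    by rewrite mem_int_range in crange.
  exact: tP.
case: s szs sP => //= c t [szt] tP; exists c, t; split=> //.
  by rewrite mem_int_range; exact: (tP 0%N).
by apply/(IHr _ isT); split=> // i lt; apply: (tP i.+1).
Qed.

Lemma uniq_interlacing r : uniq (interlacing r).
Proof.
elim: r => // x [|y r] IHr //=; apply: allpairs_uniq => //; first exact: uniq_int_range.
by move=> [c s] [c' s'] _ _ /= [-> ->].
Qed.

(** Lists of rows, bottom row first: an explicit list makes the patterns a finite type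
    and lets sums over them be computed row by row. *)
Fixpoint patterns (n : nat) (r : seq int) : seq (seq (seq int)) :=
  if n is n'.+1 then [seq rcons p r | s <- interlacing r, p <- patterns n' s]
  else [:: [::]].

Definition arr (p : seq (seq int)) : array := fun k j => (nth [::] p k)`_j.

Lemma size_patterns n r p : p \in patterns n r -> size p = n.
Proof.
elim: n r p => [|n IHn] r p /=; first by rewrite inE => /eqP ->.
by move=> /allpairsPdep[s [t [_ /IHn szt ->]]]; rewrite size_rcons szt.
Qed.

Lemma last_patterns n r p : p \in patterns n.+1 r -> nth [::] p n = r.
Proof.
move=> /allpairsPdep[s [t [_ /size_patterns szt ->]]].
by rewrite nth_rcons szt ltnn eqxx.
Qed.

Lemma size_row_patterns n r p k : size r = n -> p \in patterns n r -> (k < n)%N ->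
  size (nth [::] p k) = k.+1.
Proof.
elim: n r p => // n IHn r p szr /allpairsPdep[s [t [sr tP ->]]] kn.
have r0 : r != [::] by rewrite -size_eq0 szr.
rewrite nth_rcons (size_patterns tP); have [kn1|kn1|->] := ltngtP k n; last by rewrite szr.
  by apply: IHn tP kn1; move/(interlacingP _ r0): sr => [-> _]; rewrite szr.
by move: kn; rewrite ltnS leqNgt kn1.
Qed.

Lemma uniq_patterns n r : size r = n -> uniq (patterns n r).
Proof.
elim: n r => // n IHn r szr /=.
have r0 : r != [::] by rewrite -size_eq0 szr.
apply: allpairs_uniq_dep => [||[s p] [s' p']]; first exact: uniq_interlacing.
  by move=> s /(interlacingP _ r0)[szs _]; apply: IHn; rewrite szs szr.
move=> /allpairsPdep[s1 [p1 [s1r p1P [-> ->]]]] /allpairsPdep[s2 [p2 [s2r p2P [-> ->]]]] /=.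
move=> /rcons_inj[pp]; rewrite pp.
suff -> : s1 = s2 by [].
case: n IHn szr p1P p2P => [|n] _ szr p1P p2P.
  move: s1r s2r => /(interlacingP _ r0)[+ _] /(interlacingP _ r0)[+ _].
  by rewrite szr => /size0nil -> /size0nil ->.
by rewrite -(last_patterns p1P) -(last_patterns p2P) pp.
Qed.

Lemma arr_pattern n r p : size r = n -> p \in patterns n r ->
  pattern n (nth 0 r) (arr p).
Proof.
elim: n r p => [|n IHn] r p szr.
  rewrite inE => /eqP ->; split=> //= k j _; rewrite /arr nth_nil //.
  by rewrite nth_nil.
have r0 : r != [::] by rewrite -size_eq0 szr.
move=> /allpairsPdep[s [t [/(interlacingP _ r0)[szs sP] tP ->]]].
have szt := size_patterns tP; rewrite szr /= in szs.
have [o tp lt le] := IHn s t szs tP.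
have rowlt k : (k < n)%N -> arr (rcons t r) k = arr t k.
  by move=> kn; apply/funext=> j; rewrite /arr nth_rcons szt kn.
have rown : arr (rcons t r) n = nth 0 r.
  by apply/funext=> j; rewrite /arr nth_rcons szt ltnn eqxx.
split=> [k j | j jn | k j kn jk | k j kn jk].
- have [kn h|kn h|-> h] := ltngtP k n.
  + by rewrite rowlt // o //; lia.
  + by rewrite /arr [nth [::] _ _]nth_default ?nth_nil // size_rcons szt.
  + by rewrite rown nth_default // szr; lia.
- by rewrite rown.
- have [kn'|kn'] := ltnP k.+1 n; first by rewrite !rowlt ?lt //; lia.
  have -> : k.+1 = n by lia.
  rewrite rown rowlt; last by lia.
  have -> : k = n.-1 by lia.
  by rewrite tp; [have := sP j; rewrite szs; lia | lia].
- have [kn'|kn'] := ltnP k.+1 n; first by rewrite !rowlt ?le //; lia.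
  have -> : k.+1 = n by lia.
  rewrite rown rowlt; last by lia.
  have -> : k = n.-1 by lia.
  by rewrite tp; [have := sP j; rewrite szs; lia | lia].
Qed.

Lemma pattern_arr n r L : size r = n -> pattern n (nth 0 r) L ->
  exists2 p, p \in patterns n r & arr p = L.
Proof.
elim: n r L => [|n IHn] r L szr [o tp lt le].
  exists [::]; first by rewrite inE.
  by apply/funext=> k; apply/funext=> j; rewrite /arr !nth_nil o.
have r0 : r != [::] by rewrite -size_eq0 szr.
pose s := mkseq (L n.-1) n.
pose L' : array := fun k j => if (k < n)%N then L k j else 0.
have szs : size s = n by rewrite size_mkseq.
have [|p pP pL] := IHn s L' szs.
  split=> [k j h | j jn | k j kn jk | k j kn jk]; rewrite /L'.
  - by case: ifP => // kn; apply: o; lia.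
  - by rewrite nth_mkseq // ifT //; lia.
  - by rewrite !ifT; [apply: lt; lia | lia | lia].
  - by rewrite !ifT; [apply: le; lia | lia | lia].
have szp := size_patterns pP.
exists (rcons p r).
  apply/allpairsPdep; exists s, p; split=> //.
  apply/(interlacingP _ r0); rewrite szs szr; split=> // i ilt.
  rewrite nth_mkseq // -!tp //=; last lia.
  have e : n.-1.+1 = n by lia.
  have := lt n.-1 i; have := le n.-1 i; rewrite e; lia.
apply/funext=> k; apply/funext=> j; rewrite /arr nth_rcons szp.
have [kn|kn|->] := ltngtP k n.
- by have := congr1 (fun f => f k j) pL; rewrite /L' kn.
- by rewrite nth_nil o //; lia.
- have [jn|jn] := ltnP j n.+1; first by rewrite tp.
  by rewrite nth_default ?szr // o //; lia.
Qed.
Lemma arr_inj n r : size r = n -> {in patterns n r &, injective arr}.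
Proof.
elim: n r => [|n IHn] r szr p p'; first by rewrite !inE => /eqP-> /eqP->.
have r0 : r != [::] by rewrite -size_eq0 szr.
move=> /allpairsPdep[s [t [/(interlacingP _ r0)[szs _] tP ->]]].
move=> /allpairsPdep[s' [t' [/(interlacingP _ r0)[szs' _] tP' ->]]] E.
have szt := size_patterns tP; have szt' := size_patterns tP'.
have {}E k j : (k < n)%N -> arr t k j = arr t' k j.
  by move=> kn; have := congr1 (fun f => f k j) E; rewrite /arr !nth_rcons szt szt' kn.
have ss : s = s'.
  case: n IHn szr szt szt' tP tP' E => [|n] _ szr szt szt' tP tP' E.
    by move: szs szs'; rewrite szr => /size0nil -> /size0nil ->.
  rewrite szr /= in szs szs'.
  apply: (@eq_from_nth _ 0) => [|j _]; first by rewrite szs.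
  by have := E n j (leqnn _); rewrite /arr (last_patterns tP) (last_patterns tP').
congr rcons; apply: (IHn s) => //; first by rewrite szs szr.
  by rewrite ss.
apply/funext=> k; apply/funext=> j; have [kn|kn] := ltnP k n; first exact: E.
by rewrite /arr ![nth [::] _ _]nth_default ?szt ?szt'.
Qed.

(** * The principal specialization of a sum over patterns *)

(** Subtract from each column of the Vandermonde matrix the preceding one. *)
Lemma det_Vandermonde_diff (F : comNzRingType) (n : nat) (a : nat -> F) :
  \det (\matrix_(m < n, i < n) (a i.+1 ^+ m.+1 - a i ^+ m.+1)) =
  \prod_(i < n.+1) \prod_(j < n.+1 | (i < j)%N) (a j - a i).
Proof.
pose V := Vandermonde n.+1 (\row_(i < n.+1) a i).
have -> : \prod_(i < n.+1) \prod_(j < n.+1 | (i < j)%N) (a j - a i) = \det V.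
  rewrite det_Vandermonde; apply: eq_bigr => i _; apply: eq_bigr => j _.
  by rewrite !mxE.
pose U : 'M[F]_n.+1 := \matrix_(k, i) ((k == i)%:R - ((k.+1 == i :> nat)%:R)).
have detU : \det U = 1.
  rewrite -det_tr det_trig.
    rewrite big1 // => i _; rewrite !mxE eqxx.
    have -> : i.+1 == i :> nat = false by lia.
    by rewrite subr0.
  apply/is_trig_mxP => i j ij; rewrite !mxE -val_eqE /=.
  have -> : j == i :> nat = false by lia.
  have -> : j.+1 == i :> nat = false by lia.
  by rewrite subr0.
rewrite -[\det V]mulr1 -detU -det_mulmx (expand_det_row _ ord0) big_ord_recl.
have VU m i : (V *m U) m i = a i ^+ m - (if (0 < i)%N then a i.-1 ^+ m else 0).
  rewrite mxE (eq_bigr (fun k : 'I_n.+1 => a k ^+ m * (k == i)%:R - a k ^+ m * (k.+1 == i :> nat)%:R)).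
    rewrite sumrB; congr (_ - _).
      by rewrite (bigD1 i) //= eqxx mulr1 big1 ?addr0 // => k /negPf ->; rewrite mulr0.
    case: ifP => i0; last first.
      rewrite big1 // => k _; have -> : k.+1 == i :> nat = false by lia.
      by rewrite mulr0.
    have iln : (i.-1 < n.+1)%N by have := ltn_ord i; lia.
    rewrite (bigD1 (Ordinal iln)) //= prednK // eqxx mulr1 big1 ?addr0 // => k.
    rewrite -val_eqE /= => ne; have -> : k.+1 == i :> nat = false by lia.
    by rewrite mulr0.
  by move=> k _; rewrite !mxE mulrBr.
rewrite big1 ?addr0 => [|i _]; last first.
  by rewrite VU /= !expr0 subrr mul0r.
rewrite VU /= subr0 expr0 mul1r /cofactor /= expr0 mul1r; congr (\det _).
by apply/matrixP => m i; rewrite [LHS]mxE [RHS]mxE [RHS]mxE VU.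
Qed.

Section Sums.
Variables (F : fieldType) (x : F).
Hypotheses (x0 : x != 0) (x1 : forall m, x ^+ m.+1 != 1).

Lemma sum_int_range b a m : b <= a ->
  \sum_(c <- int_range b a) x ^ (- c * m.+1%:Z) =
  (x ^ (- b * m.+1%:Z) - x ^ (- a * m.+1%:Z)) / (x ^+ m.+1 - 1).
Proof.
move=> ba; rewrite /int_range ba big_map.
have -> : a = b + (absz (a - b)%R)%:Z by lia.
rewrite addrAC subrr add0r /=; move: (absz _) => n.
rewrite -[X in iota 0 X]subn0 -/(index_iota 0 n) big_mkord.
have d0 : x ^+ m.+1 - 1 != 0 by rewrite subr_eq0.
elim: n => [|n IHn]; first by rewrite big_ord0 [b + _]addr0 subrr mul0r.
rewrite big_ord_recr /= IHn.
have -> : x ^ (- (b + n%:Z) * m.+1%:Z) = x ^ (- (b + n.+1%:Z) * m.+1%:Z) * x ^+ m.+1.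
  by rewrite exprnP -expfzDr //; congr (x ^ _); ring.
by field.
Qed.

(** The entries of an interlacing row range independently over their intervals. *)
Lemma sum_interlacing n (r : seq int) (f : 'I_n -> int -> F) : size r = n.+1 ->
  \sum_(s <- interlacing r) \prod_(i < n) f i s`_i =
  \prod_(i < n) \sum_(c <- int_range r`_i.+1 r`_i) f i c.
Proof.
elim: n r f => [|n IHn] [|y r] f //= [szr].
  by case: r szr => //= _; rewrite big_seq1 !big_ord0.
case: r szr => // z r szr.
rewrite big_allpairs_dep big_ord_recl big_distrl /=; apply: eq_bigr => c _.
rewrite -(IHn (z :: r) (fun i => f (lift ord0 i))) // big_distrr /=.
by apply: eq_bigr => s _; rewrite big_ord_recl.
Qed.

Definition row_size (r : seq int) : int := \sum_(i < size r) (r`_i + i%:Z).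

Definition vdm n (y : nat -> F) : F := \prod_(i < n) \prod_(j < n | (i < j)%N) (y j - y i).

Lemma vdm_det n y : vdm n y = \det (Vandermonde n (\row_(i < n) y i)).
Proof.
rewrite det_Vandermonde; apply: eq_bigr => i _; apply: eq_bigr => j _.
by rewrite !mxE.
Qed.

Lemma vdm_geometric n :
  vdm n.+1 (fun i => x ^+ i) =
  vdm n (fun i => x ^+ i) * x ^+ (\sum_(i < n) i) * \prod_(m < n) (x ^+ m.+1 - 1).
Proof.
rewrite /vdm big_ord_recr /= [X in _ * X = _]big1 ?mulr1 => [|i]; last first.
  by have := ltn_ord i; lia.
rewrite (eq_bigr (fun i : 'I_n => (\prod_(j < n | (i < j)%N) (x ^+ j - x ^+ i)) * (x ^+ n - x ^+ i))).
  rewrite big_split /= -mulrA; congr (_ * _).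
  rewrite [X in _ = _ * X](reindex_inj rev_ord_inj) -prodrXr.
  rewrite -big_split /=; apply: eq_bigr => i _.
  by rewrite mulrBr mulr1 -exprD; congr (x ^+ _ - _); have := ltn_ord i; lia.
by move=> i _; rewrite big_mkcond big_ord_recr /= ltn_ord -big_mkcond.
Qed.

(** Principal specialization: the sum over the row s below r of x^-|s| times
    the value at s is, by multilinearity, a determinant of geometric sums, which is
    again a Vandermonde determinant. *)
Lemma sum_patterns n (r : seq int) : size r = n ->
  (forall i, (i.+1 < n)%N -> r`_i.+1 < r`_i) ->
  \sum_(p <- patterns n r) \prod_(k < n.-1) x ^ (- row_size (nth [::] p k)) =
  vdm n (fun i => x ^ (- r`_i)) / vdm n (fun i => x ^+ i).
Proof.
elim: n r => [|n IHn] r szr dec.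
  by rewrite big_seq1 /vdm !big_ord0 divr1.
rewrite [patterns _ _]/= big_allpairs_dep.
have r0 : r != [::] by rewrite -size_eq0 szr.
transitivity (\sum_(s <- interlacing r)
    x ^ (- row_size s) * (vdm n (fun i => x ^ (- s`_i)) / vdm n (fun i => x ^+ i))).
  apply: eq_big_seq => s /(interlacingP _ r0)[szs sP]; rewrite szr /= in szs.
  rewrite -IHn //; last first.
    move=> i iln; have := sP i; have := sP i.+1; have := dec i.+1; rewrite szs; lia.
  rewrite big_distrr /=; apply: eq_big_seq => p pP.
  have szp := size_patterns pP.
  transitivity (\prod_(k < n) x ^ (- row_size (nth [::] p k))).
    by apply: eq_bigr => k _; rewrite nth_rcons szp ltn_ord.
  case: n IHn szr dec szs sP pP szp => [|n] _ szr dec szs sP pP szp.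
    by rewrite !big_ord0 /row_size szs big_ord0 oppr0 expr0z mulr1.
  by rewrite big_ord_recr /= (last_patterns pP) mulrC.
pose Y i := x ^ (- r`_i).
have pow (b : int) m : (x ^ (- b)) ^+ m = x ^ (- b * m%:Z) by rewrite exprnP exprz_exp.
have key : \sum_(s <- interlacing r) x ^ (- row_size s) * vdm n (fun i => x ^ (- s`_i)) =
    (x ^+ (\sum_(i < n) i))^-1 * (vdm n.+1 Y / \prod_(m < n) (x ^+ m.+1 - 1)).
  transitivity (\sum_(s <- interlacing r) (x ^+ (\sum_(i < n) i))^-1 *
      \sum_(sg : 'S_n) (-1) ^+ sg * \prod_(i < n) x ^ (- s`_i * (sg i).+1%:Z)).
    apply: eq_big_seq => s /(interlacingP _ r0)[szs _]; rewrite szr /= in szs.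
    have -> : x ^ (- row_size s) = (x ^+ (\sum_(i < n) i))^-1 * \prod_(i < n) x ^ (- s`_i).
      rewrite /row_size szs -prodrXr -prodfV -big_split /= -sumrN.
      elim/big_rec2: _ => [|i y1 y2 _ <-]; first by rewrite expr0z.
      by rewrite expfzDr // opprD addrC expfzDr // exprnN.
    rewrite -mulrA vdm_det -det_tr; congr (_ * _); rewrite big_distrr /=.
    apply: eq_bigr => sg _; rewrite mulrCA -big_split /=; congr (_ * _).
    apply: eq_bigr => i _; rewrite !mxE pow -expfzDr //; congr (x ^ _).
    by rewrite intS; ring.
  rewrite -big_distrr /=; congr (_ * _); rewrite exchange_big /=.
  rewrite /vdm -det_Vandermonde_diff -det_tr big_distrl /=; apply: eq_bigr => sg _.
  rewrite -big_distrr /= -mulrA; congr (_ * _).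
  rewrite (sum_interlacing (fun i c => x ^ (- c * (sg i).+1%:Z)) szr).
  rewrite [X in _ / X](reindex_inj (@perm_inj _ sg)) -prodf_div.
  apply: eq_bigr => i _; rewrite sum_int_range.
    by rewrite !mxE /Y !pow.
  by apply/ltW/dec; rewrite ltnS.
rewrite (eq_bigr (fun s => x ^ (- row_size s) * vdm n (fun i => x ^ (- s`_i)) / vdm n (fun i => x ^+ i))).
  rewrite -mulr_suml key vdm_geometric -/Y !invfM; ring.
by move=> s _; rewrite mulrA.
Qed.
End Sums.

(** Abel summation turns a weighted sum of the differences wt j into row sums. *)
Lemma weight_abel (L : array) n (c : int) :
  \sum_(j < n.+1) (2 * j%:Z + c) * wt j L =
  (2 * n%:Z + c) * (\sum_(i < n.+1) (L n i + i%:Z))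
  - 2 * \sum_(k < n) \sum_(i < k.+1) (L k i + i%:Z).
Proof.
elim: n => [|n IHn]; first by rewrite /wt !big_ord_recr !big_ord0 /=; ring.
rewrite big_ord_recr IHn [\sum_(k < n.+1) _]big_ord_recr /= /wt /= intS; ring.
Qed.

Lemma sum_pairs n (u : nat -> int) :
  \sum_(i < n) \sum_(j < n | (i < j)%N) (u i + u j) = (n%:Z - 1) * \sum_(i < n) u i.
Proof.
elim: n => [|n IHn]; first by rewrite !big_ord0 mulr0.
rewrite big_ord_recr /= [X in _ + X]big1 ?addr0 => [|i]; last first.
  by have := ltn_ord i; lia.
rewrite (eq_bigr (fun i : 'I_n => (\sum_(j < n | (i < j)%N) (u i + u j)) + (u i + u n))).
  rewrite big_split /= IHn big_split /= sumr_const card_ord big_ord_recr /= -mulr_natl natz intS.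
  ring.
by move=> i _; rewrite big_mkcond big_ord_recr /= ltn_ord -big_mkcond.
Qed.

Section QTrace.
Variables (R : realFieldType) (q : R).
Hypotheses (q_gt0 : 0 < q) (q2 : forall m, (q ^+ 2) ^+ m.+1 != 1).

(** The exponent of the eigenvalue of K_(2 rho)^-1. *)
Definition trace_exponent (n : nat) (L : array) : int :=
  \sum_(j < n) (2 * j%:Z + 1 - n%:Z) * wt j L.

(** sum_patterns with x = q^2; the powers of q that turn differences of powers of q^2
    into q-numbers cancel by sum_pairs. *)
Lemma sum_trace n (r : seq int) : size r = n ->
  (forall i, (i.+1 < n)%N -> r`_i.+1 < r`_i) ->
  \sum_(p <- patterns n r) q ^ trace_exponent n (arr p) =
  \prod_(i < n) \prod_(j < n | (i < j)%N) (qnum q (r`_i - r`_j) / qnum q (j%:Z - i%:Z)).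
Proof.
case: n => [|n] szr dec.
  by rewrite big_seq1 big_ord0 /trace_exponent big_ord0.
have q0 : q != 0 by rewrite gt_eqF.
have x0 : q ^+ 2 != 0 by rewrite expf_neq0.
have qq : q - q^-1 != 0.
  apply: contra_neq (q2 0) => /eqP; rewrite subr_eq0 => /eqP e.
  by rewrite expr1 expr2 {1}e mulVf.
have pow (z : int) : (q ^+ 2) ^ z = q ^ (2 * z) by rewrite exprnP exprz_exp.
transitivity (q ^ (n%:Z * row_size r) *
    \sum_(p <- patterns n.+1 r) \prod_(k < n) (q ^+ 2) ^ (- row_size (nth [::] p k))).
  rewrite big_distrr /=; apply: eq_big_seq => p pP.
  have E k : (k < n.+1)%N -> \sum_(i < k.+1) (arr p k i + i%:Z) = row_size (nth [::] p k).
    by move=> kn; rewrite /row_size (size_row_patterns szr pP kn).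
  rewrite /trace_exponent.
  rewrite (eq_bigr (fun j : 'I_n.+1 => (2 * j%:Z + (1 - n.+1%:Z)) * wt j (arr p))); last first.
    by move=> j _; rewrite addrA.
  rewrite weight_abel E // (last_patterns pP).
  rewrite (eq_bigr (fun k : 'I_n => q ^ (- 2 * row_size (nth [::] p k)))); last first.
    by move=> k _; rewrite pow; congr (q ^ _); ring.
  rewrite -(qpow_sum q_gt0) -expfzDr // -mulr_sumr; congr (q ^ _).
  rewrite (eq_bigr (fun k : 'I_n => row_size (nth [::] p k))); last first.
    by move=> k _; rewrite E // ltnW // ltnS.
  by rewrite intS; ring.
rewrite (sum_patterns x0 q2 szr dec) /vdm.
pose u (i : nat) : int := r`_i + i%:Z.
have -> : n%:Z * row_size r = \sum_(i < n.+1) \sum_(j < n.+1 | (i < j)%N) (u i + u j).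
  rewrite sum_pairs /row_size szr; congr (_ * _); rewrite intS; ring.
rewrite (qpow_sum q_gt0) -prodf_div -big_split /=; apply: eq_bigr => i _.
rewrite (qpow_sum q_gt0) -prodf_div -big_split /=; apply: eq_bigr => j ij.
have E (a b : int) : (q ^+ 2) ^ (- b) - (q ^+ 2) ^ (- a) =
    q ^ (- a - b) * (q - q^-1) * qnum q (a - b).
  rewrite /qnum mulrA mulrAC mulfK // mulrBr -!expfzDr // !pow.
  by congr (q ^ _ - q ^ _); ring.
have E' (m : nat) : (q ^+ 2) ^+ m = (q ^+ 2) ^ (- - m%:Z) by rewrite opprK.
rewrite !E' !E /u; have -> : - i%:Z - - j%:Z = j%:Z - i%:Z by ring.
have nz : qnum q (j%:Z - i%:Z) != 0.
  rewrite /qnum mulf_neq0 ?invr_eq0 // subr_eq0.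
  apply: contra_neq (q2 (j - i.+1)%N) => /eqP e.
  rewrite -[LHS]/((q ^+ 2) ^ (j - i.+1).+1%:Z) pow.
  have -> : 2 * (j - i.+1).+1%:Z = (j%:Z - i%:Z) + (j%:Z - i%:Z) by lia.
  by rewrite expfzDr // {1}(eqP e) -expfzDr // addNr.
have -> : q ^ (r`_i + i%:Z + (r`_j + j%:Z)) =
   q ^ (- - i%:Z - - j%:Z) / q ^ (- r`_i - r`_j).
  by rewrite invr_expz -expfzDr //; congr (q ^ _); ring.
have := qpow_neq0 q_gt0 (- r`_i - r`_j); have := qpow_neq0 q_gt0 (- - i%:Z - - j%:Z).
set a := q ^ (- - _ - _); set b := q ^ _; set c := qnum _ _; set e := qnum q (j%:Z - _) in nz *.
by move: (q - q^-1) qq => w w0 a0 b0; field; rewrite a0 b0 w0 nz.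
Qed.
End QTrace.

(** * Families of operators and highest weight vectors *)

Section LinearAlgebra.
Variable F : fieldType.

(** For functions that are only proved linear, without a packed structure. *)
Lemma linfunP (U W : vectType F) (f : U -> W) :
  linear f -> exists h : 'Hom(U, W), h =1 f.
Proof.
move=> f_lin.
pose fL : {linear U -> W} := HB.pack f (GRing.isLinear.Build F _ _ _ f f_lin).
by exists (linfun fL) => v; rewrite (lfunE fL).
Qed.

Lemma lfunZ (U W : vectType F) (f : 'Hom(U, W)) a v : f (a *: v) = a *: f v.
Proof. exact: linearZ. Qed.
Lemma lfunD (U W : vectType F) (f : 'Hom(U, W)) u v : f (u + v) = f u + f v.
Proof. exact: linearD. Qed.
Lemma lfunB (U W : vectType F) (f : 'Hom(U, W)) u v : f (u - v) = f u - f v.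
Proof. exact: linearB. Qed.

Lemma lfun_sum (U W : vectType F) (f : 'Hom(U, W)) (I : Type) (r : seq I) (P : pred I) E :
  f (\sum_(i <- r | P i) E i) = \sum_(i <- r | P i) f (E i).
Proof. exact: linear_sum. Qed.

(** The subspace generated by w under the Y i is reached as a stable subspace of least
    dimension, so that no spanning family has to be handled. *)
Lemma min_stable (V : vectType F) (I : Type) (Y : I -> 'End(V)) (w : V) :
  exists M : {vspace V}, [/\ w \in M, forall i, (Y i @: M <= M)%VS
    & forall M' : {vspace V}, w \in M' -> (forall i, (Y i @: M' <= M')%VS) ->
      (M <= M')%VS].
Proof.
pose good (M : {vspace V}) := w \in M /\ forall i, (Y i @: M <= M)%VS.
have ex : exists n, `[< exists2 M, good M & \dim M = n >].
  exists (\dim {:V}); apply/asboolP; exists fullv => //; split=> [|i].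
    exact: memvf.
  exact: subvf.
have [m /asboolP[M0 [wM0 YM0] dM0] mmin] := ex_minnP ex.
exists M0; split=> // M' wM' YM'.
have dle : (m <= \dim (M0 :&: M'))%N.
  apply: mmin; apply/asboolP; exists (M0 :&: M')%VS => //; split.
    by rewrite memv_cap wM0.
  move=> i; rewrite subv_cap; apply/andP; split.
    exact: subv_trans (limgS _ (capvSl _ _)) (YM0 i).
  exact: subv_trans (limgS _ (capvSr _ _)) (YM' i).
have /eqP <- : (M0 :&: M' == M0)%VS by rewrite eqEdim capvSl dM0.
exact: capvSr.
Qed.

Lemma lfun_stableP (V : vectType F) (f : 'End(V)) (M : {vspace V}) :
  (forall v, v \in M -> f v \in M) <-> (f @: M <= M)%VS.
Proof.
split=> [fM | /subvP fM v vM]; last by rewrite fM // memv_img.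
by apply/subvP => _ /memv_imgP[v vM ->]; apply: fM.
Qed.

(** The kernels of the products (H - h q^0) ... (H - h q^n) grow with n, hence
    are eventually constant, and a constant one is stable under every operator that
    multiplies H-eigenvalues by q. It then contains the space M generated by w, and the
    product without its first factor maps M to the line of w. *)
Lemma highest_line (V : vectType F) (I : Type) (Y : I -> 'End(V)) (H : 'End(V))
    (q h : F) (w : V) (M : {vspace V}) :
  (forall n, q ^+ n.+1 != 1) -> q != 0 -> h != 0 ->
  (forall i v, H (Y i v) = q *: Y i (H v)) -> H w = h *: w ->
  w \in M ->
  (forall M' : {vspace V}, w \in M' -> (forall i, (Y i @: M' <= M')%VS) ->
      (M <= M')%VS) ->
  (forall i, (Y i @: M <= M)%VS) ->
  exists (Phi : 'End(V)) (c : F), [/\ c != 0,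
     forall v, H v = h *: v -> Phi v = c *: v
     & forall v, v \in M -> Phi v \in <[w]>%VS].
Proof.
move=> q1 q0 h0 HY Hw wM Mmin YM.
pose D n : 'End(V) := H - (h * q ^+ n) *: \1%VF.
have DE n v : D n v = H v - (h * q ^+ n) *: v.
  by rewrite add_lfunE opp_lfunE scale_lfunE id_lfunE.
have DY n i v : D n.+1 (Y i v) = q *: Y i (D n v).
  by rewrite !DE HY lfunB lfunZ scalerBr scalerA exprS mulrCA.
pose T := fix T m n : 'End(V) := if n is n'.+1 then (D (m + n')%N \o T m n')%VF else \1%VF.
have TS m n v : T m n.+1 v = D (m + n)%N (T m n v) by rewrite /= comp_lfunE.
have TY m n i v : T m.+1 n (Y i v) = q ^+ n *: Y i (T m n v).
  elim: n => [|n IHn]; first by rewrite /= !id_lfunE scale1r.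
  by rewrite !TS IHn lfunZ addSn DY scalerA -exprSr.
have HT m n v : H v = h *: v ->
    T m n v = (\prod_(k < n) (h - h * q ^+ (m + k))) *: v.
  move=> Hv; elim: n => [|n IHn]; first by rewrite big_ord0 scale1r /= id_lfunE.
  by rewrite TS IHn lfunZ DE Hv -scalerBl scalerA big_ord_recr.
have DC m n v : D m (D n v) = D n (D m v).
  rewrite !DE !lfunB !lfunZ !scalerBr !scalerA.
  rewrite [h * _ * _]mulrC !opprB !addrA -!addrA; congr (_ + _).
  by rewrite addrC -addrA [RHS]addrC -[RHS]addrA; congr (_ + _); rewrite addrC.
have T0 n v : T 0%N n.+1 v = D 0 (T 1 n v).
  elim: n => [|n IHn]; first by rewrite /= comp_lfunE !id_lfunE.
  by rewrite TS IHn add0n DC (TS 1).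
have kS n : (lker (T 0%N n) <= lker (T 0%N n.+1))%VS.
  by apply/subvP=> v; rewrite !memv_ker TS => /eqP->; rewrite linear0.
have [n kn] : exists n, (lker (T 0%N n.+2) <= lker (T 0%N n.+1))%VS.
  apply: contrapT => /forallNP nex.
  have dims n : (n <= \dim (lker (T 0%N n.+1)))%N.
    elim: n => // n IHn; apply: leq_ltn_trans IHn _.
    rewrite ltnNge; apply/negP => le; apply: (nex n).
    by have /eqP-> : (lker (T 0%N n.+1) == lker (T 0%N n.+2))%VS by rewrite eqEdim kS.
  have := leq_trans (dims (\dim {:V}).+1) (dimvS (subvf _)).
  by rewrite ltnn.
have MK : (M <= lker (T 0%N n.+1))%VS.
  apply: Mmin => [|i].
    by rewrite memv_ker (HT _ _ _ Hw) big_ord_recl /= mulr1 subrr mul0r scale0r.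
  apply/lfun_stableP=> v; rewrite memv_ker => /eqP Tv; apply: (subvP kn).
  by rewrite memv_ker T0 TY Tv linear0 scaler0 linear0.
exists (T 1 n.+1), (\prod_(k < n.+1) (h - h * q ^+ (1 + k))); split.
- apply/prodf_neq0=> k _; rewrite -{1}[h]mulr1 -mulrBr mulf_neq0 // subr_eq0.
  by rewrite eq_sym add1n.
- by move=> v /HT.
suff /subvP MP : (M <= M :&: (T 1 n.+1 @^-1: <[w]>))%VS.
  by move=> v /MP; rewrite memv_cap => /andP[_]; rewrite memv_preim.
apply: Mmin => [|i].
  by rewrite memv_cap wM -memv_preim (HT _ _ _ Hw) memvZ // memv_line.
apply/lfun_stableP=> v; rewrite !memv_cap => /andP[vM _].
move/lfun_stableP: (YM i) => -> //; rewrite andTb -memv_preim TY.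
have := subvP MK _ vM; rewrite memv_ker => /eqP ->.
by rewrite linear0 scaler0 mem0v.
Qed.

End LinearAlgebra.

Section OperatorFamilies.
Variables (R : realType) (d : nat) (q : R).
Local Notation C := R[i].
Local Notation qc := (q%:C : C).

Fixpoint ev_term (V : vectType C) (op : uq_gen d -> 'End(V)) (t : uq_term R d) :
    'End(V) :=
  match t with
  | TGen g => op g
  | TZero => 0
  | TOne => \1%VF
  | TAdd s t => ev_term op s + ev_term op t
  | TMul s t => (ev_term op s \o ev_term op t)%VF
  | TScale a t => a *: ev_term op t
  end.

(** Working with the operators of the generators alone allows a comparison with a
    module on which only these have been constructed. *)
Definition gen_ops (V : vectType C) (rho : uq_repr_on d q V) (g : uq_gen d) : 'End(V) :=
  rho (uq_pi q (TGen g)).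

Lemma uq_act0 (V : vectType C) (rho : uq_repr_on d q V) : rho 0 = 0.
Proof.
by have := uq_act_linear rho (- 1) 0 0; rewrite scaler0 addr0 scaleN1r addNr.
Qed.

Section Action.
Variables (V : vectType C) (rho : uq_repr_on d q V).

Lemma rep0 v : rho 0 v = 0.
Proof. by rewrite uq_act0 lfunE. Qed.
Lemma repD X Y v : rho (X + Y) v = rho X v + rho Y v.
Proof. by rewrite -{1}[X]scale1r uq_act_linear add_lfunE scale1r. Qed.
Lemma repZ a X v : rho (a *: X) v = a *: rho X v.
Proof. by rewrite -[_ *: X]addr0 uq_act_linear uq_act0 addr0 scale_lfunE. Qed.
Lemma repB X Y v : rho (X - Y) v = rho X v - rho Y v.
Proof. by rewrite -scaleN1r repD repZ scaleN1r. Qed.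
Lemma repM X Y v : rho (X * Y) v = rho X (rho Y v).
Proof. by rewrite uq_actM comp_lfunE. Qed.
Lemma rep1 v : rho 1 v = v.
Proof. by rewrite uq_act1 id_lfunE. Qed.
End Action.

Lemma rep_ev (V : vectType C) (rho : uq_repr_on d q V) t :
  rho (uq_pi q t) = ev_term (gen_ops rho) t.
Proof.
elim: t => [g|||s IHs t IHt|s IHs t IHt|a t IHt] //=.
- exact: uq_act0.
- exact: uq_act1.
- by rewrite uq_piD -[uq_pi q s]scale1r uq_act_linear scale1r IHs IHt.
- by rewrite uq_piM uq_actM IHs IHt.
- by rewrite uq_piZ -[_ *: _]addr0 uq_act_linear uq_act0 addr0 IHt.
Qed.

Definition stable (V : vectType C) (op : uq_gen d -> 'End(V)) (W : {vspace V}) : Prop :=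
  forall g, (op g @: W <= W)%VS.

Definition op_irreducible (V : vectType C) (op : uq_gen d -> 'End(V)) : Prop :=
  (fullv : {vspace V}) != 0%VS /\
  forall W : {vspace V}, stable op W -> W = 0%VS \/ W = fullv.

Lemma ev_stable (V : vectType C) (op : uq_gen d -> 'End(V)) W t v :
  stable op W -> v \in W -> ev_term op t v \in W.
Proof.
move=> Wst; elim: t v => [g|||s IHs t IHt|s IHs t IHt|a t IHt] v vW /=.
- by move/lfun_stableP: (Wst g); apply.
- by rewrite lfunE mem0v.
- by rewrite id_lfunE.
- by rewrite add_lfunE memvD ?IHs ?IHt.
- by rewrite comp_lfunE IHs ?IHt.
- by rewrite scale_lfunE memvZ ?IHt.
Qed.

Lemma irreducible_gen_ops (V : vectType C) (rho : uq_repr_on d q V) :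
  irreducible rho -> op_irreducible (gen_ops rho).
Proof.
move=> [nz irr]; split=> // W Wst; apply: irr; elim/uq_ind=> t.
by apply/lfun_stableP=> v vW; rewrite rep_ev ev_stable.
Qed.

(** The relations that control the vectors generated by a highest weight vector. *)
Record chevalley_rel (V : vectType C) (op : uq_gen d -> 'End(V)) : Prop := ChevalleyRel {
  rel_KKi : forall j v, op (GenK j) (op (GenKi j) v) = v;
  rel_KiK : forall j v, op (GenKi j) (op (GenK j) v) = v;
  rel_Kx : forall j i v,
    op (GenK j) (op (GenX i) v) = (qc ^ wt_exp j i) *: op (GenX i) (op (GenK j) v);
  rel_Ky : forall j i v,
    op (GenK j) (op (GenY i) v) = (qc ^ (- wt_exp j i)) *: op (GenY i) (op (GenK j) v);
  rel_xy : forall i j v,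
    op (GenX i) (op (GenY j) v) - op (GenY j) (op (GenX i) v) =
      ((i == j)%:R / (qc - qc^-1)) *:
        (op (GenK (idx_lo i)) (op (GenKi (idx_hi i)) v)
         - op (GenKi (idx_lo i)) (op (GenK (idx_hi i)) v)) }.

Definition highest (V : vectType C) (op : uq_gen d -> 'End(V)) (mu : 'I_d -> int) v :=
  (forall j, op (GenK j) v = qc ^ mu j *: v) /\ (forall i, op (GenX i) v = 0).

Hypothesis (q0 : 0 < q) (q1 : q < 1).

Let qc0 : qc != 0. Proof. by rewrite qC_neq0 // gt_eqF. Qed.

Lemma qc_exp_neq1 n : qc ^+ n.+1 != 1.
Proof.
rewrite -rmorphXn -(rmorph1 (real_complex R)) (inj_eq (fmorph_inj _)).
by rewrite lt_eqF // exprn_ilt1 // ltW.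
Qed.

Lemma chevalley_gen_ops (V : vectType C) (rho : uq_repr_on d q V) :
  chevalley_rel (gen_ops rho).
Proof.
have q_neq0 : q != 0 by rewrite gt_eqF.
split=> *; rewrite /gen_ops.
- by rewrite -repM Uq_KKi rep1.
- by rewrite -repM Uq_KiK rep1.
- by rewrite -!repM (Uq_K_move _ (Uq_KiK _ _) (Uq_Kx _ _ _)) ?Uq_KKi // repZ.
- by rewrite -!repM (Uq_K_move _ (Uq_KiK _ _) (Uq_Ky _ _ _)) ?Uq_KKi // repZ.
- by rewrite -!repM -!repB Uq_xy repZ.
Qed.

Section Graph.
Variables (V G : vectType C) (opV : uq_gen d -> 'End(V)) (opG : uq_gen d -> 'End(G)).
Hypotheses (relV : chevalley_rel opV) (relG : chevalley_rel opG).
Variables (mu : 'I_d -> int) (u : V) (g : G).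
Hypotheses (hwu : highest opV mu u) (hwg : highest opG mu g).
Hypotheses (u0 : u != 0) (g0 : g != 0).
Hypotheses (irrV : op_irreducible opV) (irrG : op_irreducible opG).

(** The operator prod_j K_j^j, whose eigenvalues every Y_i multiplies by q. *)
Fixpoint grading (W : vectType C) (op : uq_gen d -> 'End(W)) (s : seq 'I_d) (v : W) : W :=
  if s is j :: s' then iter j (op (GenK j)) (grading op s' v) else v.

Lemma grading_linear (W : vectType C) (op : uq_gen d -> 'End(W)) s :
  linear (grading op s).
Proof.
move=> a v w; elim: s => //= j s ->.
by elim: (nat_of_ord j) => //= n ->; rewrite linearP.
Qed.

Lemma gradingY (W : vectType C) (op : uq_gen d -> 'End(W)) s i v : chevalley_rel op ->
  grading op s (op (GenY i) v) =
    (qc ^ (\sum_(j <- s) - (j%:Z * wt_exp j i))) *: op (GenY i) (grading op s v).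
Proof.
move=> rel; elim: s => /= [|j s ->]; first by rewrite big_nil scale1r.
have itZ n a w : iter n (op (GenK j)) (a *: w) = a *: iter n (op (GenK j)) w.
  by elim: n => //= n ->; rewrite lfunZ.
rewrite itZ big_cons [_ + \sum_(_ <- _) _]addrC expfzDr // -scalerA; congr (_ *: _).
elim: (nat_of_ord j) => [|n IHn] /=; first by rewrite mul0r oppr0 scale1r.
rewrite IHn lfunZ rel_Ky // scalerA -expfzDr //; congr (qc ^ _ *: _).
by rewrite intS; ring.
Qed.

Lemma grading_highest (W : vectType C) (op : uq_gen d -> 'End(W)) s w :
  highest op mu w ->
  grading op s w = (qc ^ (\sum_(j <- s) j%:Z * mu j)) *: w.
Proof.
move=> [Kw _]; elim: s => /= [|j s ->]; first by rewrite big_nil scale1r.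
rewrite big_cons; elim: (nat_of_ord j) => [|n IHn] /=.
  by rewrite mul0r add0r.
rewrite IHn lfunZ Kw scalerA -expfzDr //; congr (qc ^ _ *: _).
by rewrite intS; ring.
Qed.

Lemma grading_exponent (i : 'I_d.-1) :
  \sum_(j <- enum 'I_d) - (j%:Z * wt_exp j i) = 1.
Proof.
rewrite big_enum /= (bigD1 (idx_lo i)) //= (bigD1 (idx_hi i)) /=; last first.
  by rewrite -val_eqE /=; lia.
rewrite big1 => [|j]; rewrite /wt_exp -?val_eqE /=; last lia.
by rewrite !eqxx; lia.
Qed.

Lemma linear_pair (f : 'End(V)) (h : 'End(G)) :
  exists k : 'End((V * G)%type), forall z, k z = (f z.1, h z.2).
Proof.
apply: linfunP => a y z /=.
by rewrite !linearP.
Qed.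

(** The graph of the isomorphism is the submodule of V * G generated by (u, g):
    its vectors of highest weight are the multiples of (u, g), so it contains
    neither (u, 0) nor (0, g), and irreducibility does the rest. *)
Lemma highest_weight_iso : exists phi : 'Hom(V, G),
  [/\ lker phi = 0%VS, limg phi = fullv
    & forall x v, phi (opV x v) = opG x (phi v)].
Proof.
have [op opE] := choice (fun x => linear_pair (opV x) (opG x)).
have [M [wM YM Mmin]] := min_stable (fun i => op (GenY i)) (u, g).
have [hwu1 hwu2] := hwu; have [hwg1 hwg2] := hwg.
have relW : chevalley_rel op.
  split=> *; rewrite !opE /=.
  - by rewrite (rel_KKi relV) (rel_KKi relG) -surjective_pairing.
  - by rewrite (rel_KiK relV) (rel_KiK relG) -surjective_pairing.
  - by rewrite (rel_Kx relV) (rel_Kx relG).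
  - by rewrite (rel_Ky relV) (rel_Ky relG).
  - by congr (_, _); [exact: rel_xy relV _ _ _ | exact: rel_xy relG _ _ _].
have hww : highest op mu (u, g).
  split=> j; rewrite opE /= ?hwu1 ?hwg1 ?hwu2 ?hwg2 //.
have Yst i v : v \in M -> op (GenY i) v \in M by move/lfun_stableP: (YM i); apply.
have Kst j v : v \in M -> op (GenK j) v \in M.
  suff /subvP MP : (M <= M :&: (op (GenK j) @^-1: M))%VS.
    by move=> /MP; rewrite memv_cap -memv_preim => /andP[].
  apply: Mmin => [|i]; first by rewrite memv_cap wM -memv_preim hww.1 memvZ.
  apply/lfun_stableP => w; rewrite !memv_cap -!memv_preim => /andP[wM1 KwM].
  by rewrite Yst //= rel_Ky // memvZ // Yst.
have Kist j v : v \in M -> op (GenKi j) v \in M.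
  have KM : (op (GenK j) @: M)%VS = M.
    apply/eqP; rewrite eqEdim; apply/andP; split.
      by apply/lfun_stableP; exact: Kst.
    rewrite limg_dim_eq //; apply/eqP; rewrite -subv0; apply/subvP => w.
    rewrite memv_cap memv_ker memv0 => /andP[_ /eqP Kw].
    by rewrite -[w](rel_KiK relW j) Kw linear0.
  by rewrite -{1}KM => /memv_imgP[w wM' ->]; rewrite rel_KiK.
have Xst i v : v \in M -> op (GenX i) v \in M.
  suff /subvP MP : (M <= M :&: (op (GenX i) @^-1: M))%VS.
    by move=> /MP; rewrite memv_cap -memv_preim => /andP[].
  apply: Mmin => [|j]; first by rewrite memv_cap wM -memv_preim hww.2 mem0v.
  apply/lfun_stableP => w; rewrite !memv_cap -!memv_preim => /andP[wM1 XwM].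
  rewrite Yst //= -[op _ _](subrK (op (GenY j) (op (GenX i) w))) rel_xy //.
  by apply: memvD (Yst _ _ XwM); apply/memvZ/memvB; do ?[apply: Kst | apply: Kist].
have Mst x v : v \in M -> op x v \in M.
  by case: x => ?; [exact: Xst | exact: Yst | exact: Kst | exact: Kist].
have [H HE] := linfunP (@grading_linear _ op (enum 'I_d)).
have HY i v : H (op (GenY i) v) = qc *: op (GenY i) (H v).
  by rewrite !HE gradingY // grading_exponent expr1z.
pose h := qc ^ (\sum_(j <- enum 'I_d) j%:Z * mu j).
have Hhw v : highest op mu v -> H v = h *: v by move=> hwv; rewrite HE grading_highest.
have h0 : h != 0 by rewrite expfz_neq0.
have [Phi [c [c0 Phih PhiM]]] :=
  highest_line qc_exp_neq1 qc0 h0 HY (Hhw _ hww) wM Mmin YM.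
have only_line v : highest op mu v -> v \in M -> v \in <[(u, g)]>%VS.
  by move=> /Hhw/Phih E /PhiM; rewrite E rpredZeq (negPf c0).
have [pV pVE] : exists p : 'Hom((V * G)%type, V), p =1 fst by exact: linfunP.
have [pG pGE] : exists p : 'Hom((V * G)%type, G), p =1 snd by exact: linfunP.
have [iV iVE] : exists p : 'Hom(V, (V * G)%type), forall v, p v = (v, 0).
  apply: linfunP => a v w; transitivity (a *: v + w, a *: 0 + 0 : G) => //.
  by rewrite scaler0 addr0.
have [iG iGE] : exists p : 'Hom(G, (V * G)%type), forall v, p v = (0, v).
  apply: linfunP => a v w; transitivity (a *: 0 + 0 : V, a *: v + w) => //.
  by rewrite scaler0 addr0.
have kerV v : (v, 0) \in M -> v = 0.
  move=> vM; have /irrV.2[] : stable opV (iV @^-1: M)%VS.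
  - move=> x; apply/lfun_stableP => w; rewrite -!memv_preim !iVE => /(Mst x).
    by rewrite opE /= linear0.
  - by move=> E; apply/eqP; rewrite -memv0 -E -memv_preim iVE.
  move=> E; have : u \in (iV @^-1: M)%VS by rewrite E memvf.
  have hwE : highest op mu (u, 0).
    split=> j; rewrite opE linear0 ?hwu1 ?hwu2 //.
    by transitivity (qc ^ mu j *: u, qc ^ mu j *: 0 : G); first by rewrite scaler0.
  rewrite -memv_preim iVE => /(only_line _ hwE)/vlineP[a [ua]].
  move=> /esym/eqP; rewrite scaler_eq0 (negPf g0) orbF => /eqP a0.
  by case/eqP: u0; rewrite ua a0 scale0r.
have kerG v : (0, v) \in M -> v = 0.
  move=> vM; have /irrG.2[] : stable opG (iG @^-1: M)%VS.
  - move=> x; apply/lfun_stableP => w; rewrite -!memv_preim !iGE => /(Mst x).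
    by rewrite opE /= linear0.
  - by move=> E; apply/eqP; rewrite -memv0 -E -memv_preim iGE.
  move=> E; have : g \in (iG @^-1: M)%VS by rewrite E memvf.
  have hwE : highest op mu (0, g).
    split=> j; rewrite opE linear0 ?hwg1 ?hwg2 //.
    by transitivity (qc ^ mu j *: 0 : V, qc ^ mu j *: g); first by rewrite scaler0.
  rewrite -memv_preim iGE => /(only_line _ hwE)/vlineP[a [/esym/eqP]].
  rewrite scaler_eq0 (negPf u0) orbF => /eqP a0 ga.
  by case/eqP: g0; rewrite ga a0 scale0r.
have fullV : (pV @: M)%VS = fullv.
  have /irrV.2[E|//] : stable opV (pV @: M)%VS.
    move=> x; apply/lfun_stableP => _ /memv_imgP[w wM1 ->].
    by rewrite pVE (_ : opV x w.1 = pV (op x w)) ?memv_img ?Mst // pVE opE.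
  case/eqP: u0; apply/eqP; rewrite -memv0 -E -[u]/((u, g).1) -pVE.
  exact: memv_img.
have fullG : (pG @: M)%VS = fullv.
  have /irrG.2[E|//] : stable opG (pG @: M)%VS.
    move=> x; apply/lfun_stableP => _ /memv_imgP[w wM1 ->].
    by rewrite pGE (_ : opG x w.2 = pG (op x w)) ?memv_img ?Mst // pGE opE.
  case/eqP: g0; apply/eqP; rewrite -memv0 -E -[g]/((u, g).2) -pGE.
  exact: memv_img.
have ex v : exists w, (v, w) \in M.
  have : v \in (pV @: M)%VS by rewrite fullV memvf.
  by case/memv_imgP=> -[v' w] wM1 ->; exists w; rewrite pVE.
have [f fM] := choice ex.
have fE v w : (v, w) \in M -> f v = w.
  move=> vwM; apply/eqP; rewrite -subr_eq0; apply/eqP/kerG.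
  by have := memvB (fM v) vwM; rewrite -[_ - _]/(_, _) subrr.
have [|phi phiE] := @linfunP _ V G f.
  move=> a v w; apply: fE.
  by have := memvD (memvZ a (fM v)) (fM w).
exists phi; split=> [||x v].
- apply/eqP; rewrite -subv0; apply/subvP => v; rewrite memv_ker memv0 phiE => /eqP fv.
  by apply/eqP/kerV; rewrite -fv.
- apply/eqP; rewrite eqEsubv subvf -fullG; apply/subvP => _ /memv_imgP[[v w] vwM ->].
  by rewrite pGE /= -(fE _ _ vwM) -phiE memv_img ?memvf.
- by rewrite !phiE; apply: fE; have := Mst x _ (fM v); rewrite opE.
Qed.
End Graph.
End OperatorFamilies.

(** * The Gelfand-Tsetlin module *)

Section Module.
Variables (R : realType) (q : R).
Hypotheses (q_gt0 : 0 < q) (q_lt1 : q < 1).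
Variables (d : nat) (r : seq int).
Hypothesis (size_r : size r = d).
Hypothesis (r_dec : forall i j, (i < j)%N -> (j < d)%N -> r`_j < r`_i).
Local Notation C := R[i].
Local Notation qc := (q%:C : C).
Local Notation pat := (pattern d (nth 0 r)).

Definition gt_index : finType := seq_sub (patterns d r).
Definition gt_space : vectType C := {ffun gt_index -> C^o}.
Definition ar (p : gt_index) : array := arr (ssval p).

Lemma ar_pattern p : pat (ar p).
Proof. by apply: arr_pattern size_r _; exact: ssvalP. Qed.
Lemma ar_inj : injective ar.
Proof. by move=> p p' /(arr_inj size_r (ssvalP p) (ssvalP p')) /val_inj. Qed.
Lemma ar_surj L : pat L -> exists p, ar p = L.
Proof. by move=> /(pattern_arr size_r)[p pP <-]; exists (SeqSub pP). Qed.

(** The basis vector of a pattern. With the value 0 on the other arrays, the action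
    can be written without testing whether a move leads to a pattern. *)
Definition gt (L : array) : gt_space := [ffun p => (`[< ar p = L >])%:R].

Lemma gtE L p : gt L p = (`[< ar p = L >])%:R.
Proof. by rewrite ffunE. Qed.

Lemma gt_ar p p' : gt (ar p) p' = (p' == p)%:R.
Proof.
rewrite gtE; congr (_ %:R); congr nat_of_bool.
by apply/asboolP/eqP => [/ar_inj|->].
Qed.

Lemma gt_out L : ~ pat L -> gt L = 0.
Proof.
move=> nL; apply/ffunP=> p; rewrite gtE ffunE.
by rewrite (_ : `[< _ >] = false) //; apply/asboolP => E; apply: nL; rewrite -E; exact: ar_pattern.
Qed.

Lemma gt_decomp (f : gt_space) : f = \sum_p (f p : C) *: gt (ar p).
Proof.
apply/ffunP=> p'; rewrite sum_ffunE (bigD1 p') //= big1 ?addr0 => [|p ne].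
  by rewrite ffunE gt_ar eqxx [_ *: _]mulr1.
by rewrite ffunE gt_ar eq_sym (negPf ne) scaler0.
Qed.

Lemma gt_ext (f g : 'End(gt_space)) :
  (forall L, pat L -> f (gt L) = g (gt L)) -> f = g.
Proof.
move=> fg; apply/lfunP => v; rewrite (gt_decomp v) !lfun_sum.
by apply: eq_bigr => p _; rewrite !lfunZ fg //; exact: ar_pattern.
Qed.

Lemma lin_ext_linear (h : gt_index -> gt_space) :
  linear (fun f : gt_space => \sum_p (f p : C) *: h p).
Proof.
move=> a f g; rewrite scaler_sumr -big_split /=; apply: eq_bigr => p _.
by rewrite !ffunE scalerDl scalerA.
Qed.

(** Operators are given by their values on the basis vectors; an opaque construction
    keeps them from being unfolded. *)
Fact lin_ext_exists : {ext : (array -> gt_space) -> 'End(gt_space) |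
  forall h L, (forall L', ~ pat L' -> h L' = 0) -> ext h (gt L) = h L}.
Proof.
exists (fun h => sval (cid (linfunP (lin_ext_linear (fun p => h (ar p)))))) => h L h0.
case: cid => f /= ->.
have [/ar_surj[p <-]|nL] := pselect (pat L).
  rewrite (bigD1 p) //= big1 ?addr0 => [|p' ne]; rewrite gt_ar ?eqxx ?scale1r //.
  by rewrite (negPf ne) scale0r.
by rewrite gt_out // h0 // big1 // => p _; rewrite ffunE scale0r.
Qed.
Definition lin_ext : (array -> gt_space) -> 'End(gt_space) := sval lin_ext_exists.
Lemma lin_extE h (L : array) : (forall L', ~ pat L' -> h L' = 0) -> lin_ext h (gt L) = h L.
Proof. exact: (svalP lin_ext_exists). Qed.

(** Both ends of the move are tested because coef2 is positive only between patterns
    (coef2_gt0). *)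
Definition move_coef (k j : nat) (L : array) : R :=
  if `[< pat L >] && `[< pat (shift L k j 1) >] then Num.sqrt (coef2 q d k j L) else 0.

Definition gtX (k : nat) : 'End(gt_space) :=
  lin_ext (fun L => \sum_(j < k.+1) (move_coef k j L)%:C *: gt (shift L k j 1)).
Definition gtY (k : nat) : 'End(gt_space) :=
  lin_ext (fun L => \sum_(j < k.+1)
    (move_coef k j (shift L k j (- 1)))%:C *: gt (shift L k j (- 1))).
Definition gtD (c : array -> C) : 'End(gt_space) := lin_ext (fun L => c L *: gt L).

Lemma move_coef_out k j L : ~ pat L -> move_coef k j L = 0.
Proof. by move=> nL; rewrite /move_coef (_ : `[< pat L >] = false) //; apply/asboolP. Qed.

Lemma move_coef_out1 k j L : ~ pat (shift L k j 1) -> move_coef k j L = 0.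
Proof.
by move=> nL; rewrite /move_coef (_ : `[< pat (shift L k j 1) >] = false) ?andbF //; apply/asboolP.
Qed.

Lemma shiftNK L k j : shift (shift L k j (- 1)) k j 1 = L.
Proof. by rewrite -{2}[1]opprK shiftK. Qed.

Lemma gtXE k L : gtX k (gt L) = \sum_(j < k.+1) (move_coef k j L)%:C *: gt (shift L k j 1).
Proof.
by rewrite /gtX lin_extE // => L' nL; apply: big1 => j _; rewrite move_coef_out // scale0r.
Qed.

Lemma gtYE k L : gtY k (gt L) = \sum_(j < k.+1)
    (move_coef k j (shift L k j (- 1)))%:C *: gt (shift L k j (- 1)).
Proof.
rewrite /gtY lin_extE // => L' nL; apply: big1 => j _.
by rewrite move_coef_out1 ?scale0r // shiftNK.
Qed.

Lemma gtDE c L : gtD c (gt L) = c L *: gt L.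
Proof. by rewrite /gtD lin_extE // => L' nL; rewrite gt_out // scaler0. Qed.

Opaque gtX gtY gtD gt.

Definition gt_ops (g : uq_gen d) : 'End(gt_space) :=
  match g with
  | GenX i => gtX i
  | GenY i => gtY i
  | GenK j => gtD (fun L => qc ^ wt j L)
  | GenKi j => gtD (fun L => qc ^ (- wt j L))
  end.

Lemma wt_shift j k i L c : (i <= k)%N ->
  wt j (shift L k i c) = wt j L + c * ((j == k)%:Z - (j == k.+1)%:Z).
Proof.
move=> ik.
have row m n : (m == k -> n = k.+1)%N ->
    \sum_(i' < n) (shift L k i c m i' + i'%:Z) =
    \sum_(i' < n) (L m i' + i'%:Z) + c * (m == k)%:Z.
  move=> mn; have [mk|mk] := eqVneq m k; last first.
    by rewrite mulr0 addr0; apply: eq_bigr => i' _; rewrite shift_off // mk.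
  have ik' : (i < n)%N by rewrite mn ?mk.
  rewrite (bigD1 (Ordinal ik')) //= [in RHS](bigD1 (Ordinal ik')) //= mk shift_at mulr1.
  rewrite (eq_bigr (fun i' : 'I_n => L k i' + i'%:Z)); first by ring.
  by move=> i' /negPf ne; rewrite shift_off // orbC -[_ != _]/(~~ (i' == Ordinal ik')) ne.
rewrite /wt row => [|/eqP->//].
case: j => [|j] /=; first by rewrite !big_ord0 /=; ring.
rewrite row => [|/eqP->//].
by rewrite eqSS; ring.
Qed.

Let qC_unit : qc != 0. Proof. by rewrite qC_neq0 // gt_eqF. Qed.

Lemma gt_Kx (j : 'I_d) (i : 'I_d.-1) v : gt_ops (GenK j) (gt_ops (GenX i) v) =
  (qc ^ wt_exp j i) *: gt_ops (GenX i) (gt_ops (GenK j) v).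
Proof.
rewrite -[LHS]comp_lfunE -[gt_ops (GenX i) _]comp_lfunE -scale_lfunE; congr (fun_of_lfun _ v).
apply: gt_ext => L pL; rewrite scale_lfunE !comp_lfunE /= gtDE lfunZ gtXE.
rewrite !scaler_sumr lfun_sum; apply: eq_bigr => m _.
rewrite lfunZ gtDE !scalerA; congr (_ *: _).
rewrite wt_shift ?leq_ord // expfzDr // mul1r /wt_exp; ring.
Qed.

Lemma gt_Ky (j : 'I_d) (i : 'I_d.-1) v : gt_ops (GenK j) (gt_ops (GenY i) v) =
  (qc ^ (- wt_exp j i)) *: gt_ops (GenY i) (gt_ops (GenK j) v).
Proof.
rewrite -[LHS]comp_lfunE -[gt_ops (GenY i) _]comp_lfunE -scale_lfunE; congr (fun_of_lfun _ v).
apply: gt_ext => L pL; rewrite scale_lfunE !comp_lfunE /= gtDE lfunZ gtYE.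
rewrite !scaler_sumr lfun_sum; apply: eq_bigr => m _.
rewrite lfunZ gtDE !scalerA; congr (_ *: _).
rewrite wt_shift ?leq_ord // expfzDr // mulN1r /wt_exp; ring.
Qed.

Lemma move_coef_exchange k j k' j' L :
  (k.+1 < d)%N -> (j <= k)%N -> (k'.+1 < d)%N -> (j' <= k')%N -> (k, j) != (k', j') ->
  pat L -> pat (shift (shift L k j 1) k' j' (- 1)) ->
  move_coef k' j' (shift L k' j' (- 1)) * move_coef k j (shift L k' j' (- 1)) =
  move_coef k j L * move_coef k' j' (shift (shift L k j 1) k' j' (- 1)).
Proof.
move=> kd jk kd' jk' ne pL pL1.
have [p1 p2] := pattern_corner ne pL pL1.
set L1 := shift L k' j' (- 1).
have E : L = shift L1 k' j' 1 by rewrite /L1 shiftNK.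
have E1 : shift (shift L k j 1) k' j' (- 1) = shift L1 k j 1 by rewrite shiftC.
have E2 : shift (shift L1 k j 1) k' j' 1 = shift L k j 1 by rewrite shiftC -E.
have good k0 j0 L0 : pat L0 -> pat (shift L0 k0 j0 1) ->
    move_coef k0 j0 L0 = Num.sqrt (coef2 q d k0 j0 L0).
  by move=> /asboolP P1 /asboolP P2; rewrite /move_coef P1 P2.
rewrite E1 in pL1 *.
rewrite !good ?E2 -?E //.
have pos k0 j0 L0 : (k0.+1 < d)%N -> (j0 <= k0)%N -> pat L0 -> pat (shift L0 k0 j0 1) ->
    0 <= coef2 q d k0 j0 L0.
  by move=> ? ? P0 P1; apply/ltW; exact: (coef2_gt0 q_gt0 q_lt1 _ P0).
rewrite -!sqrtrM ?pos -?E //; congr Num.sqrt.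
by rewrite [in RHS]E mulrC; apply: (coef2_exchange q_gt0 q_lt1) => //; lia.
Qed.

Lemma move_coef_sq k j L : (k.+1 < d)%N -> (j <= k)%N ->
  move_coef k j L ^+ 2 =
  if `[< pat L >] && `[< pat (shift L k j 1) >] then coef2 q d k j L else 0.
Proof.
move=> kd jk; rewrite /move_coef; case: ifP => [/andP[/asboolP P1 /asboolP P2]|_].
  by rewrite sqr_sqrtr // ltW // (coef2_gt0 q_gt0 q_lt1 kd P1).
by rewrite expr0n.
Qed.

(** Moves at different entries commute by move_coef_exchange. What remains, for i = j,
    is a multiple of the basis vector, evaluated by coef2_commutator. *)
Lemma gt_xy (i j : 'I_d.-1) v :
  gt_ops (GenX i) (gt_ops (GenY j) v) - gt_ops (GenY j) (gt_ops (GenX i) v) =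
      ((i == j)%:R / (qc - qc^-1)) *:
        (gt_ops (GenK (idx_lo i)) (gt_ops (GenKi (idx_hi i)) v)
         - gt_ops (GenKi (idx_lo i)) (gt_ops (GenK (idx_hi i)) v)).
Proof.
pose f : 'End(gt_space) := (gt_ops (GenX i) \o gt_ops (GenY j))%VF -
  (gt_ops (GenY j) \o gt_ops (GenX i))%VF.
pose g : 'End(gt_space) := ((i == j)%:R / (qc - qc^-1)) *:
  ((gt_ops (GenK (idx_lo i)) \o gt_ops (GenKi (idx_hi i)))%VF
   - (gt_ops (GenKi (idx_lo i)) \o gt_ops (GenK (idx_hi i)))%VF).
suff /(congr1 (fun h => fun_of_lfun h v)) : f = g.
  by rewrite /f /g !(add_lfunE, opp_lfunE, scale_lfunE, comp_lfunE).
apply: gt_ext => L pL.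
have DD c c' : gtD c (gtD c' (gt L)) = (c L * c' L) *: gt L.
  by rewrite (gtDE c' L) lfunZ (gtDE c L) scalerA mulrC.
have KK1 : gt_ops (GenK (idx_lo i)) (gt_ops (GenKi (idx_hi i)) (gt L)) =
    (qc ^ wt i L * qc ^ (- wt i.+1 L)) *: gt L by exact: DD.
have KK2 : gt_ops (GenKi (idx_lo i)) (gt_ops (GenK (idx_hi i)) (gt L)) =
    (qc ^ (- wt i L) * qc ^ wt i.+1 L) *: gt L by exact: DD.
rewrite /f /g !(add_lfunE, opp_lfunE, scale_lfunE, comp_lfunE) KK1 KK2 /=.
have id : (i.+1 < d)%N by rewrite -ltn_predRL.
have jd : (j.+1 < d)%N by rewrite -ltn_predRL.
pose t (a b : nat) : gt_space := gt (shift (shift L i a 1) j b (- 1)).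
pose c1 (a b : nat) := move_coef j b (shift L j b (- 1)) * move_coef i a (shift L j b (- 1)).
pose c2 (a b : nat) := move_coef i a L * move_coef j b (shift (shift L i a 1) j b (- 1)).
have -> : gtX i (gtY j (gt L)) = \sum_(a < i.+1) \sum_(b < j.+1) (c1 a b)%:C *: t a b.
  rewrite exchange_big (gtYE j L) lfun_sum; apply: eq_bigr => b _; rewrite lfunZ gtXE scaler_sumr.
  by apply: eq_bigr => a _; rewrite scalerA /t /c1 shiftC rmorphM.
have -> : gtY j (gtX i (gt L)) = \sum_(a < i.+1) \sum_(b < j.+1) (c2 a b)%:C *: t a b.
  rewrite (gtXE i L) lfun_sum. apply: eq_bigr => a _.
  rewrite lfunZ gtYE scaler_sumr.
  by apply: eq_bigr => b _; rewrite scalerA /t /c2 rmorphM.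
rewrite -sumrB.
have offdiag (a : 'I_i.+1) (b : 'I_j.+1) : (i : nat, a : nat) != (j : nat, b : nat) ->
    (c1 a b)%:C *: t a b = (c2 a b)%:C *: t a b.
  move=> ne; have [p|np] := pselect (pat (shift (shift L i a 1) j b (- 1))).
    by rewrite /c1 /c2 move_coef_exchange // leq_ord.
  by rewrite /t (gt_out np) [LHS]scaler0 [RHS]scaler0.
have [ij|ij] := eqVneq i j; last first.
  rewrite mul0r scale0r big1 // => a _; rewrite -sumrB big1 // => b _.
  by rewrite offdiag ?subrr //; apply: contra_neq ij => -[/val_inj e _].
subst j.
have diag (a : 'I_i.+1) : \sum_(b < i.+1) (c1 a b)%:C *: t a b - \sum_(b < i.+1) (c2 a b)%:C *: t a b
    = ((move_coef i a (shift L i a (- 1)) ^+ 2)%:C - (move_coef i a L ^+ 2)%:C) *: gt L.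
  rewrite -sumrB (bigD1 a) //= big1 => [|b ne]; last first.
    by rewrite offdiag ?subrr // xpair_eqE eqxx /= eq_sym.
  by rewrite addr0 /c1 /c2 /t shiftK -!expr2 -scalerBl.
under eq_bigr => a _ do rewrite diag.
rewrite -scaler_suml -scalerBl scalerA; congr (_ *: _); rewrite sumrB.
have PL : `[< pat L >] by apply/asboolP.
have -> : \sum_(a < i.+1) (move_coef i a (shift L i a (-1)) ^+ 2)%:C =
  (\sum_(a < i.+1 | `[< pat (shift L i a (- 1)) >]) coef2 q d i a (shift L i a (- 1)))%:C.
  rewrite [in RHS]big_mkcond rmorph_sum; apply: eq_bigr => a _.
  by rewrite move_coef_sq ?leq_ord // shiftNK PL andbT.
have -> : \sum_(a < i.+1) (move_coef i a L ^+ 2)%:C =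
  (\sum_(a < i.+1 | `[< pat (shift L i a 1) >]) coef2 q d i a L)%:C.
  rewrite [in RHS]big_mkcond rmorph_sum; apply: eq_bigr => a _.
  by rewrite move_coef_sq ?leq_ord // PL.
rewrite -rmorphB coef2_commutator // div1r /qnum mulrC.
have real_pow (z : int) : qc ^ z = (q ^ z)%:C by rewrite fmorphXz.
rewrite !real_pow -fmorphV -!rmorphM -!rmorphB -fmorphV -!rmorphM /=; congr (_%:C).
rewrite -!expfzDr ?gt_eqF //; congr (_^-1 * (q ^ _ - q ^ _)); rewrite /wt /=; ring.
Qed.

Lemma gt_chevalley : chevalley_rel q gt_ops.
Proof.
have ev (c c' : array -> C) v : (forall L, c L * c' L = 1) -> gtD c (gtD c' v) = v.
  move=> cc; rewrite -comp_lfunE -[RHS]id_lfunE; congr (fun_of_lfun _ v).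
  apply: gt_ext => L _; rewrite comp_lfunE id_lfunE gtDE lfunZ gtDE scalerA mulrC cc.
  by rewrite scale1r.
split.
- by move=> j v; apply: ev => L; rewrite -expfzDr // subrr expr0z.
- by move=> j v; apply: ev => L; rewrite -expfzDr // addNr expr0z.
- by move=> *; apply: gt_Kx.
- by move=> *; apply: gt_Ky.
- by move=> *; apply: gt_xy.
Qed.

Definition top_array : array := fun k j => if (k < d)%N && (j <= k)%N then r`_j else 0.

Lemma top_pattern : pat top_array.
Proof.
split=> [k j h|j jd|k j kd jk|k j kd jk]; rewrite /top_array.
- by rewrite ifF //; lia.
- by rewrite ifT //; lia.
- by rewrite !ifT; [apply: r_dec; lia | lia | lia].
- by rewrite !ifT //; lia.
Qed.

Lemma gt_coord_X k f p' : gtX k f p' =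
  \sum_p f p * \sum_(j < k.+1) (move_coef k j (ar p))%:C * (`[< ar p' = shift (ar p) k j 1 >])%:R.
Proof.
rewrite {1}(gt_decomp f) lfun_sum sum_ffunE; apply: eq_bigr => p _.
rewrite lfunZ gtXE ffunE sum_ffunE; congr (_ * _); apply: eq_bigr => j _.
by rewrite ffunE gtE.
Qed.

(** Row by row from the bottom: if the rows below row k are as large as row k
    allows and row k is not as large as row k + 1 allows, then some entry of
    row k can be raised, and no other pattern of the support is raised to the
    same pattern. *)
Lemma gt_highest_unique (f : gt_space) : (forall k, (k.+1 < d)%N -> gtX k f = 0) ->
  forall p, f p != 0 -> ar p = top_array.
Proof.
move=> Xf.
have rows k p : (k < d)%N -> f p != 0 -> forall m i, (m < k)%N -> (i <= m)%N ->
    ar p m i = ar p m.+1 i.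
  elim: k p => [|k IHk] p kd fp m i; first by [].
  have kd' : (k < d)%N by lia.
  rewrite ltnS leq_eqVlt => /orP[/eqP -> ik|mk im]; last exact: IHk.
  have pp := ar_pattern p.
  apply: contrapT => ne.
  have /ex_minnP[j jP jmin] : exists j, (j <= k)%N && (ar p k j != ar p k.+1 j).
    by exists i; rewrite ik; apply/eqP.
  have /andP[jk jne] := jP.
  have lt : ar p k j < ar p k.+1 j by rewrite lt_neqAle jne; exact: (pat_le pp).
  have up : pat (shift (ar p) k j 1).
    apply/(pattern_up pp kd jk); rewrite /hi; case: j jk jP jmin jne lt => // j jk jP jmin jne lt.
    have -> : ar p k.-1 j = ar p k j.
      by have := IHk p kd' fp k.-1 j; rewrite prednK; [apply; lia | lia].
    have : ar p k j = ar p k.+1 j.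
      by apply/eqP; apply: contraTT (leqnn j.+1) => nej; rewrite -ltnNge; apply: jmin; rewrite nej; lia.
    by have := pat_lt pp kd (ltnW jk); lia.
  have [p' p'E] := ar_surj up.
  have := congr1 (fun g : gt_space => g p') (Xf k kd).
  rewrite gt_coord_X ffunE (bigD1 p) //= [X in _ + X]big1 ?addr0 => [|p1 p1p].
    rewrite (bigD1 (Ordinal (jk : (j < k.+1)%N))) //= [X in _ + X]big1 => [|j1 j1j].
      rewrite addr0 p'E (_ : `[< _ >] = true); last by apply/asboolP.
      move/eqP; rewrite mulr1 mulf_eq0 (negPf fp) /= fmorph_eq0.
      rewrite /move_coef ifT; last by apply/andP; split; apply/asboolP.
      by rewrite sqrtr_eq0 leNgt (coef2_gt0 q_gt0 q_lt1 kd pp jk up).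
    rewrite (_ : `[< _ >] = false) ?mulr0 //; apply/asboolP; rewrite p'E => E.
    have := congr1 (fun g : array => g k j) E; rewrite shift_at shift_off; first by lia.
    by rewrite eq_sym orbC -[_ == _]/(j1 == Ordinal (jk : (j < k.+1)%N) :> 'I_k.+1) j1j.
  have [->|fp1] := eqVneq (f p1) 0; first by rewrite mul0r.
  rewrite big1 ?mulr0 // => j1 _; rewrite (_ : `[< _ >] = false) ?mulr0 //.
  apply/asboolP; rewrite p'E => E.
  have [jj|jj] := eqVneq (j1 : nat) j.
    move/eqP: p1p; apply; apply: ar_inj.
    by rewrite -[ar p1](shiftK _ k j1 1) -E jj shiftK.
  have row (i1 : nat) : (i1 < k)%N -> ar p1 k i1 = ar p k i1.
    move=> i1k.
    have := IHk p kd' fp k.-1 i1; have := IHk p1 kd' fp1 k.-1 i1.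
    rewrite prednK; last by lia.
    have := congr1 (fun g : array => g k.-1 i1) E.
    rewrite !shift_off; [|lia|lia] => -> <-; [|lia|lia].
    by move=> <- //; lia.
  have j1k := leq_ord j1.
  have E' (i1 : nat) := congr1 (fun g : array => g k i1) E.
  have [jk1|jk1] := ltnP j k.
    by have := E' j; rewrite shift_at shift_off ?row //; lia.
  by have := E' j1; rewrite shift_at shift_off ?row //; lia.
move=> p fp; have pp := ar_pattern p.
case: (posnP d) => [d0|d0].
  by apply/funext=> k; apply/funext=> j; rewrite (pat_out pp) /top_array d0.
have rw := rows d.-1 p _ fp.
have full m k : (k + m = d.-1)%N -> forall i, (i <= k)%N -> ar p k i = r`_i.
  elim: m k => [|m IHm] k km i ik.
    by rewrite -(pat_top pp); [congr (ar p _ _)|]; lia.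
  by rewrite rw; [apply: IHm; lia | lia | lia | lia].
apply/funext=> k; apply/funext=> j; rewrite /top_array.
case: ifP => h; first by rewrite (full (d.-1 - k)%N k); lia.
by rewrite (pat_out pp); lia.
Qed.

Definition level (L : array) : int := \sum_(k < d) \sum_(j < d) L k j.

Lemma level_shift L k j : (j <= k)%N -> (k < d)%N -> level (shift L k j 1) = level L + 1.
Proof.
move=> jk kd; have jd : (j < d)%N by lia.
rewrite /level (bigD1 (Ordinal kd)) //= [in RHS](bigD1 (Ordinal kd)) //=.
rewrite (bigD1 (Ordinal jd)) //= [in RHS](bigD1 (Ordinal jd)) //= shift_at.
rewrite [X in _ + X](eq_bigr (fun k' : 'I_d => \sum_(j' < d) L k' j')); last first.
  by move=> k' ne; apply: eq_bigr => j' _; rewrite shift_off // -[_ != _]/(k' != Ordinal kd) ne.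
rewrite (eq_bigr (fun j' : 'I_d => L k j')); first by ring.
by move=> j' ne; rewrite shift_off // orbC -[_ != _]/(j' != Ordinal jd) ne.
Qed.

(** The raising operators increase the level, which is bounded on patterns: applying
    them to f as long as the result is not 0 ends at a vector that they all kill. The
    property Q keeps that vector in a submodule, or orthogonal to one. *)
Lemma gt_highest_exists (Q : gt_space -> Prop) (f : gt_space) :
  (forall k g, (k.+1 < d)%N -> Q g -> Q (gtX k g)) -> Q f -> f != 0 ->
  exists g, [/\ Q g, g != 0 & forall k, (k.+1 < d)%N -> gtX k g = 0].
Proof.
move=> QX Qf f0; pose N : int := \sum_p `|level (ar p)|.
have maxN p : level (ar p) <= N.
  rewrite /N (bigD1 p) //=; apply: le_trans (ler_norm _) _.
  by rewrite lerDl sumr_ge0.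
have nz (g : gt_space) : g != 0 -> exists p, g p != 0.
  move=> g0; apply: contrapT => /forallNP h; case/eqP: g0; apply/ffunP=> p.
  by rewrite ffunE; apply/eqP; apply: contrapT => /negP; exact: h.
suff: forall m (n : int) g, N < n + m%:Z -> Q g -> g != 0 -> (forall p, g p != 0 -> n <= level (ar p)) ->
    exists g, [/\ Q g, g != 0 & forall k, (k.+1 < d)%N -> gtX k g = 0].
  move/(_ (absz (N + N + 1)%R) (- N) f); apply=> //.
  - have : 0 <= N by apply: sumr_ge0.
    lia.
  - move=> p _; have : - `|level (ar p)| <= level (ar p) by rewrite lerNl -normrN ler_norm.
    apply: le_trans; rewrite lerN2 /N (bigD1 p) //= lerDl; exact: sumr_ge0.
elim=> [|m IHm] n g Nn Qg g0 supp.
  by have [p gp] := nz g g0; have := supp p gp; have := maxN p; lia.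
have [h|] := pselect (forall k, (k.+1 < d)%N -> gtX k g = 0); first by exists g.
move=> /existsNP[k] /not_implyP[kd /eqP Xg].
apply: (IHm (n + 1) (gtX k g)) => //; [lia | exact: QX |].
move=> p; apply: contraNT; rewrite -ltNge => lt; rewrite gt_coord_X.
apply/eqP/big1 => p' _.
have [->|gp'] := eqVneq (g p') 0; first by rewrite mul0r.
rewrite big1 ?mulr0 // => j _; rewrite (_ : `[< _ >] = false) ?mulr0 //.
apply/asboolP => E; have := supp p' gp'; move: lt.
by rewrite E level_shift ?leq_ord //; lia.
Qed.

(** The squared norms of the basis vectors for a *-unitary form. Raising an entry of row k
    adds 2 (wt k - wt (k + 1) + 1) to the exponent of the square root of q, which accounts
    for the factor q^-1 K_k K_(k+1)^-1 in x_k^*. *)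
Definition gt_norm (L : array) : R := Num.sqrt q ^ (\sum_(j < d) wt j L ^+ 2).

Lemma gt_norm_gt0 L : 0 < gt_norm L.
Proof. by rewrite exprz_gt0 // sqrtr_gt0. Qed.

Definition gt_form (f g : gt_space) : C :=
  \sum_p (gt_norm (ar p))%:C * ((f p : C) * Num.conj (g p : C)).

Lemma gt_form_linear g : forall a f f', gt_form (a *: f + f') g = a * gt_form f g + gt_form f' g.
Proof.
move=> a f f'; rewrite /gt_form big_distrr -big_split /=; apply: eq_bigr => p _.
rewrite !ffunE /GRing.scale /=; ring.
Qed.

Lemma conj_realC (x : R) : Num.conj (x%:C : C) = x%:C.
Proof. exact: conjc_real. Qed.

Lemma gt_formC f g : gt_form f g = Num.conj (gt_form g f).
Proof.
rewrite /gt_form rmorph_sum; apply: eq_bigr => p _.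
by rewrite !rmorphM /= conjCK conj_realC [in RHS](mulrC (Num.conj _)).
Qed.

Lemma gt_form_gt0 f : f != 0 -> 0 < gt_form f f.
Proof.
move=> f0; have pos p : 0 <= (gt_norm (ar p))%:C * ((f p : C) * Num.conj (f p : C)).
  by rewrite mulr_ge0 ?mul_conjC_ge0 // ler0c ltW // gt_norm_gt0.
rewrite lt_neqAle sumr_ge0 ?andbT // eq_sym; apply: contra_neq f0.
move=> /eqP; rewrite psumr_eq0 // => /allP h; apply/ffunP=> p; rewrite ffunE.
have := h p (mem_index_enum p); rewrite implyTb mulf_eq0 mul_conjC_eq0.
by rewrite fmorph_eq0 gt_eqF ?gt_norm_gt0 //= => /eqP.
Qed.

Lemma gt_form0 g : gt_form 0 g = 0.
Proof. by rewrite /gt_form big1 // => p _; rewrite ffunE mul0r mulr0. Qed.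

Lemma gt_formDr f g h : gt_form f (g + h) = gt_form f g + gt_form f h.
Proof. by rewrite gt_formC -{1}[g]scale1r gt_form_linear mul1r rmorphD /= -!gt_formC. Qed.

Lemma gt_formZr a f g : gt_form f (a *: g) = Num.conj a * gt_form f g.
Proof.
by rewrite gt_formC -[_ *: _]addr0 gt_form_linear gt_form0 addr0 rmorphM /= -gt_formC.
Qed.

Lemma gt_form_gt L L' : pat L -> gt_form (gt L) (gt L') = (gt_norm L)%:C * (`[< L = L' >])%:R.
Proof.
move=> /ar_surj[p <-]; rewrite /gt_form (bigD1 p) //= big1 ?addr0 => [|p' ne].
  by rewrite gt_ar eqxx mul1r gtE conjC_nat.
by rewrite gt_ar (negPf ne) mul0r mulr0.
Qed.

Lemma gt_form_gtr L L' : pat L' -> gt_form (gt L) (gt L') = (gt_norm L')%:C * (`[< L = L' >])%:R.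
Proof.
move=> pL'; rewrite gt_formC gt_form_gt // rmorphM /= conjC_nat conj_realC.
congr (_ * (nat_of_bool _)%:R); by apply/asboolP/asboolP.
Qed.

Lemma gt_formZl a f g : gt_form (a *: f) g = a * gt_form f g.
Proof. by rewrite -[_ *: f]addr0 gt_form_linear gt_form0 addr0. Qed.

Lemma gt_form_suml I (s : seq I) (E : I -> gt_space) h :
  gt_form (\sum_(i <- s) E i) h = \sum_(i <- s) gt_form (E i) h.
Proof.
elim: s => [|i s IHs]; first by rewrite !big_nil gt_form0.
by rewrite !big_cons -IHs -{1}[E i]scale1r gt_form_linear mul1r.
Qed.

Lemma gt_form_sumr I (s : seq I) (E : I -> gt_space) h :
  gt_form h (\sum_(i <- s) E i) = \sum_(i <- s) gt_form h (E i).
Proof.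
by rewrite gt_formC gt_form_suml rmorph_sum /=; apply: eq_bigr => i _; rewrite -gt_formC.
Qed.

Lemma gt_form_ext (F H : 'End(gt_space)) :
  (forall L L', pat L -> pat L' -> gt_form (F (gt L)) (gt L') = gt_form (gt L) (H (gt L'))) ->
  forall f g, gt_form (F f) g = gt_form f (H g).
Proof.
move=> FH f g; rewrite (gt_decomp f) (gt_decomp g) !lfun_sum.
rewrite !gt_form_suml; apply: eq_bigr => p _; rewrite !gt_form_sumr; apply: eq_bigr => p' _.
by rewrite !lfunZ !gt_formZl !gt_formZr FH //; exact: ar_pattern.
Qed.

Lemma wt_up L k j c : (j <= k)%N -> wt k (shift L k j c) = wt k L + c.
Proof.
move=> jk; rewrite wt_shift // eqxx (_ : k == k.+1 = false); last by lia.
by rewrite subr0 mulr1.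
Qed.

Lemma wt_upS L k j c : (j <= k)%N -> wt k.+1 (shift L k j c) = wt k.+1 L - c.
Proof.
move=> jk; rewrite wt_shift // eqxx (_ : k.+1 == k = false); last by lia.
by rewrite sub0r mulrN1.
Qed.

Lemma gt_norm_up (k : 'I_d.-1) j L : (j <= k)%N ->
  gt_norm (shift L k j 1) = gt_norm L * q ^ (wt k L - wt k.+1 L + 1).
Proof.
move=> jk; rewrite /gt_norm.
have hl : idx_hi k != idx_lo k by rewrite -val_eqE /=; lia.
have split L' : \sum_(i < d) wt i L' ^+ 2 = wt k L' ^+ 2 + (wt k.+1 L' ^+ 2 +
    \sum_(i < d | (i != idx_lo k) && (i != idx_hi k)) wt i L' ^+ 2).
  by rewrite (bigD1 (idx_lo k)) //= (bigD1 (idx_hi k)) //=.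
have -> : \sum_(i < d) wt i (shift L k j 1) ^+ 2 =
    \sum_(i < d) wt i L ^+ 2 + 2 * (wt k L - wt k.+1 L + 1).
  rewrite !split wt_up // wt_upS //.
  have -> : \sum_(i < d | (i != idx_lo k) && (i != idx_hi k)) wt i (shift L k j 1) ^+ 2 =
            \sum_(i < d | (i != idx_lo k) && (i != idx_hi k)) wt i L ^+ 2.
    apply: eq_bigr => i; rewrite -!val_eqE /= => /andP[/negPf e1 /negPf e2].
    by rewrite wt_shift // e1 e2 subrr mulr0 addr0.
  by ring.
rewrite expfzDr ?sqrtr_eq0 -?ltNge //; congr (_ * _).
by rewrite -exprz_exp -exprnP sqr_sqrtr // ltW.
Qed.

(** x_k^* = q^-1 y_k k_k *)
Lemma gt_starX (k : 'I_d.-1) f g : gt_form (gt_ops (GenX k) f) g =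
  gt_form f (qc^-1 *: gt_ops (GenY k) (gt_ops (GenK (idx_lo k)) (gt_ops (GenKi (idx_hi k)) g))).
Proof.
pose H : 'End(gt_space) := qc^-1 *: (gt_ops (GenY k) \o (gt_ops (GenK (idx_lo k)) \o gt_ops (GenKi (idx_hi k))))%VF.
transitivity (gt_form f (H g)); last by rewrite /H scale_lfunE !comp_lfunE.
apply: gt_form_ext => {f g} L L' pL pL'.
rewrite /H scale_lfunE !comp_lfunE /= (gtDE _ L') lfunZ (gtDE _ L') scalerA lfunZ gtXE gtYE scalerA.
rewrite gt_form_suml scaler_sumr gt_form_sumr; apply: eq_bigr => j _.
rewrite scalerA gt_formZl gt_formZr gt_form_gtr // gt_form_gt //.
have [E|nE] := pselect (L' = shift L k j 1); last first.
  have -> : `[< shift L k j 1 = L' >] = false by apply/asboolP => E; apply: nE.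
  have -> : `[< L = shift L' k j (- 1) >] = false.
    by apply/asboolP => E; apply: nE; rewrite E shiftNK.
  by rewrite !mulr0.
have -> : `[< shift L k j 1 = L' >] = true by apply/asboolP.
have -> : `[< L = shift L' k j (- 1) >] = true by apply/asboolP; rewrite E shiftK.
rewrite !mulr1 E shiftK gt_norm_up ?leq_ord // wt_up ?leq_ord // wt_upS ?leq_ord //.
have cpow (z : int) : qc ^ z = (q ^ z)%:C by rewrite fmorphXz.
rewrite !cpow -fmorphV -!rmorphM /= conj_realC -rmorphM; congr (_%:C).
have -> : q ^ (wt k L - wt k.+1 L + 1) = q^-1 * (q ^ (- (wt k.+1 L - 1)) * q ^ (wt k L + 1)).
  by rewrite -exprN1 -!expfzDr ?gt_eqF //; congr (q ^ _); ring.
ring.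
Qed.

Lemma gt_KE (j : 'I_d) L : gt_ops (GenK j) (gt L) = qc ^ wt j L *: gt L.
Proof. exact: gtDE. Qed.
Lemma gt_KiE (j : 'I_d) L : gt_ops (GenKi j) (gt L) = qc ^ (- wt j L) *: gt L.
Proof. exact: gtDE. Qed.

Lemma gt_starD (c : array -> R) f g :
  gt_form (gtD (fun L => (c L)%:C) f) g = gt_form f (gtD (fun L => (c L)%:C) g).
Proof.
apply: gt_form_ext => {f g} L L' pL pL'.
rewrite (gtDE _ L) (gtDE _ L') gt_formZl gt_formZr gt_form_gt // conj_realC.
case: asboolP => [->|_] //; by rewrite !mulr0.
Qed.

Let cpow (z : int) : qc ^ z = (q ^ z)%:C.
Proof. by rewrite fmorphXz. Qed.

Lemma gt_starK j f g : gt_form (gt_ops (GenK j) f) g = gt_form f (gt_ops (GenK j) g).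
Proof.
have -> : gt_ops (GenK j) = gtD (fun L => (q ^ wt j L)%:C).
  by apply: gt_ext => L _; rewrite gt_KE gtDE cpow.
exact: gt_starD.
Qed.

Lemma gt_starKi j f g : gt_form (gt_ops (GenKi j) f) g = gt_form f (gt_ops (GenKi j) g).
Proof.
have -> : gt_ops (GenKi j) = gtD (fun L => (q ^ (- wt j L))%:C).
  by apply: gt_ext => L _; rewrite gt_KiE gtDE cpow.
exact: gt_starD.
Qed.

(** y_k^* = q k_k^-1 x_k *)
Lemma gt_starY (k : 'I_d.-1) f g : gt_form (gt_ops (GenY k) f) g =
  gt_form f (qc *: gt_ops (GenKi (idx_lo k)) (gt_ops (GenK (idx_hi k)) (gt_ops (GenX k) g))).
Proof.
have rel := gt_chevalley.
set f' := gt_ops (GenK (idx_hi k)) (gt_ops (GenKi (idx_lo k)) f).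
have E : f = gt_ops (GenK (idx_lo k)) (gt_ops (GenKi (idx_hi k)) f').
  by rewrite /f' (rel_KiK rel) (rel_KKi rel).
have -> : gt_form (gt_ops (GenY k) f) g = Num.conj (qc * gt_form (gt_ops (GenX k) g) f').
  rewrite gt_starX gt_formZr -E mulrA fmorphV /= conj_realC divff ?mul1r; last first.
    exact: qC_unit.
  exact: gt_formC.
rewrite rmorphM /= conj_realC -gt_formC gt_formZr conj_realC; congr (_ * _).
by rewrite /f' gt_starK gt_starKi.
Qed.

(** The orthogonal complement of W is stable under the raising operators, because W is
    stable under their adjoints. If it were not 0 it would contain a highest weight
    vector, which is a multiple of the top pattern and thus lies in W. *)
Lemma gt_full (W : {vspace gt_space}) : stable gt_ops W -> gt top_array \in W -> W = fullv.
Proof.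
move=> Wst topW; apply/eqP; rewrite eqEsubv subvf /=; apply: contrapT => /negP nW.
have [v _ nv] := subvPn nW.
have : v - projv W v != 0.
  by apply: contra nv; rewrite subr_eq0 => /eqP ->; exact: memv_proj.
move=> v0; have [p vp] : exists p, (v - projv W v) p != 0.
  apply: contrapT => /forallNP h; case/eqP: v0; apply/ffunP=> p; rewrite [RHS]ffunE.
  by apply/eqP; apply: contrapT => /negP; exact: h.
(* psi is a nonzero functional that vanishes on W, represented by f0 for gt_form *)
pose psi (f : gt_space) : C := (f - projv W f) p.
have psi_lin a f f' : psi (a *: f + f') = a * psi f + psi f'.
  by rewrite /psi linearP opprD addrACA -scalerBr !ffunE.
pose f0 : gt_space := [ffun p' => Num.conj (psi (gt (ar p'))) / (gt_norm (ar p'))%:C].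
have f0E f : gt_form f f0 = psi f.
  have psi0 : psi 0 = 0 by rewrite /psi linear0 subrr ffunE.
  rewrite {2}(gt_decomp f).
  transitivity (\sum_p (f p : C) * psi (gt (ar p))); last first.
    elim/big_rec2: _ => [//|p' x y _ ->]; by rewrite psi_lin.
  apply: eq_bigr => p' _; rewrite ffunE fmorph_div /= conjCK conj_realC.
  have N0 : (gt_norm (ar p'))%:C != 0 :> C by rewrite fmorph_eq0 gt_eqF // gt_norm_gt0.
  by rewrite mulrC -!mulrA mulVf // mulr1.
have f0_neq0 : f0 != 0.
  apply: contra_neq vp => f00; rewrite -/(psi v) -f0E f00 gt_formC gt_form0.
  exact: conjC0.
have [|||g [Qg g0 Xg]] := @gt_highest_exists (fun g => forall w, w \in W -> gt_form w g = 0) f0.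
- move=> k g kd Qg w wW.
  have kd1 : (k < d.-1)%N by rewrite ltn_predRL.
  rewrite gt_formC -[gtX k]/(gt_ops (GenX (Ordinal kd1))) gt_starX -gt_formC Qg //.
  have st x u : u \in W -> gt_ops x u \in W by move: (Wst x) => /lfun_stableP; exact.
  by rewrite memvZ // !st.
- by move=> w wW; rewrite f0E /psi projv_id // subrr ffunE.
- exact: f0_neq0.
have E : g = (\sum_(p | ar p == top_array) (g p : C)) *: gt top_array.
  rewrite {1}(gt_decomp g) scaler_suml [in RHS]big_mkcond; apply: eq_bigr => p' _.
  case: eqP => [->//|ne]; have [->|gp] := eqVneq (g p') 0; first by rewrite scale0r.
  by case: ne; exact: (gt_highest_unique Xg).
have := gt_form_gt0 g0; rewrite {1}E gt_formZl Qg ?mulr0 ?ltxx //.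
Qed.

Lemma gt_top_neq0 : gt top_array != 0.
Proof.
have [p pE] := ar_surj top_pattern.
apply/eqP => /(congr1 (fun f : gt_space => f p)); rewrite -pE gt_ar eqxx ffunE.
by move/eqP; rewrite oner_eq0.
Qed.

(** A nonzero submodule contains a highest weight vector, hence the top pattern. *)
Lemma gt_irreducible : op_irreducible gt_ops.
Proof.
split.
  by apply: contra_neq gt_top_neq0 => full0; apply/eqP; rewrite -memv0 -full0 memvf.
move=> W Wst; have [->|W0] := eqVneq W 0%VS; [by left | right].
apply: gt_full => //.
have st x u : u \in W -> gt_ops x u \in W by move: (Wst x) => /lfun_stableP; exact.
have [|||g [gW g0 Xg]] := @gt_highest_exists (fun g => g \in W) (vpick W).
- move=> k g kd gW; have kd1 : (k < d.-1)%N by rewrite ltn_predRL.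
  exact: (st (GenX (Ordinal kd1))).
- exact: memv_pick.
- by rewrite vpick0.
have E : g = (\sum_(p | ar p == top_array) (g p : C)) *: gt top_array.
  rewrite {1}(gt_decomp g) scaler_suml [in RHS]big_mkcond; apply: eq_bigr => p' _.
  case: eqP => [->//|ne]; have [->|gp] := eqVneq (g p') 0; first by rewrite scale0r.
  by case: ne; exact: (gt_highest_unique Xg).
move: gW; rewrite E rpredZeq => /orP[/eqP c0|//].
by move: g0; rewrite E c0 scale0r eqxx.
Qed.

Lemma gt_highest : highest q gt_ops (fun j : 'I_d => r`_j + j%:Z) (gt top_array).
Proof.
split=> [j|i].
  rewrite gt_KE; congr (qc ^ _ *: _); rewrite /wt.
  have E k n : (k < d)%N -> (n <= k.+1)%N ->
      \sum_(i < n) (top_array k i + i%:Z) = \sum_(i < n) (r`_i + i%:Z).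
    by move=> kd nk; apply: eq_bigr => -[i iln] _ /=; rewrite /top_array ifT //; lia.
  have jd := ltn_ord j.
  by rewrite !E //; [rewrite big_ord_recr /= [LHS]addrAC subrr add0r | lia | lia].
rewrite /= gtXE; apply: big1 => j _; rewrite move_coef_out1 ?scale0r //.
have id : (i.+1 < d)%N by rewrite -ltn_predRL.
have ji := leq_ord j.
move=> pS; have := pat_le pS id ji; rewrite shift_at shift_off; last by lia.
by rewrite /top_array !ifT; lia.
Qed.
End Module.

(** * Traces, the Schur lemma and the square of the antipode *)

Section Trace.
Variable R : realType.
Local Notation C := R[i].

Lemma lfun_traceC (V W : vectType C) (f : 'Hom(V, W)) (g : 'Hom(W, V)) :
  \tr (passmx.mxof (vbasis fullv) (vbasis fullv) (f \o g)%VF) =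
  \tr (passmx.mxof (vbasis fullv) (vbasis fullv) (g \o f)%VF).
Proof.
by rewrite !(passmx.mxof_comp _ _ (vbasisP _)) mxtrace_mulC.
Qed.

Lemma lfun_traceP (V : vectType C) a (f g : 'End(V)) :
  lfun_trace (a *: f + g) = a * lfun_trace f + lfun_trace g.
Proof. by rewrite /lfun_trace passmx.mxof_linear mxtraceD mxtraceZ. Qed.

Lemma lfun_trace0 (V : vectType C) : lfun_trace (0 : 'End(V)) = 0.
Proof.
by have := lfun_traceP (-1) (0 : 'End(V)) 0; rewrite scaler0 addr0 mulN1r addNr.
Qed.

Lemma lfun_traceZ (V : vectType C) a (f : 'End(V)) :
  lfun_trace (a *: f) = a * lfun_trace f.
Proof. by rewrite -[a *: f]addr0 lfun_traceP lfun_trace0 addr0. Qed.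

Lemma lfun_trace_sum (V : vectType C) (I : Type) (s : seq I) (E : I -> 'End(V)) :
  lfun_trace (\sum_(i <- s) E i) = \sum_(i <- s) lfun_trace (E i).
Proof.
elim: s => [|i s IHs]; first by rewrite !big_nil lfun_trace0.
by rewrite !big_cons -[E i]scale1r lfun_traceP IHs mul1r scale1r.
Qed.

Lemma lfun_trace_line (f : 'End(C^o)) : lfun_trace f = f 1.
Proof.
have fE v : f v = f 1 * v by rewrite -{1}[v]mulr1 -[v * 1]/(v *: (1 : C^o)) lfunZ mulrC.
have -> : f = f 1 *: \1%VF.
  by apply/lfunP => v; rewrite scale_lfunE id_lfunE fE.
rewrite lfun_traceZ /lfun_trace passmx.mxof1 ?mxtrace1.
  by rewrite dimvf /dim /= mulr1 scale_lfunE id_lfunE; exact: esym (mulr1 _).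
exact: basis_free (vbasisP _).
Qed.

Lemma schur (d : nat) (V : vectType C) (op : uq_gen d -> 'End(V)) (T : 'End(V)) :
  op_irreducible op -> (forall g v, T (op g v) = op g (T v)) ->
  exists c, T = c *: \1%VF.
Proof.
move=> [V0 irr] Tc.
have n0 : (0 < \dim {:V})%N by rewrite lt0n dimv_eq0.
have [c cE] := spectral.eigenvalue_closed (passmx.mxof (vbasis {:V}) (vbasis {:V}) T) n0.
exists c.
have [] := irr (lker (T - c *: \1%VF)).
- move=> g; apply/lfun_stableP => v; rewrite !memv_ker !add_lfunE !opp_lfunE !scale_lfunE !id_lfunE.
  by rewrite !subr_eq0 Tc => /eqP ->; rewrite lfunZ.
- move=> E; move: cE; rewrite /eigenvalue -(passmx.vsof_eq0 (vbasisP _)).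
  by rewrite -(passmx.leigenspaceE (vbasisP _)) /passmx.leigenspace E eqxx.
- move=> E; apply/lfunP => v.
  have : v \in lker (T - c *: \1%VF) by rewrite E memvf.
  by rewrite memv_ker !add_lfunE !opp_lfunE subr_eq0 => /eqP.
Qed.
End Trace.

Section Bidual.
Variables (R : realType) (d : nat) (q : R).
Hypotheses (q_gt0 : 0 < q) (q_lt1 : q < 1).
Variables (V : vectType R[i]) (rep : uq_repr_on d q V).
Local Notation C := R[i].
Local Notation qc := (q%:C : C).

Let q_neq0 : q != 0. Proof. by rewrite gt_eqF. Qed.
Let qc0 : qc != 0. Proof. exact: qC_neq0. Qed.

Lemma antipode0 : antipode (0 : Uq R d q) = 0.
Proof.
by have := antipode_linear q_neq0 (-1) (0 : Uq R d q) 0; rewrite scaler0 addr0 scaleN1r addNr.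
Qed.

Lemma antipodeZ a (X : Uq R d q) : antipode (a *: X) = a *: antipode X.
Proof. by rewrite -[a *: X]addr0 antipode_linear // antipode0 addr0. Qed.

Lemma antipodeD (X Y : Uq R d q) : antipode (X + Y) = antipode X + antipode Y.
Proof. by rewrite -{1}[X]scale1r antipode_linear // scale1r. Qed.

Lemma antipodeN (X : Uq R d q) : antipode (- X) = - antipode X.
Proof. by rewrite -scaleN1r antipodeZ scaleN1r. Qed.

Lemma cart_diag (i : 'I_d.-1) : cart i i = 2.
Proof.
rewrite /cart /wt_exp /= !eqxx.
have -> : i == i.+1 :> nat = false by lia.
have -> : i.+1 == i :> nat = false by lia.
by [].
Qed.

Lemma antipode2_x (i : 'I_d.-1) :
  antipode (antipode (Uq_x q i)) = qc ^ (- 2) *: Uq_x q i.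
Proof.
have Ski : antipode (Uq_ki q i) = Uq_k q i.
  by rewrite antipodeM // antipode_K // antipode_Ki // -Uq_KKi_comm.
rewrite antipode_x // antipodeN antipodeM // antipode_x // mulNr opprK Ski.
by rewrite (Uq_kix q_neq0) cart_diag -scalerAl -mulrA Uq_kikV mulr1.
Qed.

Lemma antipode2_y (i : 'I_d.-1) :
  antipode (antipode (Uq_y q i)) = qc ^ 2 *: Uq_y q i.
Proof.
have Sk : antipode (Uq_k q i) = Uq_ki q i.
  by rewrite antipodeM // antipode_K // antipode_Ki // Uq_KKi_comm.
rewrite antipode_y // antipodeN antipodeM // antipode_y // mulrN opprK Sk.
by rewrite mulrA (Uq_kiy q_neq0) cart_diag -!scalerAl -mulrA Uq_kikV mulr1.
Qed.

(** Both sides are multiplicative in X, so the generators suffice; S^2 multiplies x_i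
    by q^-2 and y_i by q^2 and fixes the K_j. *)
Lemma twisted_commutation (F : 'End(V)) :
  (forall j v, F (rep (Uq_K q j) v) = rep (Uq_K q j) (F v)) ->
  (forall j v, F (rep (Uq_Ki q j) v) = rep (Uq_Ki q j) (F v)) ->
  (forall i v, F (rep (Uq_x q i) v) = qc ^ (- 2) *: rep (Uq_x q i) (F v)) ->
  (forall i v, F (rep (Uq_y q i) v) = qc ^ 2 *: rep (Uq_y q i) (F v)) ->
  forall X v, F (rep X v) = rep (antipode (antipode X)) (F v).
Proof.
move=> FK FKi Fx Fy; elim/uq_ind; elim=> [[i|i|j|j]|||s IHs t IHt|s IHs t IHt|a t IHt] v.
- by rewrite Fx -repZ -antipode2_x.
- by rewrite Fy -repZ -antipode2_y.
- by rewrite -[uq_pi q _]/(Uq_K q j) FK antipode_K // antipode_Ki.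
- by rewrite -[uq_pi q _]/(Uq_Ki q j) FKi antipode_Ki // antipode_K.
- have -> : uq_pi q TZero = 0 by [].
  by rewrite !antipode0 !rep0 linear0.
- have -> : uq_pi q TOne = 1 by [].
  by rewrite !antipode1 // !rep1.
- by rewrite uq_piD repD lfunD IHs IHt !antipodeD repD.
- by rewrite uq_piM repM IHs IHt !antipodeM // repM.
- by rewrite uq_piZ repZ lfunZ IHt !antipodeZ repZ.
Qed.

Lemma separating (u v : V) : (forall f : 'Hom(V, C^o), f u = f v) -> u = v.
Proof.
move=> fuv; rewrite [u](coord_vbasis (memvf u)) [v](coord_vbasis (memvf v)).
apply: eq_bigr => i _; congr (_ *: _).
have [|f fE] := @linfunP _ V C^o (coord (vbasis fullv) i); first exact: linearP.
by rewrite -!fE fuv.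
Qed.

(** Functionals separate the points of V, and dualizing twice precomposes twice with
    the antipode. *)
Lemma bidual_intertwiner (F : 'End(V)) :
  (forall X, (bidual_map V \o F \o rep X)%VF =
             (dual_act (dual_act rep) X \o (bidual_map V \o F))%VF) <->
  (forall X v, F (rep X v) = rep (antipode (antipode X)) (F v)).
Proof.
have E X v f : (bidual_map V \o F \o rep X)%VF v f = f (F (rep X v)).
  by rewrite !comp_lfunE bidual_mapE.
have E' X v f : (dual_act (dual_act rep) X \o (bidual_map V \o F))%VF v f =
    f (rep (antipode (antipode X)) (F v)).
  by rewrite !comp_lfunE dual_actE comp_lfunE bidual_mapE dual_actE comp_lfunE.
split=> [H X v|H X]; last by apply/lfunP => v; apply/lfunP => f; rewrite E E' H.
by apply: separating => f; rewrite -E H E'.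
Qed.
End Bidual.

(** * The quantum dimension as a product over positive roots *)

Lemma dot_of_function (R : realType) (V : vectType R[i]) (f : V -> V -> R[i]) :
  (forall a u v w, f (a *: u + v) w = a * f u w + f v w) ->
  (forall u v, f u v = Num.conj (f v u)) ->
  (forall u, u != 0 -> 0 < f u u) ->
  exists form : {dot V for Num.conj}, forall u v, form u v = f u v.
Proof.
move=> lin herm pos.
have f0 w : f 0 w = 0.
  by have := lin (-1) 0 0 w; rewrite scaler0 addr0 mulN1r addNr.
have zl u' : zmod_morphism (f ^~ u').
  by move=> u v /=; rewrite addrC -scaleN1r lin mulN1r addrC.
have sl u' : scalable_for *%R (f ^~ u').
  by move=> a u /=; rewrite -[a *: u]addr0 lin f0 addr0.
have zr u : zmod_morphism (f u).
  by move=> v w; rewrite herm zl rmorphB /= -!herm.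
have sr u : scalable_for (Num.conj \; *%R) (f u).
  by move=> a v; rewrite herm sl rmorphM /= -herm.
have hs u v : f u v = (-1) ^+ false * Num.conj (f v u) by rewrite mul1r herm.
pose bil := isBilinear.Build _ V V _ *%R (Num.conj \; *%R) f zl zr sl sr.
pose her := isHermitianSesquilinear.Build _ V false Num.conj f hs.
pose dt := isDotProduct.Build _ V f pos.
pose form : {dot V for Num.conj} := HB.pack_for {dot V for Num.conj} f bil her dt.
by exists form.
Qed.

Section QDim.
Variables (R : realType) (d : nat) (q : R).
Hypotheses (q_gt0 : 0 < q) (q_lt1 : q < 1).
Variables (V : vectType R[i]) (rep : uq_repr_on d q V).
Local Notation C := R[i].
Local Notation qc := (q%:C : C).
Variable (r : seq int).
Hypothesis (size_r : size r = d).
Hypothesis (r_dec : forall i j, (i < j)%N -> (j < d)%N -> r`_j < r`_i).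

Let q_neq0 : q != 0. Proof. by rewrite gt_eqF. Qed.
Let qc0 : qc != 0. Proof. exact: qC_neq0. Qed.
Let x1 m : (q ^+ 2) ^+ m.+1 != 1.
Proof. by rewrite -exprM lt_eqF // exprn_ilt1 // ltW. Qed.

Local Notation G := (gt_space R d r).
Local Notation gt := (@gt R d r).

(** A diagonal operator is a combination of the coordinate projections, which factor
    through a line and therefore have trace 1. *)
Lemma trace_gtD (c : array -> C) :
  lfun_trace (gtD size_r c) = \sum_(p <- patterns d r) c (arr p).
Proof.
have /choice[E EP] : forall p : gt_index d r, exists E : 'End(G),
    (forall f, E f = (f p : C) *: gt (ar p)) /\ lfun_trace E = 1.
  move=> p.
  have [|h hE] := @linfunP _ G C^o (fun f => f p : C^o).
    by move=> a f g; rewrite !ffunE.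
  have [|k kE] := @linfunP _ C^o G (fun a => (a : C) *: gt (ar p)).
    by move=> a b b'; rewrite scalerDl scalerA.
  exists (k \o h)%VF; split=> [f|]; first by rewrite comp_lfunE kE hE.
  rewrite /lfun_trace lfun_traceC; transitivity (lfun_trace (h \o k)%VF) => //.
  by rewrite lfun_trace_line comp_lfunE hE kE ffunE gt_ar // eqxx [_ *: _]mulr1.
have -> : gtD size_r c = \sum_p c (ar p) *: E p.
  apply: (gt_ext size_r) => L /(ar_surj size_r)[p <-].
  rewrite gtDE sum_lfunE (bigD1 p) //= big1 ?addr0 => [|p' ne].
    rewrite scale_lfunE (EP p).1 (gt_ar R size_r p p) eqxx; congr (_ *: _).
    exact: esym (scale1r _).
  rewrite scale_lfunE (EP p').1 (gt_ar R size_r p p') (negPf ne).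
  by rewrite [0%:R *: _]scale0r; exact: scaler0.
rewrite lfun_trace_sum (eq_bigr (fun p => c (ar p))) => [|p _]; last first.
  by rewrite lfun_traceZ (EP p).2 mulr1.
rewrite -[in RHS](val_seq_sub_enum (uniq_patterns size_r)) big_map.
apply: perm_big; apply: uniq_perm; rewrite ?index_enum_uniq ?undup_uniq //.
by move=> p; rewrite mem_index_enum mem_seq_sub_enum.
Qed.

Variable phi : 'Hom(V, G).
Hypotheses (phi_inj : lker phi = 0%VS) (phi_surj : limg phi = fullv).
Hypothesis (phiE : forall x v, phi (gen_ops rep x v) = gt_ops q size_r x (phi v)).

Let psi := (phi^-1)%VF.
Let phiK v : psi (phi v) = v.
Proof. by apply: lker0_lfunK; apply/eqP. Qed.
Let psiK w : phi (psi w) = w.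
Proof. by apply: limg_lfunVK; rewrite phi_surj memvf. Qed.

Let form_ex : exists form : {dot V for Num.conj},
  forall v w, form v w = gt_form q (phi v) (phi w).
Proof.
apply: (@dot_of_function _ _ (fun v w => gt_form q (phi v) (phi w))).
- by move=> a u v w; rewrite linearP gt_form_linear.
- by move=> u v; rewrite gt_formC.
- move=> u u0; apply: gt_form_gt0 => //; apply: contra_neq u0 => e.
  by apply/eqP; rewrite -memv0 -phi_inj memv_ker e.
Qed.

Let star_form (form : {dot V for Num.conj}) :
  (forall v w, form v w = gt_form q (phi v) (phi w)) -> star_unitary rep form.
Proof.
move=> fE.
have fDl u v w : form (u + v) w = form u w + form v w.
  by rewrite !fE lfunD -{1}[phi u]scale1r gt_form_linear mul1r.
have fDr u v w : form w (u + v) = form w u + form w v.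
  by rewrite !fE lfunD gt_formDr.
have fZl b u w : form (b *: u) w = b * form u w.
  by rewrite !fE lfunZ gt_formZl.
have fZr b u w : form w (b *: u) = Num.conj b * form w u.
  by rewrite !fE lfunZ gt_formZr.
elim/uq_ind; elim=> [[i|i|j|j]|||s IHs t IHt|s IHs t IHt|a t IHt] v w.
- rewrite -[uq_pi q _]/(Uq_x q i) star_x // repZ repM repM !fE.
  rewrite (phiE (GenX i)) gt_starX //; congr (gt_form q _ _).
  by rewrite lfunZ (phiE (GenY i)) (phiE (GenK _)) (phiE (GenKi _)).
- rewrite -[uq_pi q _]/(Uq_y q i) star_y // repZ repM repM !fE.
  rewrite (phiE (GenY i)) gt_starY //; congr (gt_form q _ _).
  by rewrite lfunZ (phiE (GenKi _)) (phiE (GenK _)) (phiE (GenX i)).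
- rewrite -[uq_pi q _]/(Uq_K q j) star_K // !fE.
  by rewrite !(phiE (GenK j)) gt_starK.
- rewrite -[uq_pi q _]/(Uq_Ki q j) star_Ki // !fE.
  by rewrite !(phiE (GenKi j)) gt_starKi.
- have -> : uq_pi q TZero = 0 by [].
  have -> : star (0 : Uq R d q) = 0.
    have := star_antilinear q_neq0 (-1) (0 : Uq R d q) 0.
    by rewrite scaler0 addr0 rmorphN rmorph1 scaleN1r addNr.
  by rewrite !rep0 -(scale0r (0 : V)) fZl fZr conjC0 !mul0r.
- have -> : uq_pi q TOne = 1 by [].
  by rewrite star1 // !rep1.
- have SD X Y : star (X + Y : Uq R d q) = star X + star Y.
    have := star_antilinear q_neq0 1 X Y; rewrite rmorph1 !scale1r; exact.
  by rewrite uq_piD SD !repD fDl fDr IHs IHt.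
- by rewrite uq_piM starM // !repM IHs IHt.
- have SZ X : star (a *: X : Uq R d q) = Num.conj a *: star X.
    have := star_antilinear q_neq0 a X 0.
    have -> : star (0 : Uq R d q) = 0.
      have := star_antilinear q_neq0 (-1) (0 : Uq R d q) 0.
      by rewrite scaler0 addr0 rmorphN rmorph1 scaleN1r addNr.
    by rewrite !addr0.
  by rewrite uq_piZ SZ !repZ fZl fZr IHt conjCK.
Qed.

Let weight (L : array) : R := q ^ trace_exponent d L.

Let weight_shift k j c L : (k.+1 < d)%N -> (j <= k)%N ->
  weight (shift L k j c) = q ^ (- 2 * c) * weight L.
Proof.
move=> kd jk; rewrite /weight -expfzDr //; congr (q ^ _); rewrite /trace_exponent.
have kd' : (k < d)%N by apply: ltnW.
rewrite (eq_bigr (fun i : 'I_d => (2 * i%:Z + 1 - d%:Z) * wt i L +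
   (2 * i%:Z + 1 - d%:Z) * (c * ((i == k :> nat)%:Z - (i == k.+1 :> nat)%:Z)))); last first.
  by move=> i _; rewrite wt_shift // mulrDr.
rewrite big_split /= addrC; congr (_ + _).
rewrite (bigD1 (Ordinal kd')) //= (bigD1 (Ordinal kd)) /=; last by rewrite -val_eqE /=; lia.
rewrite big1 ?addr0 => [|i]; last first.
  by rewrite -!val_eqE /= => /andP[/negPf -> /negPf ->]; rewrite subrr !mulr0.
rewrite !eqxx; have -> : k == k.+1 = false by lia.
have -> : k.+1 == k = false by lia.
by rewrite intS /=; ring.
Qed.

Let real_pow (z : int) : qc ^ z = (q ^ z)%:C.
Proof. by rewrite fmorphXz. Qed.

Section Diagonal.
Variable D : 'End(G).
Hypothesis DE : forall L, D (gt L) = (weight L)%:C *: gt L.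

Lemma diagonal_X (i : 'I_d.-1) w :
  D (gt_ops q size_r (GenX i) w) = qc ^ (- 2) *: gt_ops q size_r (GenX i) (D w).
Proof.
have id : (i.+1 < d)%N by rewrite -ltn_predRL.
rewrite -[LHS]comp_lfunE -[gt_ops _ _ _ (D w)]comp_lfunE -scale_lfunE; congr (fun_of_lfun _ w).
apply: (gt_ext size_r) => L pL; rewrite scale_lfunE !comp_lfunE DE lfunZ /= gtXE.
rewrite lfun_sum !scaler_sumr; apply: eq_bigr => j _.
rewrite lfunZ DE (weight_shift 1 L id (leq_ord j)) mulr1 !scalerA; congr (_ *: _).
by rewrite real_pow rmorphM /=; ring.
Qed.

Lemma diagonal_Y (i : 'I_d.-1) w :
  D (gt_ops q size_r (GenY i) w) = qc ^ 2 *: gt_ops q size_r (GenY i) (D w).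
Proof.
have id : (i.+1 < d)%N by rewrite -ltn_predRL.
rewrite -[LHS]comp_lfunE -[gt_ops _ _ _ (D w)]comp_lfunE -scale_lfunE; congr (fun_of_lfun _ w).
apply: (gt_ext size_r) => L pL; rewrite scale_lfunE !comp_lfunE DE lfunZ /= gtYE.
rewrite lfun_sum !scaler_sumr; apply: eq_bigr => j _.
rewrite lfunZ DE (weight_shift (- 1) L id (leq_ord j)) mulrNN mulr1 !scalerA; congr (_ *: _).
by rewrite real_pow rmorphM /=; ring.
Qed.

Lemma diagonal_D c w : D (gtD size_r c w) = gtD size_r c (D w).
Proof.
rewrite -[LHS]comp_lfunE -[RHS]comp_lfunE; congr (fun_of_lfun _ w); apply: (gt_ext size_r) => L _.
rewrite !comp_lfunE DE lfunZ (gtDE size_r c L) lfunZ DE !scalerA; congr (_ *: _).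
exact: mulrC.
Qed.
End Diagonal.

Let DW := gtD size_r (fun L => (weight L)%:C).
Let DWV := gtD size_r (fun L => ((weight L)^-1)%:C).
(** The operator K_(2 rho)^-1, transported from the Gelfand-Tsetlin module. *)
Definition qdim_witness : 'End(V) := (psi \o (DW \o phi))%VF.
Definition qdim_witnessV : 'End(V) := (psi \o (DWV \o phi))%VF.

Let weight_gt0 L : 0 < weight L. Proof. exact: exprz_gt0. Qed.

Let gtD_comp (c c' : array -> C) w :
  (forall L, c L * c' L = 1) -> gtD size_r c (gtD size_r c' w) = w.
Proof.
move=> cc; rewrite -[LHS]comp_lfunE -[RHS]id_lfunE; congr (fun_of_lfun _ w).
apply: (gt_ext size_r) => L _; rewrite comp_lfunE id_lfunE (gtDE size_r c' L) lfunZ.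
rewrite (gtDE size_r c L) scalerA [_ * _]mulrC cc; exact: scale1r.
Qed.

Let WK w : DW (DWV w) = w.
Proof. by apply: gtD_comp => L; rewrite -rmorphM /= divff // gt_eqF. Qed.
Let WVK w : DWV (DW w) = w.
Proof. by apply: gtD_comp => L; rewrite -rmorphM /= mulVf // gt_eqF. Qed.

Lemma witnessE v : phi (qdim_witness v) = DW (phi v).
Proof. by rewrite /qdim_witness !comp_lfunE psiK. Qed.

Lemma witnessK : (qdim_witness \o qdim_witnessV = \1)%VF.
Proof.
by apply/lfunP => v; rewrite /qdim_witness /qdim_witnessV !comp_lfunE psiK WK phiK id_lfunE.
Qed.
Lemma witnessVK : (qdim_witnessV \o qdim_witness = \1)%VF.
Proof.
by apply/lfunP => v; rewrite /qdim_witness /qdim_witnessV !comp_lfunE psiK WVK phiK id_lfunE.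
Qed.

Lemma witness_ker : lker qdim_witness == 0%VS.
Proof.
rewrite -subv0; apply/subvP => v; rewrite memv_ker memv0 => /eqP Wv.
by rewrite -[v]id_lfunE -witnessVK comp_lfunE Wv linear0.
Qed.

Lemma witness_inv : qdim_witness^-1%VF = qdim_witnessV.
Proof.
by rewrite -[LHS]comp_lfun1r -witnessK comp_lfunA (lker0_compVf witness_ker) comp_lfun1l.
Qed.

Lemma trace_conj (T : 'End(G)) : lfun_trace (psi \o (T \o phi))%VF = lfun_trace T.
Proof.
rewrite /lfun_trace lfun_traceC; congr (\tr (passmx.mxof _ _ _)).
by apply/lfunP => w; rewrite !comp_lfunE psiK.
Qed.

Definition weyl_product : R :=
  \prod_(i < d) \prod_(j < d | (i < j)%N) (qnum q (r`_i - r`_j) / qnum q (j%:Z - i%:Z)).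

Let dec i : (i.+1 < d)%N -> r`_i.+1 < r`_i.
Proof. by move=> id; apply: r_dec. Qed.

Lemma trace_witness : lfun_trace qdim_witness = weyl_product%:C.
Proof.
rewrite /qdim_witness trace_conj trace_gtD -(rmorph_sum (real_complex R)) /=.
by rewrite /weight (sum_trace q_gt0 x1 size_r dec).
Qed.

Lemma qnumV z : qnum q^-1 z = qnum q z.
Proof.
rewrite /qnum invrK !exprz_inv opprK -[q^-1 - q]opprB -[q ^ (- z) - _]opprB.
by rewrite invrN mulrNN.
Qed.

(** The q-numbers, hence the Weyl product, are invariant under q -> q^-1. *)
Lemma trace_witnessV : lfun_trace qdim_witnessV = weyl_product%:C.
Proof.
have qV0 : 0 < q^-1 by rewrite invr_gt0.
have xV1 m : (q^-1 ^+ 2) ^+ m.+1 != 1.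
  by rewrite -exprM exprVn invr_eq1 exprM x1.
rewrite /qdim_witnessV trace_conj trace_gtD -(rmorph_sum (real_complex R)) /=.
congr (_%:C); rewrite /weyl_product.
transitivity (\sum_(p <- patterns d r) q^-1 ^ trace_exponent d (arr p)).
  by apply: eq_bigr => p _; rewrite /weight exprz_inv invr_expz.
rewrite (sum_trace qV0 xV1 size_r dec).
by apply: eq_bigr => i _; apply: eq_bigr => j _; rewrite !qnumV.
Qed.

Lemma weyl_product_gt0 : 0 < weyl_product.
Proof.
apply: prodr_gt0 => i _; apply: prodr_gt0 => j ij.
by rewrite divr_gt0 // qnum_gt0 // ?subr_gt0 ?ltz_nat //; exact: r_dec.
Qed.

Lemma witness_commutes X v :
  qdim_witness (rep X v) = rep (antipode (antipode X)) (qdim_witness v).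
Proof.
have phiinj u w : phi u = phi w -> u = w by move=> e; rewrite -[u]phiK e phiK.
have DWE L : DW (gt L) = (weight L)%:C *: gt L by exact: gtDE.
apply: (twisted_commutation q_gt0 q_lt1) => [j u|j u|i u|i u]; apply: phiinj.
- by rewrite witnessE !(phiE (GenK j)) witnessE; exact: diagonal_D.
- by rewrite witnessE !(phiE (GenKi j)) witnessE; exact: diagonal_D.
- by rewrite witnessE lfunZ !(phiE (GenX i)) witnessE; exact: diagonal_X.
- by rewrite witnessE lfunZ !(phiE (GenY i)) witnessE; exact: diagonal_Y.
Qed.

(** The witness is the square of a self-adjoint invertible operator, its square root in
    the pattern basis. *)
Lemma witness_positive (form : {dot V for Num.conj}) :
  (forall v w, form v w = gt_form q (phi v) (phi w)) -> positive_definite form qdim_witness.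
Proof.
move=> fE v v0; rewrite fE witnessE.
pose sq L : R := Num.sqrt (weight L).
have sq0 L : 0 < sq L by rewrite sqrtr_gt0.
have -> : DW (phi v) = gtD size_r (fun L => (sq L)%:C) (gtD size_r (fun L => (sq L)%:C) (phi v)).
  rewrite -[RHS]comp_lfunE; congr (fun_of_lfun _ (phi v)); apply: (gt_ext size_r) => L _.
  rewrite comp_lfunE (gtDE size_r _ L) lfunZ !(gtDE size_r _ L) scalerA -rmorphM /=.
  by rewrite -expr2 sqr_sqrtr // ltW.
rewrite gt_starD //; apply: gt_form_gt0 => //.
apply: contra_neq v0 => e; rewrite -[v]phiK.
have K : gtD size_r (fun L => ((sq L)^-1)%:C) (gtD size_r (fun L => (sq L)%:C) (phi v)) = phi v.
  by apply: gtD_comp => L; rewrite -rmorphM /= mulVf // gt_eqF.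
by rewrite -K e !linear0.
Qed.

Lemma qdim_operator_witness : qdim_operator rep qdim_witness.
Proof.
have [form fE] := form_ex; exists form; split.
- exact: star_form.
- by split; [exact: witness_positive | exact: witness_ker].
- by rewrite witness_inv trace_witness trace_witnessV.
- by rewrite trace_witness ltcR weyl_product_gt0.
- by apply/bidual_intertwiner; exact: witness_commutes.
Qed.

(** By the Schur lemma F is c times the witness. The witness and its inverse have the
    same trace, so equality of the traces of F and its inverse gives c^2 = 1, and
    positivity of the trace leaves c = 1. *)
Lemma qdim_operator_unique F : op_irreducible (gen_ops rep) ->
  qdim_operator rep F -> F = qdim_witness.
Proof.
move=> irr [form [_ [_ kF] trF trpos /bidual_intertwiner Fc]].
have cK u : qdim_witness (qdim_witnessV u) = u by rewrite -comp_lfunE witnessK id_lfunE.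
have cVK u : qdim_witnessV (qdim_witness u) = u by rewrite -comp_lfunE witnessVK id_lfunE.
have [|c cE] := schur (T := (qdim_witnessV \o F)%VF) irr.
  have TE w : (qdim_witnessV \o F)%VF w = qdim_witnessV (F w) by exact: comp_lfunE.
  move=> g v; rewrite !TE /gen_ops Fc -{1}[F v]cK.
  by rewrite -(witness_commutes _ (qdim_witnessV (F v))) cVK.
have FE : F = c *: qdim_witness.
  apply/lfunP => v; rewrite scale_lfunE -[LHS]cK.
  by rewrite -(comp_lfunE qdim_witnessV F) cE scale_lfunE id_lfunE lfunZ.
have c0 : c != 0.
  by apply: contraTneq trpos => c0; rewrite FE c0 scale0r lfun_trace0 ltxx.
have FV : F^-1%VF = c^-1 *: qdim_witnessV.
  have FX : (F \o (c^-1 *: qdim_witnessV) = \1)%VF.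
    apply/lfunP => v; rewrite FE comp_lfunE !scale_lfunE lfunZ cK scalerA divff // id_lfunE.
    exact: scale1r.
  by rewrite -[LHS]comp_lfun1r -FX comp_lfunA (lker0_compVf kF) comp_lfun1l.
move: trF trpos; rewrite FV FE !lfun_traceZ trace_witness trace_witnessV.
have w0 : weyl_product%:C != 0 :> C by rewrite fmorph_eq0 gt_eqF // weyl_product_gt0.
move=> /(mulIf w0) cc; rewrite pmulr_lgt0 ?ltcR ?weyl_product_gt0 // => cpos.
have : c ^+ 2 == 1 by rewrite expr2 {2}cc divff.
rewrite sqrf_eq1 => /orP[/eqP ->|/eqP cN]; first by rewrite scale1r.
by move: cpos; rewrite cN oppr_gt0 ltr10.
Qed.

Lemma qdim_value : op_irreducible (gen_ops rep) -> qdim rep = weyl_product%:C.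
Proof.
move=> irr; rewrite /qdim -trace_witness; congr lfun_trace.
apply: qdim_operator_unique => //.
have : exists F, [set F | qdim_operator rep F]%classic F.
  by exists qdim_witness; exact: qdim_operator_witness.
by move/(xgetPex 0).
Qed.
End QDim.

(** * Products over the positive roots of a symmetric weight *)

(** The indices split into the first n, the middle m and the last n, which are numbered
    from the end by j |-> d - 1 - j. In the order of the factors: pairs inside one end,
    pairs of an end and the middle, pairs of the two ends, pairs inside the middle. *)
Lemma triangle_blocks (T : comPzSemiRingType) n m d (F : nat -> nat -> T) :
  d = (n + (m + n))%N ->
  \prod_(i < d) \prod_(j < d | (i < j)%N) F i j =
    (\prod_(i < n) \prod_(j < n | (i < j)%N) (F i j * F (d.-1 - j)%N (d.-1 - i)%N))
    * (\prod_(i < n) \prod_(t < m) (F i (n + t)%N * F (n + (m.-1 - t))%N (d.-1 - i)%N))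
    * (\prod_(i < n) \prod_(j < n) F i (d.-1 - j)%N)
    * \prod_(s < m) \prod_(t < m | (s < t)%N) F (n + s)%N (n + t)%N.
Proof.
move=> dE; subst d; rewrite big_split_ord /= [X in _ * X = _]big_split_ord /=.
have revE (j : 'I_n) : (n + (m + rev_ord j) = (n + (m + n)).-1 - j)%N.
  by have := ltn_ord j; rewrite /=; lia.
have -> : \prod_(i < n) \prod_(j < n + (m + n) | (i < j)%N) F i j =
    (\prod_(i < n) \prod_(j < n | (i < j)%N) F i j)
    * (\prod_(i < n) \prod_(t < m) F i (n + t)%N)
    * \prod_(i < n) \prod_(j < n) F i ((n + (m + n)).-1 - j)%N.
  rewrite -!big_split /=; apply: eq_bigr => i _.
  rewrite big_split_ord /= [X in _ * X = _]big_split_ord /= mulrA; congr (_ * _ * _).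
  - by apply: eq_bigl => j; rewrite ltn_addr.
  - rewrite (reindex_inj rev_ord_inj) /=; apply: eq_big => [j|j _]; last by rewrite -revE.
    by have := ltn_ord i; lia.
have -> : \prod_(s < m) \prod_(j < n + (m + n) | (n + s < j)%N) F (n + s)%N j =
    (\prod_(s < m) \prod_(t < m | (s < t)%N) F (n + s)%N (n + t)%N)
    * \prod_(i < n) \prod_(t < m) F (n + (m.-1 - t))%N ((n + (m + n)).-1 - i)%N.
  rewrite [X in _ = _ * X]exchange_big /= [X in _ = _ * X](reindex_inj rev_ord_inj) /=.
  rewrite -big_split /=; apply: eq_bigr => s _.
  rewrite big_split_ord /= big_pred0 ?mul1r => [|j]; last by have := ltn_ord j; lia.
  rewrite big_split_ord /=; congr (_ * _).
  - by apply: eq_bigl => t; lia.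
  - rewrite (reindex_inj rev_ord_inj) /=; apply: eq_big => [j|j _].
      by have := ltn_ord s; lia.
    rewrite -revE; congr (F _ _); have := ltn_ord s; lia.
have -> : \prod_(s < n) \prod_(j < n + (m + n) | (n + (m + s) < j)%N) F (n + (m + s))%N j =
    \prod_(i < n) \prod_(j < n | (i < j)%N)
      F ((n + (m + n)).-1 - j)%N ((n + (m + n)).-1 - i)%N.
  rewrite (reindex_inj rev_ord_inj) /= [RHS](exchange_big_dep xpredT) //=.
  apply: eq_bigr => j _.
  rewrite big_split_ord /= big_pred0 ?mul1r => [|i]; last by have := ltn_ord i; lia.
  rewrite big_split_ord /= big_pred0 ?mul1r => [|i]; last by have := ltn_ord i; lia.
  rewrite (reindex_inj rev_ord_inj) /=; apply: eq_big => [i|i _].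
    by have := ltn_ord j; have := ltn_ord i; lia.
  by rewrite -!revE.
have -> : \prod_(i < n) \prod_(j < n | (i < j)%N)
      (F i j * F ((n + (m + n)).-1 - j)%N ((n + (m + n)).-1 - i)%N) =
    (\prod_(i < n) \prod_(j < n | (i < j)%N) F i j)
    * \prod_(i < n) \prod_(j < n | (i < j)%N)
      F ((n + (m + n)).-1 - j)%N ((n + (m + n)).-1 - i)%N.
  by rewrite -big_split /=; apply: eq_bigr => i _; rewrite big_split.
have -> : \prod_(i < n) \prod_(t < m)
      (F i (n + t)%N * F (n + (m.-1 - t))%N ((n + (m + n)).-1 - i)%N) =
    (\prod_(i < n) \prod_(t < m) F i (n + t)%N)
    * \prod_(i < n) \prod_(t < m) F (n + (m.-1 - t))%N ((n + (m + n)).-1 - i)%N.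
  by rewrite -big_split /=; apply: eq_bigr => i _; rewrite big_split.
set AA := \prod_(i < n) \prod_(j < n | _) F i j.
set CC := \prod_(i < n) \prod_(j < n | _) F (_ - j)%N (_ - i)%N.
set AC := \prod_(i < n) \prod_(j < n) F i ((n + (m + n)).-1 - j)%N.
set AB := \prod_(i < n) \prod_(t < m) F i (n + t)%N.
set BC := \prod_(i < n) \prod_(t < m) F (n + (m.-1 - t))%N _.
set BB := \prod_(i < m) \prod_(t < m | _) _.
by rewrite !mulrA -!mulrA; congr (_ * _); rewrite !mulrA; ring.
Qed.

Lemma prod_symmetric (T : comPzSemiRingType) n (H : nat -> nat -> T) :
  (forall i j, H i j = H j i) ->
  \prod_(i < n) \prod_(j < n) H i j =
  (\prod_(i < n) H i i) * \prod_(i < n) \prod_(j < n | (i < j)%N) H i j ^+ 2.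
Proof.
move=> HC; transitivity (\prod_(i < n) (H i i *
    ((\prod_(j < n | (i < j)%N) H i j) * \prod_(j < n | (j < i)%N) H i j))).
  apply: eq_bigr => i _; rewrite (bigD1 i) //=; congr (_ * _).
  rewrite (bigID (fun j : 'I_n => (i < j)%N)) /=; congr (_ * _); apply: eq_bigl => j.
    by rewrite -val_eqE /=; lia.
  by rewrite -val_eqE /=; lia.
rewrite !big_split /=; congr (_ * _).
rewrite [X in _ * X](exchange_big_dep xpredT) //= -big_split /=; apply: eq_bigr => i _.
rewrite -big_split /=; apply: eq_bigr => j _.
by rewrite (HC j i) expr2.
Qed.

Lemma sum_differences n (u : nat -> int) :
  \sum_(i < n) \sum_(j < n | (i < j)%N) (u j - u i) = \sum_(i < n) (2 * i%:Z + 1 - n%:Z) * u i.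
Proof.
elim: n => [|n IHn]; first by rewrite !big_ord0.
rewrite big_ord_recr /= [X in _ + X]big1 ?addr0 => [|i]; last first.
  by have := ltn_ord i; lia.
rewrite (eq_bigr (fun i : 'I_n => (\sum_(j < n | (i < j)%N) (u j - u i)) + (u n - u i))).
  rewrite big_split /= IHn sumrB sumr_const card_ord -mulr_natl natz big_ord_recr /=.
  have -> : \sum_(i < n) (2 * i%:Z + 1 - n.+1%:Z) * u i =
      \sum_(i < n) (2 * i%:Z + 1 - n%:Z) * u i - \sum_(i < n) u i.
    by rewrite -sumrB; apply: eq_bigr => i _; rewrite intS; ring.
  by rewrite intS; ring.
by move=> i _; rewrite big_mkcond big_ord_recr /= ltn_ord -big_mkcond.
Qed.

Lemma sum_blocks n m d (g : nat -> int) : d = (n + (m + n))%N ->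
  \sum_(i < d) g i = \sum_(i < n) (g i + g (d.-1 - i)%N) + \sum_(t < m) g (n + t)%N.
Proof.
move=> dE; subst d; rewrite big_split_ord /= [X in _ + X = _]big_split_ord /= big_split /=.
rewrite [\sum_(i < n) g (n + (m + i))%N](reindex_inj rev_ord_inj) /= addrA addrAC.
congr (_ + _ + _); apply: eq_bigr => i _; congr g.
by have := ltn_ord i; lia.
Qed.

Section Product.
Variables (R : realType) (q : R).
Hypotheses (q_gt0 : 0 < q) (q_lt1 : q < 1).

Let E (z : int) : R := 1 - q ^ (2 * z).

Lemma E_neq0 b : b != 0 -> E b != 0.
Proof.
move=> b0; rewrite /E subr_eq0 -(expr0z q) (inj_eq (qpow_inj q_gt0 q_lt1)).
by apply: contra_neq b0; lia.
Qed.

Lemma qnum_quotient (a b : int) : b != 0 -> qnum q a / qnum q b = q ^ (b - a) * (E a / E b).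
Proof.
move=> b0; have nz z : q ^ z != 0 by exact: qpow_neq0.
have qd : q - q^-1 != 0 by exact: qdiff_neq0.
have e z : qnum q z = - (q ^ (- z) * E z / (q - q^-1)).
  rewrite /qnum /E mulrBr mulr1 -expfzDr ?gt_eqF //.
  have -> : - z + 2 * z = z by ring.
  by rewrite -mulNr opprB.
have Eb := E_neq0 b0.
rewrite !e expfzDr ?gt_eqF // -[q ^ b]invrK invr_expz.
move: (q - q^-1) qd (q ^ (- a)) (q ^ (- b)) (nz (- b)) => x x0 y z z0.
move: (E a) (E b) Eb => f g g0; field.
by rewrite g0 x0 z0.
Qed.

(** Pairs inside one end give the factors in l_j - l_k, pairs of the two ends those in
    l_j + l_k and, on the diagonal, those in 2 l_i; pairs of an end and the middle
    give the q-shifted factorials, and the middle contributes 1. *)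
Lemma weyl_product_blocks n d (lam : 'I_n -> nat) (w : nat -> int) : (2 * n <= d)%N ->
  (forall i : 'I_n, w i = (lam i)%:Z) ->
  (forall i : 'I_n, w (d.-1 - i)%N = - (lam i)%:Z) ->
  (forall t, (t < d - 2 * n)%N -> w (n + t)%N = 0) ->
  let r (i : 'I_n) : int := (rho_vec i)%:Z in
  let l (i : 'I_n) : int := (lam i)%:Z in
  let m : int := d%:Z - 2 * n%:Z in
  \prod_(i < d) \prod_(j < d | (i < j)%N)
     (qnum q (w i - w j + (j%:Z - i%:Z)) / qnum q (j%:Z - i%:Z)) =
  q ^ (2 * (2 * n%:Z - d%:Z - 1) * (weight_size lam)%:Z
          - 4 * (rho_pairing lam)%:Z)
   * \prod_(i < n)
       (qpoch (q ^ (2 * (1 + l i + r i))) (q ^+ 2) (d - 2 * n) ^+ 2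
          / qpoch (q ^ (2 * (1 + r i))) (q ^+ 2) (d - 2 * n) ^+ 2
        * ((1 - q ^ (2 * (m + 1 + 2 * (l i + r i))))
             / (1 - q ^ (2 * (m + 1 + 2 * r i)))))
   * \prod_(j < n) \prod_(k < n | (j < k)%N)
       ((1 - q ^ (2 * (m + 1 + l j + l k + r j + r k))) ^+ 2
          * (1 - q ^ (2 * (l j - l k + r j - r k))) ^+ 2
        / ((1 - q ^ (2 * (m + 1 + r j + r k))) ^+ 2
             * (1 - q ^ (2 * (r j - r k))) ^+ 2)).
Proof.
move=> nd wA wC wB r l m.
have q0 : q != 0 by rewrite gt_eqF.
have dE : d = (n + ((d - 2 * n) + n))%N by lia.
pose F (i j : nat) : R := E (w i - w j + (j%:Z - i%:Z)) / E (j%:Z - i%:Z).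
transitivity ((\prod_(i < d) \prod_(j < d | (i < j)%N) q ^ (w j - w i))
    * \prod_(i < d) \prod_(j < d | (i < j)%N) F i j).
  rewrite -big_split /=; apply: eq_bigr => i _; rewrite -big_split /=; apply: eq_bigr => j ij.
  rewrite qnum_quotient; last by lia.
  by congr (q ^ _ * _); ring.
have -> : \prod_(i < d) \prod_(j < d | (i < j)%N) q ^ (w j - w i) =
    q ^ (2 * (2 * n%:Z - d%:Z - 1) * (weight_size lam)%:Z - 4 * (rho_pairing lam)%:Z).
  rewrite (eq_bigr (fun i : 'I_d => q ^ (\sum_(j < d | (i < j)%N) (w j - w i)))); last first.
    by move=> i _; rewrite (qpow_sum q_gt0).
  rewrite -(qpow_sum q_gt0); congr (q ^ _); rewrite sum_differences.
  rewrite (sum_blocks (fun i => (2 * i%:Z + 1 - d%:Z) * w i) dE).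
  rewrite [X in _ + X]big1 ?addr0 => [|t _]; last by rewrite wB // mulr0.
  rewrite -[(weight_size _)%:Z]natz -[(rho_pairing _)%:Z]natz /weight_size /rho_pairing !natr_sum !mulr_sumr -sumrB; apply: eq_bigr => i _.
  have := ltn_ord i => iN; rewrite wA wC /rho_vec !natz PoszM.
  have -> : (d.-1 - i)%:Z = d%:Z - 1 - i%:Z by lia.
  have -> : (n - i.+1)%:Z = n%:Z - 1 - i%:Z by lia.
  ring.
rewrite (triangle_blocks _ dE); set G := \prod_(s < d - 2 * n) _.
have -> : G = 1.
  rewrite /G big1 // => s _; rewrite big1 // => t st.
  rewrite /F !wB // subrr add0r divff //; apply: E_neq0; lia.
rewrite mulr1 -[RHS]mulrA; congr (_ * _).
pose H (i j : nat) : R := E (w i + w j + (d%:Z - 1 - i%:Z - j%:Z)) / E (d%:Z - 1 - i%:Z - j%:Z).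
have -> : \prod_(i < n) \prod_(j < n) F i (d.-1 - j)%N = \prod_(i < n) \prod_(j < n) H i j.
  apply: eq_bigr => i _; apply: eq_bigr => j _; rewrite /F /H wC -wA.
  have := ltn_ord i; have := ltn_ord j => jn iN.
  by congr (E _ / E _); lia.
rewrite prod_symmetric => [|i j]; last by rewrite /H; congr (E _ / E _); ring.
rewrite [X in X * _ = _]mulrC mulrACA; congr (_ * _); rewrite -big_split /=.
  apply: eq_bigr => i _; have iN := ltn_ord i; congr (_ * _); last first.
    by rewrite /H wA /r /l /m /rho_vec; congr (E _ / E _); lia.
  have qpochE (a : int) : qpoch (q ^ (2 * a)) (q ^+ 2) (d - 2 * n) =
      \prod_(t < d - 2 * n) E (a + t%:Z).
    by apply: eq_bigr => t _; rewrite /E mulrDr expfzDr // -exprM exprnP PoszM.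
  rewrite !qpochE !expr2 -!big_split -prodf_div /=; apply: eq_bigr => t _.
  have ts := ltn_ord t.
  have -> : F (n + ((d - 2 * n).-1 - t))%N (d.-1 - i)%N = F i (n + t)%N.
    by rewrite /F wC !wB ?wA; [congr (E _ / E _); lia | lia | lia].
  rewrite mulf_div /F wA wB //.
  have -> : (lam i)%:Z - 0 + ((n + t)%:Z - i%:Z) = 1 + l i + r i + t%:Z.
    by rewrite /r /l /rho_vec; lia.
  by have -> : (n + t)%:Z - i%:Z = 1 + r i + t%:Z by rewrite /r /rho_vec; lia.
apply: eq_bigr => i _; rewrite -big_split /=; apply: eq_bigr => j ij.
have iN := ltn_ord i; have jN := ltn_ord j.
have -> : F (d.-1 - j)%N (d.-1 - i)%N = F i j.
  by rewrite /F !wC !wA; congr (E _ / E _); lia.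
rewrite /F /H !wA.
have -> : (lam i)%:Z - (lam j)%:Z + (j%:Z - i%:Z) = l i - l j + r i - r j.
  by rewrite /r /l /rho_vec; lia.
have -> : j%:Z - i%:Z = r i - r j by rewrite /r /rho_vec; lia.
have -> : (lam i)%:Z + (lam j)%:Z + (d%:Z - 1 - i%:Z - j%:Z) = m + 1 + l i + l j + r i + r j.
  by rewrite /r /l /m /rho_vec; lia.
have -> : d%:Z - 1 - i%:Z - j%:Z = m + 1 + r i + r j by rewrite /r /m /rho_vec; lia.
by rewrite expr_div_n !mulf_div -!expr2 [E _ ^+ 2 * _]mulrC [E (r i - r j) ^+ 2 * _]mulrC.
Qed.
End Product.

(** * The quantum dimension formula *)

Lemma natural_weight_decreasing n d (lam : 'I_n -> nat) :
  (forall i j : 'I_n, (i <= j)%N -> (lam j <= lam i)%N) ->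
  forall i j : 'I_d, (i <= j)%N -> natural_weight lam j <= natural_weight lam i.
Proof.
move=> hlam i j ij; have iN := ltn_ord i; have jN := ltn_ord j.
rewrite /natural_weight; case: insubP => [b bn bE|nb].
  case: insubP => [a _ aE|]; last by lia.
  by rewrite lez_nat; apply: hlam; rewrite aE bE.
case: (insubP _ (rev_ord j : nat)) => [b bn bE|nb'].
  case: insubP => [a _ aE|_]; first by lia.
  case: insubP => [a an aE|_]; last by lia.
  by rewrite lerN2 lez_nat; apply: hlam; rewrite aE bE /=; lia.
case: insubP => [a _ _|_]; first by lia.
by case: insubP => [a an _|] //; move: an nb' => /=; lia.
Qed.

Theorem proposition5p3 (R : realType) (q : R) (hq0 : 0 < q) (hq1 : q < 1)
    (n d : nat) (hn : (0 < n)%N) (hd : (0 < d)%N) (hnd : (2 * n <= d)%N)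
    (lam : 'I_n -> nat) (hlam : forall i j : 'I_n, (i <= j)%N -> (lam j <= lam i)%N)
    (V : vectType R[i]) (rep : uq_repr_on d q V)
    (hrep : is_L (natural_weight lam) rep) :
  let r (i : 'I_n) : int := (rho_vec i)%:Z in
  let l (i : 'I_n) : int := (lam i)%:Z in
  let m : int := d%:Z - 2 * n%:Z in
  qdim rep =
  (q ^ (2 * (2 * n%:Z - d%:Z - 1) * (weight_size lam)%:Z
          - 4 * (rho_pairing lam)%:Z)
   * \prod_(i < n)
       (qpoch (q ^ (2 * (1 + l i + r i))) (q ^+ 2) (d - 2 * n) ^+ 2
          / qpoch (q ^ (2 * (1 + r i))) (q ^+ 2) (d - 2 * n) ^+ 2
        * ((1 - q ^ (2 * (m + 1 + 2 * (l i + r i))))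
             / (1 - q ^ (2 * (m + 1 + 2 * r i)))))
   * \prod_(j < n) \prod_(k < n | (j < k)%N)
       ((1 - q ^ (2 * (m + 1 + l j + l k + r j + r k))) ^+ 2
          * (1 - q ^ (2 * (l j - l k + r j - r k))) ^+ 2
        / ((1 - q ^ (2 * (m + 1 + r j + r k))) ^+ 2
             * (1 - q ^ (2 * (r j - r k))) ^+ 2)))%:C.
Proof.
move=> r l m; have [irr _ [u u0 [uW uX]]] := hrep.
pose mu : 'I_d -> int := natural_weight lam.
pose s : seq int := [seq mu j - j%:Z | j <- enum 'I_d].
have size_s : size s = d by rewrite size_map size_enum_ord.
have sE (j : 'I_d) : s`_j = mu j - j%:Z.
  by rewrite (nth_map j) ?size_enum_ord // nth_ord_enum.
have s_dec i j : (i < j)%N -> (j < d)%N -> s`_j < s`_i.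
  move=> ij jd; have id := ltn_trans ij jd.
  have := natural_weight_decreasing hlam (i := Ordinal id) (j := Ordinal jd) (ltnW ij).
  by rewrite (sE (Ordinal id)) (sE (Ordinal jd)) -/mu /=; lia.
have hwu : highest q (gen_ops rep) mu u.
  split=> [j|i]; last exact: uX.
  have : u \in lker (rep (Uq_K q j) - (q%:C ^ mu j) *: \1%VF).
    by move: uW; apply/subvP; exact: (bigcapv_inf j).
  by rewrite memv_ker add_lfunE opp_lfunE scale_lfunE id_lfunE subr_eq0 => /eqP.
have hwg : highest q (gt_ops q size_s) mu (gt R d s (top_array d s)).
  have [K X] := gt_highest hq0 hq1 size_s; split=> [j|i]; last exact: X.
  by rewrite K sE subrK.
have [phi [phi_inj phi_surj phiE]] := highest_weight_iso hq0 hq1 (chevalley_gen_ops hq0 rep)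
  (gt_chevalley hq0 hq1 size_s) hwu hwg u0 (gt_top_neq0 hq0 hq1 size_s s_dec)
  (irreducible_gen_ops irr) (gt_irreducible hq0 hq1 size_s s_dec).
rewrite (qdim_value hq0 hq1 s_dec phi_inj phi_surj phiE); last exact: irreducible_gen_ops.
congr (_%:C); pose w j := s`_j + j%:Z.
have wE (j : 'I_d) : w j = mu j by rewrite /w sE; lia.
rewrite -(weyl_product_blocks hq0 hq1 (w := w) hnd).
- apply: eq_bigr => i _; apply: eq_bigr => j _; congr (qnum q _ / _).
  by rewrite /w; ring.
- move=> i; have id : (i < d)%N by have := ltn_ord i; lia.
  by rewrite (wE (Ordinal id)) /mu /natural_weight /= valK.
- move=> i; have iN := ltn_ord i; have id : (d.-1 - i < d)%N by lia.
  rewrite (wE (Ordinal id)) /mu /natural_weight insubF /=; last by lia.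
  have -> : (d - (d.-1 - i).+1)%N = i by lia.
  by rewrite valK.
- move=> t tm; have td : (n + t < d)%N by lia.
  by rewrite (wE (Ordinal td)) /mu /natural_weight !insubF //=; lia.
Qed.
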